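(* Let $d\in\mathbb{N}$ and $\sigma\in(0,1]$, with $\sigma<d/2$ if $d\in\{1,2\}$. Put $\alpha_0=\frac{d/2+\sigma}{2}$. Then $w_{\sigma,\alpha_0}=\kappa_{\sigma-\alpha_0}/\kappa_{-\alpha_0}$ is an optimal Hardy weight for $\Delta^\sigma$ on $\mathbb{Z}^d$, and as $|x|\to\infty$, \[ w_{\sigma,\alpha_0}(x)=\frac{c_{d,\sigma}}{|x|^{2\sigma}}+O\!\left(\frac{1}{|x|^{2\sigma+2}}\right),\qquad c_{d,\sigma}=4^{\sigma}\frac{\Gamma(\frac d4+\frac\sigma2)^2}{\Gamma(\frac d4-\frac\sigma2)^2}. \]
   Context: For $f:\mathbb{Z}^d\to\mathbb{R}$ let $\Delta f(x)=\sum_{y:|y-x|=1}(f(x)-f(y))$, where $|\cdot|$ is the Euclidean norm; $\Delta$ is a bounded nonnegative self-adjoint operator on $\ell^2(\mathbb{Z}^d)$, and $e^{-t\Delta}$ is its heat semigroup. $1_y$ denotes the indicator function of $\{y\}$. For $\sigma\in(0,1)$, $\Delta^\sigma$ is defined on $\ell^2(\mathbb{Z}^d)$ by the spectral theorem (equivalently $\Delta^\sigma f=\frac{1}{|\Gamma(-\sigma)|}\int_0^\infty (I-e^{-t\Delta})f\,\frac{dt}{t^{1+\sigma}}$), and $\Delta^1=\Delta$. For $\alpha\in(-d/2,1]$ the Riesz kernel $\kappa_\alpha:\mathbb{Z}^d\to[0,\infty)$ is defined by $\kappa_0=1_0$, $\kappa_1(x)=1_{\{|x|=1\}}$, $\kappa_\alpha(0)=0$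 if $\alpha\in(0,1)$, and otherwise $\kappa_\alpha(x)=\frac{1}{|\Gamma(-\alpha)|}\int_0^\infty e^{-t\Delta}1_0(x)\,\frac{dt}{t^{1+\alpha}}$. For $\sigma\in(0,1]$ and $\alpha\in(\sigma,d/2)$ set $w_{\sigma,\alpha}=\kappa_{\sigma-\alpha}/\kappa_{-\alpha}$. Let $Q^\sigma(f)=\frac12\sum_{x,y\in\mathbb{Z}^d}\kappa_\sigma(x-y)(f(x)-f(y))^2$ (which equals $\langle\Delta^\sigma\varphi,\varphi\rangle$ for finitely supported $\varphi$), and let $\mathcal{D}_0^\sigma$ be the closure of the finitely supported functions $C_c(\mathbb{Z}^d)$ with respect to the norm $\|\varphi\|_{\sigma,0}=\sqrt{Q^\sigma(\varphi)+|\varphi(0)|^2}$. A function $w:\mathbb{Z}^d\to[0,\infty)$ is a Hardy weight if $\langle\Delta^\sigma\varphi,\varphi\rangle\ge\sum_x w(x)|\varphi(x)|^2$ for all $\varphi\in C_c(\mathbb{Z}^d)$ (the inequality then extends to $\mathcal{D}_0^\sigma$). A Hardy weight $w$ is optimal if every Hardy weight $w'\ge w$ satisfies $w'=w$, and there is no nonzero $v\in\mathcal{D}_0^\sigma$ with $Q^\sigma(v)=\sum_x w(x)v(x)^2$ (no minimizer). *)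

(* Defs.v *)
From HB Require Import structures.
From mathcomp Require Import all_boot all_order all_algebra.
From mathcomp Require Import all_classical all_reals all_analysis.
Set Implicit Arguments. Unset Strict Implicit. Unset Printing Implicit Defensive.
Import Order.TTheory GRing.Theory Num.Theory.
Import numFieldNormedType.Exports.
Local Open Scope classical_set_scope.
Local Open Scope ring_scope.

Section Defs.
Variable R : realType.
Variable d : nat.

Definition Zd := 'rV[int]_d.

(* The i-th unit vector; the neighbours y of x with |y - x| = 1 are exactly
   x + e_i and x - e_i, i < d. *)
Definition unitv (i : 'I_d) : Zd := delta_mx 0 i.

Definition enorm (x : Zd) : R := Num.sqrt (\sum_(i < d) ((x 0 i)%:~R) ^+ 2).

Definition Lap (f : Zd -> R) : Zd -> R :=
  fun x => \sum_(i < d) ((f x - f (x + unitv i)) + (f x - f (x - unitv i))).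

Fixpoint Lap_pow (n : nat) : Zd -> R :=
  match n with
  | 0%N => fun x => if x == 0 then 1 else 0
  | n.+1 => Lap (Lap_pow n)
  end.

(* heat kernel e^{-t Delta} 1_0 (x) = sum_n (-t)^n/n! (Delta^n 1_0)(x)
   (exponential series of the bounded operator Delta). *)
Definition heat (t : R) (x : Zd) : R :=
  limn (fun N => \sum_(0 <= n < N) ((- t) ^+ n / (n`!)%:R * Lap_pow n x)).

(* Euler Gamma function: integral for s > 0, extended to non-positive
   non-integers by the functional equation Gamma(s) = Gamma(s+n)/(s(s+1)...(s+n-1)). *)
Definition Gamma_pos (s : R) : R :=
  fine (\int[@lebesgue_measure R]_(t in [set t : R | (0 < t)%R])
          ((powR t (s - 1)) * expR (- t))%R%:E)%E.

Definition Gamma (s : R) : R :=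
  if 0 < s then Gamma_pos s
  else let n := (`|Num.floor (- s)|%N).+1 in
       Gamma_pos (s + n%:R) / \prod_(k < n) (s + k%:R).

(* Riesz kernel kappa_alpha, alpha in (-d/2, 1]. *)
Definition kappa (a : R) (x : Zd) : R :=
  if a == 0 then (if x == 0 then 1 else 0)
  else if a == 1 then (if \sum_(i < d) (x 0 i) ^+ 2 == 1 then 1 else 0)
  else if (0 < a) && (a < 1) && (x == 0) then 0
  else fine (\int[@lebesgue_measure R]_(t in [set t : R | (0 < t)%R])
               (heat t x * powR t (- 1 - a))%R%:E)%E / `|Gamma (- a)|.

Definition wsa (s a : R) (x : Zd) : R := kappa (s - a) x / kappa (- a) x.

Definition Qs (s : R) (f : Zd -> R) : \bar R :=
  ((2^-1)%:E * \esum_(p in [set: Zd * Zd])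
       (kappa s (p.1 - p.2) * (f p.1 - f p.2) ^+ 2)%:E)%E.

Definition wsum (w : Zd -> R) (f : Zd -> R) : \bar R :=
  \esum_(x in [set: Zd]) (w x * f x ^+ 2)%:E.

Definition fin_supp (f : Zd -> R) : Prop := finite_set [set x | f x != 0].

(* D_0^sigma: closure of C_c w.r.t. ||.||_{sigma,0} *)
Definition D0 (s : R) (v : Zd -> R) : Prop :=
  exists u : nat -> Zd -> R, (forall n, fin_supp (u n)) /\
    ((fun n => Qs s (fun x => (v x - u n x)%R) + (`|v 0 - u n 0| ^+ 2)%R%:E)%E
       @ \oo --> 0%E).

Definition hardy_weight (s : R) (w : Zd -> R) : Prop :=
  (forall x, 0 <= w x) /\
  forall phi : Zd -> R, fin_supp phi -> (wsum w phi <= Qs s phi)%E.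

Definition optimal_hardy_weight (s : R) (w : Zd -> R) : Prop :=
  hardy_weight s w /\
  (forall w' : Zd -> R, hardy_weight s w' -> (forall x, w x <= w' x) -> w' = w) /\
  ~ (exists v : Zd -> R, D0 s v /\ v <> (fun _ => 0) /\ Qs s v = wsum w v).

End Defs.

(* Main.v *)
Require Import Defs.
From HB Require Import structures.
From mathcomp Require Import all_boot all_order all_algebra.
From mathcomp Require Import all_classical all_reals all_analysis.
From mathcomp Require Import measurable_realfun zify ring lra.
Set Implicit Arguments. Unset Strict Implicit. Unset Printing Implicit Defensive.
Import Order.TTheory GRing.Theory Num.Theory.
Import numFieldNormedType.Exports.
Local Open Scope classical_set_scope.
Local Open Scope ring_scope.

(* Write u = kappa_(-a0), f = kappa_(sigma-a0), w = f / u, and m for the sum of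
   kappa_sigma. Integrating the semigroup identity for the heat kernel against powers
   of time gives m u = f + kappa_sigma * u, that is, u solves the equation with
   potential w. Hence Q = h + (sum of w phi^2), where h is the nonnegative form with
   terms kappa_sigma(x-y) u(x) u(y) (phi(x)/u(x) - phi(y)/u(y))^2: this is the Hardy
   inequality.
   The truncations (u - eps)_+ are finitely supported with h bounded uniformly in eps,
   because eps times the sum of f over {u > eps} is bounded at the exponent a0.
   Averages of truncations whose mutual h-products are small have h arbitrarily small
   while staying above u(x0)/2 at a given point x0, so w cannot be increased.
   A minimiser v has h(v) = 0, so it is a multiple of u, and u is excluded because the
   sum of w u^2 = f u diverges logarithmically: f u decays like |x|^(-d).
   The asymptotics of u and f come from a local limit theorem with error O(1/t) for the
   heat kernel, which factors into one-dimensional kernels; these are controlled through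
   the recurrence n q(t,n) = t (q(t,n-1) - q(t,n+1)). *)

(** * Calculus on the half-line *)

(** For a general exponent a, u and f are of order |x|^(-2 (d/2 - a)) and |x|^(-2 (d/2 - a +
    sigma)). Bounding eps times the sum of f over {u > eps} needs a <= a0, and divergence of the sum
    of f u needs a >= a0, so a0 is the one exponent meeting both; equivalently, a1 = a0 - sigma
    satisfies a0 + a1 = d/2. The sum of u diverges, so identities are kept between nonnegative terms
    of the extended reals, negative terms being moved to the other side, and subtraction comes only
    after finiteness is known. For sigma < 1 the equation comes from the loss 1 - heat t 0
    integrated against t^(-sigma-1). At sigma = 1 that integral diverges at 0, and integration by
    parts against the heat equation takes its place. The weight is a quotient of kernels with
    relative error |x|^(-2). This calls for an error 1/t in the heat kernel, with enough decay in
    |x| / sqrt t to be integrated against powers of t down to 0. Instead of Fourier inversion, the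
    recurrence controls the ratios of consecutive values of the one-dimensional kernel, and their
    product yields the Gaussian. *)

Local Notation mu := lebesgue_measure.
Local Notation pos := [set t | (0 < t)%R].

Section Calculus.
Variable R : realType.
Implicit Types (a b c t x y : R) (f g df : R -> R).

Lemma is_derive_cts f (df : R) x : is_derive x 1 f df -> {for x, continuous f}.
Proof.
by move=> [h _]; apply: differentiable_continuous; exact/derivable1_diffP.
Qed.

Lemma derive_ge0_le f g a b : a <= b ->
  (forall x, a <= x <= b -> is_derive x 1 f (g x)) ->
  (forall x, a < x < b -> 0 <= g x) -> f a <= f b.
Proof.
move=> ab df g0.
apply: (@ger0_derive1_ndecr _ f a b _ _ _ a b) => //.
- move=> x /[!in_itv]/= /andP[ax xb].
  have /df[]// : a <= x <= b by rewrite !ltW.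
- move=> x /[!in_itv]/= /andP[ax xb].
  have /df[_] : a <= x <= b by rewrite !ltW.
  by rewrite derive1E => ->; exact/g0/andP.
- apply: continuous_in_subspaceT => x /[!inE]/= /[!in_itv]/= xab.
  exact: (is_derive_cts (df x xab)).
Qed.

Lemma derive_le0_ge f g a b : a <= b ->
  (forall x, a <= x <= b -> is_derive x 1 f (g x)) ->
  (forall x, a < x < b -> g x <= 0) -> f b <= f a.
Proof.
move=> ab df g0; rewrite -lerN2.
apply: (@derive_ge0_le (\- f) (\- g)) => // [x xab|x xab].
  exact: is_deriveN (df x xab).
by rewrite oppr_ge0; exact: g0.
Qed.

Lemma derC c x : is_derive x 1 (fun=> c) 0.
Proof. exact: is_derive_cst. Qed.

Lemma derI x : is_derive x 1 (fun t => t) 1.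
Proof. exact: is_derive_id. Qed.

Lemma derD f g (df dg : R) x : is_derive x 1 f df -> is_derive x 1 g dg ->
  is_derive x 1 (fun t => f t + g t) (df + dg).
Proof. by move=> h1 h2; exact: is_deriveD. Qed.

Lemma derN f (df : R) x : is_derive x 1 f df ->
  is_derive x 1 (fun t => - f t) (- df).
Proof. by move=> h1; exact: is_deriveN. Qed.

Lemma derB f g (df dg : R) x : is_derive x 1 f df -> is_derive x 1 g dg ->
  is_derive x 1 (fun t => f t - g t) (df - dg).
Proof. by move=> h1 h2; exact: is_deriveB. Qed.

Lemma derM f g (df dg : R) x : is_derive x 1 f df -> is_derive x 1 g dg ->
  is_derive x 1 (fun t => f t * g t) (df * g x + f x * dg).
Proof.
move=> h1 h2; apply: (is_derive_eq (is_deriveM h1 h2)).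
by rewrite /GRing.scale/= addrC (mulrC df).
Qed.

Lemma derX f (df : R) n x : is_derive x 1 f df ->
  is_derive x 1 (fun t => f t ^+ n.+1) (n.+1%:R * f x ^+ n * df).
Proof.
move=> h; elim: n => [|n IH].
  by apply: (is_derive_eq h); rewrite expr0 mul1r mul1r.
rewrite (_ : (fun _ => _) = fun t => f t * f t ^+ n.+1); last first.
  by apply/funext => t; rewrite exprS.
apply: (is_derive_eq (derM h IH)).
by rewrite -[n.+2]addn1 natrD exprS; ring.
Qed.

Lemma der_comp f g (df dg : R) x : is_derive (g x) 1 f df ->
  is_derive x 1 g dg -> is_derive x 1 (fun t => f (g t)) (df * dg).
Proof.
move=> h1 h2; apply: (is_derive_eq (is_derive1_comp h1 h2)).
by rewrite /GRing.scale/= mulrC.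
Qed.

Lemma der_exp f (df : R) x : is_derive x 1 f df ->
  is_derive x 1 (fun t => expR (f t)) (expR (f x) * df).
Proof. by move=> h; apply: der_comp h; exact: is_derive_expR. Qed.

Lemma measurable_affine a b : measurable_fun setT (fun x => a * x + b).
Proof. exact: measurable_funD (measurable_funM _ _) _. Qed.

Lemma measurable_powRZ a b : measurable_fun setT (fun t => a * t `^ b).
Proof.
apply: (@measurable_funM _ _ _ _ (cst a) (fun t => t `^ b)) => //.
Qed.

Lemma is_derive_powR_div a x : a != 0 -> 0 < x ->
  is_derive x 1 (fun t => t `^ a / a) (x `^ (a - 1)).
Proof.
move=> a0 x0.
have h := is_deriveM (is_derive1_powR a x0) (is_derive_cst (a^-1) x 1).
apply: (is_derive_eq h).
by rewrite scaler0 add0r /GRing.scale/= mulrA mulVf// mul1r.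
Qed.

Lemma cvg_powR0 a (u : nat -> R) : 0 < a -> (forall n, 0 < u n) ->
  u @ \oo --> 0 -> u n `^ a @[n --> \oo] --> 0.
Proof.
by move=> a0 u0 cu; have /cvg_at_rightP := powR_cvg0 a0; apply.
Qed.

Lemma cvg_sumr (T I : Type) (F : set_system T) {FF : Filter F} (r : seq I)
    (u : T -> I -> R) (l : I -> R) :
  (forall i, u ^~ i @ F --> l i) ->
  (fun n => \sum_(i <- r) u n i) @ F --> \sum_(i <- r) l i.
Proof.
move=> ul; elim: r => [|i r IH].
  by rewrite big_nil; under eq_fun do rewrite big_nil; exact: cvg_cst.
by rewrite big_cons; under eq_fun do rewrite big_cons; exact: cvgD.
Qed.

End Calculus.

(** * Affine substitution, Tonelli's theorem and integrals of powers *)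

Section Lebesgue.
Variable R : realType.
Local Open Scope ereal_scope.
Implicit Types (a b c : R).

(** Uniqueness of Lebesgue measure: [a] times its push-forward under [x -> a x + b] gives half-open
    intervals their length, hence equals it. *)
Lemma ge0_integral_affine (f : R -> \bar R) a b : (0 < a)%R ->
  measurable_fun setT f -> (forall x, 0 <= f x) ->
  \int[mu]_x f (a * x + b)%R = (a^-1)%:E * \int[mu]_x f x.
Proof.
move=> a0 mf f0.
pose phi : R -> measurableTypeR R := fun x => (a * x + b)%R.
have mphi : measurable_fun setT phi by exact: measurable_affine.
have push X : measurable X -> a%:E * pushforward mu phi X = mu X.
  move=> mX; apply/esym.
  pose nu : {measure set (measurableTypeR R) -> \bar R} :=
    mscale (NngNum (ltW a0)) (pushforward mu phi).
  apply: (@lebesgue_measure_unique R (nu mphi)) => // _ [[x y]/= _ <-].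
  rewrite /nu/= /mscale/= /pushforward.
  rewrite (_ : phi @^-1` _ = `]((x - b) / a)%R, ((y - b) / a)%R]%classic).
    rewrite !lebesgue_measure_itv/= !lte_fin.
    rewrite ltr_pM2r ?invr_gt0// ltrD2r.
    case: ifPn => _; last by rewrite mule0.
    by rewrite -!EFinD -EFinM; congr EFin; field; rewrite gt_eqF.
  apply/seteqP; split => z/=; rewrite !in_itv/= /phi.
    by rewrite ltr_pdivrMr// ler_pdivlMr// ltrBlDr lerBrDr mulrC.
  by rewrite ltr_pdivrMr// ler_pdivlMr// ltrBlDr lerBrDr (mulrC z).
have a1 : (0 <= a^-1)%R by rewrite invr_ge0 ltW.
transitivity (\int[pushforward mu phi]_x f x).
  by rewrite ge0_integral_pushforward.
transitivity (\int[mscale (NngNum a1) mu]_x f x).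
  apply: eq_measure_integral => A mA _.
  transitivity ((a^-1)%:E * (a%:E * pushforward mu phi A)).
    by rewrite muleA -EFinM mulVf ?mul1e// gt_eqF.
  by congr (_ * _); exact: push.
by rewrite ge0_integral_mscale.
Qed.

Lemma posE : (pos : set R) = `]0%R, +oo[%classic.
Proof. by apply/seteqP; split => x/=; rewrite in_itv/= andbT. Qed.

Lemma measurable_pos : measurable (pos : set R).
Proof. by rewrite posE. Qed.

(** Nonnegativity is available on the product of [A] and [B] only, so the integrand is extended by 0
    outside before Tonelli's theorem is applied on the plane. *)
Lemma ge0_tonelli (A B : set R) (f : R -> R -> \bar R) :
  measurable A -> measurable B ->
  measurable_fun setT (fun p : R * R => f p.1 p.2) ->
  (forall t s, A t -> B s -> 0 <= f t s) ->
  \int[mu]_(t in A) \int[mu]_(s in B) f t s =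
  \int[mu]_(s in B) \int[mu]_(t in A) f t s.
Proof.
move=> mA mB mf f0.
rewrite integral_mkcond [RHS]integral_mkcond.
pose g (p : R * R) := ((fun p => f p.1 p.2) \_ (A `*` B)) p.
have gE t s : g (t, s) = if (t \in A) && (s \in B) then f t s else 0.
  by rewrite /g patchE in_setX.
transitivity (\int[mu]_t \int[mu]_s g (t, s)).
  apply: eq_integral => t _; rewrite patchE; case: ifPn => tA.
    rewrite integral_mkcond; apply: eq_integral => s _.
    by rewrite gE tA/= patchE.
  rewrite (eq_integral (cst 0)) ?integral0// => s _.
  by rewrite gE (negbTE tA).
rewrite (@fubini_tonelli _ _ _ _ _ mu mu g); last 2 first.
- by apply/(measurable_restrictT _ (measurableX _ _)) => //; exact: measurable_funTS.
- move=> [t s]; rewrite gE; case: ifPn => // /andP[/[!inE] At Bs].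
  exact: f0.
apply: eq_integral => s _; rewrite patchE; case: ifPn => sB.
  rewrite [RHS]integral_mkcond; apply: eq_integral => t _.
  by rewrite gE sB andbT patchE.
rewrite (eq_integral (cst 0)) ?integral0 ?patchE ?(negbTE sB)// => t _.
by rewrite gE (negbTE sB) andbF.
Qed.

Lemma measurable_integral_snd (A B : set R) (f : R -> R -> \bar R) :
  measurable B -> measurable_fun setT (fun p : R * R => f p.1 p.2) ->
  (forall t s, B s -> 0 <= f t s) ->
  measurable_fun A (fun t => \int[mu]_(s in B) f t s).
Proof.
move=> mB mf f0; apply: measurable_funTS.
pose g (p : R * R) := ((fun p => f p.1 p.2) \_ (setT `*` B)) p.
rewrite (_ : (fun _ => _) = fun t => \int[mu]_s g (t, s)).
  apply: measurable_fun_fubini_tonelli_F.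
  - by apply/(measurable_restrictT _ (measurableX _ _)) => //; exact: measurable_funTS.
  - move=> [t s]; rewrite /g patchE; case: ifPn => // /[!inE] -[_ Bs].
    exact: f0.
apply/funext => t; rewrite integral_mkcond; apply: eq_integral => s _.
by rewrite /g !patchE in_setX in_setT.
Qed.

(* Monotone limit of the integrals over [c / (n + 1) <= t <= c]. *)
Lemma integral_powR_0 (a c : R) : (0 < a)%R -> (0 < c)%R ->
  \int[mu]_(t in `]0%R, c]) (t `^ (a - 1))%:E = (c `^ a / a)%:E.
Proof.
move=> a0 c0.
pose F n := `[(c / n.+1%:R)%R, c]%classic.
have cn n : (0 < c / n.+1%:R)%R by rewrite divr_gt0.
have FE : \bigcup_n F n = `]0%R, c]%classic.
  apply/seteqP; split => t/=.
    move=> [n _]; rewrite /F/= !in_itv/= => /andP[h ->].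
    by rewrite (lt_le_trans _ h).
  rewrite in_itv/= => /andP[t0 tc]; exists (Num.truncn (c / t)) => //.
  rewrite /F/= in_itv/= tc andbT ler_pdivrMr// mulrC -ler_pdivrMr//.
  exact/ltW/truncnS_gt.
have h1 : \int[mu]_(t in F i) (t `^ (a - 1))%:E @[i --> \oo] -->
    \int[mu]_(t in `]0%R, c]) (t `^ (a - 1))%:E.
  rewrite -FE; apply: ge0_nondecreasing_set_cvg_integral => //.
  - move=> m n mn; rewrite subsetEset => t; rewrite /F/= !in_itv/=.
    move=> /andP[h ->]; rewrite (le_trans _ h)//.
    by rewrite ler_pM2l// lef_pV2 ?posrE// ler_nat.
  - by move=> n; rewrite /F; exact: measurable_itv.
  - move=> n; apply/measurable_EFinP; apply: measurable_funTS.
    exact: measurable_powR.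
  - by move=> n x _; rewrite lee_fin powR_ge0.
have cvc : (c / n.+1%:R)%R @[n --> \oo] --> (0 : R)%R.
  rewrite -[X in _ --> X](mulr0 c); apply: cvgMl_tmp.
  exact: cvg_harmonic.
have h2 : \int[mu]_(t in F i) (t `^ (a - 1))%:E @[i --> \oo] --> (c `^ a / a)%:E.
  (* [F 0] is the single point [c], and the fundamental theorem needs distinct endpoints; hence the
     shift by one. *)
  rewrite -cvg_shiftS/=.
  rewrite (_ : (fun _ => _) =
    fun n => ((c `^ a / a - (c / n.+2%:R) `^ a / a)%:E)); last first.
    apply/funext => n; rewrite /F.
    have dd (x : R) : (0 < x)%R -> is_derive x 1%R (fun t : R => t `^ a / a)%R
        (x `^ (a - 1))%R by move=> x0; apply: is_derive_powR_div => //; rewrite gt_eqF.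
    have cc (x : R) : (0 < x)%R -> {for x, continuous (fun t : R => t `^ a / a)%R}.
      by move=> x0; exact: (is_derive_cts (dd x x0)).
    rewrite (@continuous_FTC2 _ _ (fun t => t `^ a / a)%R)//.
    - by rewrite ltr_pdivrMr// ltr_pMr// ltr1n.
    - apply: continuous_in_subspaceT => x /[!inE]/= /[!in_itv]/= /andP[cx _].
      exact: (is_derive_cts (is_derive1_powR (a - 1) (lt_le_trans (cn _) cx))).
    - split.
      + move=> x /[!in_itv]/= /andP[cx _].
        by have [] := dd x (lt_trans (cn _) cx).
      + exact/cvg_at_right_filter/cc.
      + exact/cvg_at_left_filter/cc.
    - move=> x /[!in_itv]/= /andP[cx _].
      by rewrite derive1E; have [_ ->] := dd x (lt_trans (cn _) cx).
  apply: cvg_EFin; first by near=> n.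
  rewrite -[X in _ --> X]subr0; apply: cvgB; first exact: cvg_cst.
  rewrite -(mul0r (a^-1)%R); apply: cvgMr_tmp.
  apply: (@cvg_powR0 _ _ (fun n => c / n.+2%:R)%R) => //.
  by have := cvc; rewrite -cvg_shiftS.
exact: (cvg_unique _ h1 h2).
Unshelve. all: by end_near. Qed.

End Lebesgue.

Section PowerIntegrals.
Variable R : realType.
Implicit Types (a b c x : R).

Lemma cvg_powRN_oo b : 0 < b -> t `^ (- b) @[t --> +oo] --> (0 : R).
Proof.
move=> b0; apply/cvgrPdist_le => e e0; near=> t.
have t0 : 0 < t by [].
rewrite sub0r normrN ger0_norm ?powR_ge0// powRN.
rewrite invf_ple ?posrE ?powR_gt0//.
have -> : e^-1 = (e^-1 `^ b^-1) `^ b.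
  by rewrite -powRrM mulVf ?gt_eqF// powRr1// invr_ge0 ltW.
rewrite ge0_ler_powR ?nnegrE ?powR_ge0 ?ltW//.
Unshelve. all: by end_near. Qed.

Lemma integral_powR_oo b c : 0 < b -> 0 < c ->
  (\int[mu]_(t in `[c, +oo[) (t `^ (- b - 1))%:E = (c `^ (- b) / b)%:E)%E.
Proof.
move=> b0 c0.
have dd x : 0 < x -> is_derive x 1 (fun t => t `^ (- b) / (- b)) (x `^ (- b - 1)).
  by move=> x0; apply: is_derive_powR_div => //; rewrite oppr_eq0 gt_eqF.
rewrite (@ge0_continuous_FTC2y _ _ (fun t => t `^ (- b) / (- b)) _ 0)//.
- by rewrite sub0e -EFinN invrN mulrN opprK.
- by move=> x _; rewrite powR_ge0.
- apply: continuous_in_subspaceT => x /[!inE]/= /[!in_itv]/= /andP[cx _].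
  exact: (is_derive_cts (is_derive1_powR (- b - 1) (lt_le_trans c0 cx))).
- rewrite -[X in _ --> X](mul0r (- b)^-1); apply: cvgMr_tmp.
  exact: cvg_powRN_oo.
- by move=> x cx; have [] := dd x (lt_trans c0 cx).
- by apply: cvg_at_right_filter; exact: (is_derive_cts (dd c c0)).
- move=> x /[!in_itv]/= /andP[cx _].
  by rewrite derive1E; have [_ ->] := dd x (lt_trans c0 cx).
Qed.

Lemma integral_expR_oo c :
  (\int[mu]_(t in `[c, +oo[) (expR (- t))%:E = (expR (- c))%:E)%E.
Proof.
have dd x : is_derive x 1 (fun t => - expR (- t)) (expR (- x)).
  have h := is_deriveN (is_derive1_comp (is_derive_expR (- x)) (is_deriveN (is_derive_id x (1:R)))).
  apply: (is_derive_eq h).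
  by rewrite /GRing.scale/= mulrN1 opprK.
rewrite (@ge0_continuous_FTC2y _ _ (fun t => - expR (- t)) _ 0)//.
- by rewrite sub0e -EFinN opprK.
- apply: continuous_in_subspaceT => x _.
  apply: continuous_comp; first exact: opp_continuous.
  exact: continuous_expR.
- by rewrite -[X in _ --> X]oppr0; apply: cvgN; exact: cvgr_expR.
- by apply: cvg_at_right_filter; exact: (is_derive_cts (dd c)).
- by move=> x _; rewrite derive1E; have [_ ->] := dd x.
Qed.

End PowerIntegrals.

Section PositiveHalfLine.
Variable R : realType.
Implicit Types (a b c t : R) (f g : R -> R) (D : set R).

Lemma le_integralR D f g : measurable D -> measurable_fun D f ->
  measurable_fun D g -> (forall t, D t -> 0 <= f t) ->
  (forall t, D t -> f t <= g t) ->
  (\int[mu]_(t in D) (f t)%:E <= \int[mu]_(t in D) (g t)%:E)%E.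
Proof.
move=> mD mf mg f0 fg; apply: ge0_le_integral => //.
- exact/measurable_EFinP.
- exact/measurable_EFinP.
Qed.

Lemma ge0_integralZlR D f k : measurable D -> measurable_fun D f ->
  (forall t, D t -> 0 <= f t) -> 0 <= k ->
  (\int[mu]_(t in D) (k * f t)%:E = k%:E * \int[mu]_(t in D) (f t)%:E)%E.
Proof.
move=> mD mf f0 k0; under eq_integral do rewrite EFinM.
rewrite ge0_integralZl//.
exact/measurable_EFinP.
Qed.

Lemma integral_pos_split c f : 0 < c -> measurable_fun setT f ->
  (forall t, 0 < t -> 0 <= f t) ->
  (\int[mu]_(t in pos) (f t)%:E =
   \int[mu]_(t in `]0%R, c]) (f t)%:E + \int[mu]_(t in `[c, +oo[) (f t)%:E)%E.
Proof.
move=> c0 mf f0.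
have mfD D : measurable_fun D (fun t => (f t)%:E).
  by apply/measurable_EFinP; exact: measurable_funTS.
rewrite -(@integral_itv_obnd_cbnd _ c)//.
have -> : pos = `]0, c]%classic `|` `]c, +oo[%classic :> set R.
  apply/seteqP; split => t /=; rewrite !in_itv/= andbT.
    by move=> ->; have [tc|tc] := leP t c; [left|right].
  by case=> [/andP[]//|]; exact: lt_trans.
rewrite ge0_integral_setU//.
- exact: mfD.
- move=> t /= tD; rewrite lee_fin f0//; move: tD; rewrite !in_itv/= andbT.
  by case=> [/andP[]//|]; exact: lt_trans.
- apply/disj_setPS => t/= []; rewrite !in_itv/= andbT => /andP[_ h1] h2.
  by move: h1; rewrite leNgt h2.
Qed.

(** The common tool for convergence at both ends. The splitting point [c] is left free because later
    estimates take it at the square of a radius, the diffusive time scale. *)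
Lemma integral_pos_bound a b c C1 C2 f : 0 < a -> 0 < b -> 0 < c ->
  0 <= C1 -> 0 <= C2 -> measurable_fun setT f ->
  (forall t, 0 < t -> 0 <= f t) ->
  (forall t, 0 < t -> t <= c -> f t <= C1 * t `^ (a - 1)) ->
  (forall t, c <= t -> f t <= C2 * t `^ (- b - 1)) ->
  (\int[mu]_(t in pos) (f t)%:E <=
   (C1 * (c `^ a / a) + C2 * (c `^ (- b) / b))%:E)%E.
Proof.
move=> a0 b0 c0 C10 C20 mf f0 f1 f2; rewrite (integral_pos_split c0)// EFinD.
apply: leeD.
  rewrite EFinM -integral_powR_0// -ge0_integralZlR//.
  - apply: le_integralR => //; first exact: measurable_funTS.
    + apply: measurable_funTS; exact: measurable_powRZ.
    + by move=> t; rewrite /= in_itv/= => /andP[t0 _]; exact: f0.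
    + by move=> t; rewrite /= in_itv/= => /andP[t0 tc]; exact: f1.
  - by apply: measurable_funTS; exact: measurable_powR.
  - by move=> t _; exact: powR_ge0.
rewrite EFinM -integral_powR_oo// -ge0_integralZlR//.
- apply: le_integralR => //; first exact: measurable_funTS.
  + apply: measurable_funTS; exact: measurable_powRZ.
  + move=> t; rewrite /= in_itv/= andbT => tc.
    by apply: f0; exact: lt_le_trans tc.
  + by move=> t; rewrite /= in_itv/= andbT => tc; exact: f2.
- by apply: measurable_funTS; exact: measurable_powR.
- by move=> t _; exact: powR_ge0.
Qed.

(** With [y = c t / b] one has [t^b = (b / c)^b y^b], and [ln y <= y] gives
    [y^b <= exp (b y) = exp (c t)]. For [b = 0] the constant reads [0^0 = 1]. *)
Lemma powR_le_expR b c : 0 <= b -> 0 < c ->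
  exists2 C, 0 < C & forall t, 0 <= t -> t `^ b <= C * expR (c * t).
Proof.
move=> b0 c0; exists ((b / c) `^ b); last first.
  move=> t; rewrite le_eqVlt => /predU1P[<-|t0].
    rewrite mulr0 expR0 mulr1; have [->|bn0] := eqVneq b 0.
      by rewrite !powRr0.
    by rewrite powR0// powR_ge0.
  have [->|bn0] := eqVneq b 0.
    by rewrite !powRr0 mul1r -expR0 ler_expR mulr_ge0// ltW.
  have {bn0}b0 : 0 < b by rewrite lt_def bn0.
  rewrite {1}(_ : t = (b / c) * (c * t / b)); last first.
    by field; rewrite !gt_eqF.
  have ctb : 0 < c * t / b by rewrite divr_gt0 ?mulr_gt0.
  have bc : 0 < b / c by rewrite divr_gt0.
  rewrite (powRM _ (ltW bc) (ltW ctb)) ler_pM2l ?powR_gt0//.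
  rewrite /powR gt_eqF// ler_expR.
  have : ln (c * t / b) <= c * t / b by exact/ltW/ln_sublinear.
  by rewrite ler_pdivlMr// mulrC.
have [->|bn0] := eqVneq b 0; first by rewrite powRr0.
by rewrite powR_gt0// divr_gt0// lt_def bn0.
Qed.

End PositiveHalfLine.

Section Esum.
Variables (R : realType) (T : choiceType).
Implicit Types (f g : T -> \bar R) (k : R).

(** One inequality suffices: applied to the factor [k^-1] and the family [k f], it gives the
    converse. *)
Lemma esumZl f k : 0 <= k -> (forall x, (0 <= f x)%E) ->
  (\esum_(x in setT) (k%:E * f x) = k%:E * \esum_(x in setT) f x)%E.
Proof.
have half f' k' : 0 <= k' -> (forall x, (0 <= f' x)%E) ->
  (\esum_(x in setT) (k'%:E * f' x) <= k'%:E * \esum_(x in setT) f' x)%E.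
  move=> k0 f0; apply: ge_ereal_sup => _ [X [finX _] <-].
  rewrite -ge0_mule_fsumr//; apply: lee_wpmul2l; first by rewrite lee_fin.
  by apply: esum_ge; exists X.
move=> k0 f0; apply/eqP; rewrite eq_le half//=.
have [->|kn0] := eqVneq k 0; first by rewrite mul0e esum_ge0// => x _; rewrite mul0e.
have k1 : 0 < k by rewrite lt_def kn0.
have := half (fun x => k%:E * f x)%E k^-1; rewrite invr_ge0 => /(_ k0).
move=> /(_ (fun x => mule_ge0 (k0 : (0 <= k%:E)%E) (f0 x))) h.
rewrite -(@lee_pmul2l _ (k^-1)%:E) ?lte_fin ?invr_gt0//.
rewrite muleA -EFinM mulVf// mul1e; apply: le_trans h.
by under [leRHS]eq_esum do rewrite muleA -EFinM mulVf// mul1e.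
Qed.

Lemma esum_ge_term f x : (forall y, (0 <= f y)%E) ->
  (f x <= \esum_(y in setT) f y)%E.
Proof.
move=> f0; apply: esum_ge; exists [set x]; first by split.
by rewrite fsbig_set1.
Qed.

Lemma esum_single f x : (forall y, (0 <= f y)%E) ->
  (forall y, y != x -> f y = 0%E) -> (\esum_(y in setT) f y = f x)%E.
Proof.
move=> f0 fx; rewrite (esumID [set x])// !setTI esum_set1// esum1 ?adde0//.
by move=> y /= /eqP; exact: fx.
Qed.

End Esum.

(** * The Gamma integral and integrals of powers against exponentials *)

Section GammaFunction.
Variable R : realType.
Implicit Types (a b c s t : R).

Let ker (s t : R) := t `^ (s - 1) * expR (- t).

Lemma measurable_gamma_ker s :
  measurable_fun setT (fun t => t `^ (s - 1) * expR (- t)).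
Proof.
apply: measurable_funM; first exact: measurable_powR.
by apply: measurableT_comp.
Qed.

Let mker s : measurable_fun setT (ker s) := measurable_gamma_ker s.

Let ker_ge0 s t : 0 <= ker s t.
Proof. by rewrite mulr_ge0 ?powR_ge0 ?expR_ge0. Qed.

(** [Gamma_pos] is a [fine], so the content is finiteness of the integral: [t^(s-1)] dominates up to
    1, and [t^(s+1) <= C exp t] gives decay [t^(-2)] beyond. *)
Lemma Gamma_pos_integral s : 0 < s ->
  (\int[mu]_(t in pos) (t `^ (s - 1) * expR (- t))%:E = (Gamma_pos s)%:E)%E.
Proof.
move=> s0; rewrite /Gamma_pos fineK// ge0_fin_numE; last first.
  by apply: integral_ge0 => t _; rewrite lee_fin ker_ge0.
have [C C0 hC] := @powR_le_expR R (s + 1) 1 (addr_ge0 (ltW s0) ler01) ltr01.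
apply: le_lt_trans (_ : _ <=
  (1 * (1 `^ s / s) + C * (1 `^ (- 1) / 1))%:E)%E _; last exact: ltry.
apply: (@integral_pos_bound R s 1 1 1 C) => //; first exact: ltW.
- exact: measurable_gamma_ker.
- by move=> t t0; exact: ker_ge0.
- by move=> t t0 t1; rewrite mul1r ger_pMr ?powR_gt0// -expR0 ler_expR oppr_le0 ltW.
- move=> t t1; have t0 : 0 < t by rewrite (lt_le_trans _ t1).
  rewrite expRN ler_pdivrMr ?expR_gt0//.
  rewrite -[s - 1](_ : (s + 1) + (- 1 - 1) = _); last by ring.
  rewrite powRD; last by rewrite (gt_eqF t0) implybT.
  rewrite [leRHS]mulrAC ler_pM2r ?powR_gt0//.
  by have := hC t (ltW t0); rewrite mul1r.
Qed.

Lemma Gamma_pos_gt0 s : 0 < s -> 0 < Gamma_pos s.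
Proof.
move=> s0; rewrite -lte_fin -Gamma_pos_integral//.
have h : (0 < (expR (- 1) * (1 `^ s / s))%:E)%E.
  by rewrite lte_fin mulr_gt0 ?expR_gt0// powR1 divr_gt0.
apply: (lt_le_trans h).
rewrite (integral_pos_split ltr01); last 2 first.
- exact: mker.
- by move=> t _; exact: ker_ge0.
rewrite EFinM -integral_powR_0// -ge0_integralZlR//.
- rewrite -[leLHS]adde0; apply: leeD; last first.
    by apply: integral_ge0 => t _; rewrite lee_fin ker_ge0.
  apply: le_integralR => //.
  + apply: measurable_funTS; exact: measurable_powRZ.
  + by apply: measurable_funTS; exact: mker.
  + by move=> t _; rewrite mulr_ge0 ?expR_ge0 ?powR_ge0.
  + move=> t; rewrite /= in_itv/= => /andP[t0 t1].
    by rewrite mulrC ler_pM2l ?powR_gt0// ler_expR lerN2.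
- by apply: measurable_funTS; exact: measurable_powR.
- by move=> t _; exact: powR_ge0.
Qed.

Lemma measurable_set_le (f g : R * R -> R) : measurable_fun setT f ->
  measurable_fun setT g -> measurable [set p : R * R | f p <= g p].
Proof.
move=> mf mg; have h := measurable_fun_ler mf mg.
have := h measurableT [set true]; rewrite setTI; exact.
Qed.

Lemma in_pos t : (t \in pos) = (0 < t).
Proof. by apply/idP/idP; rewrite inE. Qed.

Lemma in_itv_ge t s : (s \in `[t, +oo[%classic) = (t <= s).
Proof. by rewrite mem_setE in_itv/= andbT. Qed.

Lemma in_itv_oc t s : (t \in `]0, s]%classic) = (0 < t) && (t <= s).
Proof. by rewrite mem_setE in_itv. Qed.

Lemma indic_le (f g : R * R -> R) p :
  \1_[set p : R * R | f p <= g p] p = (f p <= g p)%R%:R :> R.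
Proof. by rewrite indicE; congr ((nat_of_bool _)%:R); apply/idP/idP; rewrite inE. Qed.

(** Both sides integrate [f t * g s] over [0 < t <= s]; the indicator of [t <= s] turns the moving
    bounds into a product domain. *)
Lemma tonelli_triangle (f g : R -> R) :
  measurable_fun setT f -> measurable_fun setT g ->
  (forall t, 0 < t -> 0 <= f t) -> (forall t, 0 < t -> 0 <= g t) ->
  (\int[mu]_(t in pos) ((f t)%:E * \int[mu]_(s in `[t, +oo[) (g s)%:E) =
   \int[mu]_(s in pos) ((g s)%:E * \int[mu]_(t in `]0%R, s]) (f t)%:E))%E.
Proof.
move=> mf mg f0 g0.
pose h t s : \bar R := (f t * g s * \1_[set p : R * R | p.1 <= p.2] (t, s))%:E.
have mh : measurable_fun setT (fun p : R * R => h p.1 p.2).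
  apply/measurable_EFinP; apply: measurable_funM.
    apply: measurable_funM; exact: measurableT_comp.
  rewrite (_ : (fun _ => _) = \1_[set p : R * R | p.1 <= p.2]).
    by apply/measurable_indicP; exact: measurable_set_le.
  by apply/funext => -[].
transitivity (\int[mu]_(t in pos) \int[mu]_(s in pos) h t s)%E.
  apply: eq_integral => t /[!inE] t0.
  rewrite -ge0_integralZl//.
  - rewrite [RHS]integral_mkcond [LHS]integral_mkcond.
    apply: eq_integral => s _.
    rewrite !patchE in_pos in_itv_ge /h (indic_le fst snd)/=.
    have [ts|st] := leP t s; last by rewrite mulr0; case: ifP.
    by rewrite (lt_le_trans t0 ts) mulr1 EFinM.
  - by apply/measurable_EFinP; exact: measurable_funTS.
  - move=> s; rewrite /= in_itv/= andbT => ts.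
    by rewrite lee_fin g0// (lt_le_trans t0).
  - by rewrite lee_fin f0.
rewrite ge0_tonelli//; last 3 first.
- exact: measurable_pos.
- exact: measurable_pos.
- by move=> t s /= t0 s0; rewrite lee_fin !mulr_ge0 ?f0 ?g0// indicE ler0n.
apply: eq_integral => s /[!inE] s0.
rewrite -ge0_integralZl//.
- rewrite [RHS]integral_mkcond [LHS]integral_mkcond.
  apply: eq_integral => t _.
  rewrite !patchE in_pos in_itv_oc /h (indic_le fst snd)/=.
  have [ts|st] := leP t s; last by rewrite mulr0 andbF; case: ifP.
  by rewrite andbT mulr1 mulrC EFinM.
- by apply/measurable_EFinP; exact: measurable_funTS.
- by move=> t; rewrite /= in_itv/= => /andP[t0 _]; rewrite lee_fin f0.
- by rewrite lee_fin g0.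
Qed.

(* Integration by parts in layer-cake form, from [s^a = int_0^s a t^(a-1) dt]. *)
Lemma integral_powR_layer a (g : R -> R) : 0 < a -> measurable_fun setT g ->
  (forall t, 0 < t -> 0 <= g t) ->
  (\int[mu]_(t in pos) ((a * t `^ (a - 1))%:E * \int[mu]_(s in `[t, +oo[) (g s)%:E) =
   \int[mu]_(s in pos) (g s * s `^ a)%:E)%E.
Proof.
move=> a0 mg g0.
rewrite (@tonelli_triangle (fun t => a * t `^ (a - 1)) g)//.
- apply: eq_integral => s /[!inE] s0; rewrite EFinM; congr (_ * _)%E.
  rewrite ge0_integralZlR//.
  - by rewrite integral_powR_0// -EFinM mulrCA divff ?gt_eqF// mulr1.
  - by apply: measurable_funTS; exact: measurable_powR.
  - by move=> t _; exact: powR_ge0.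
  - exact: ltW.
- exact: measurable_powRZ.
- by move=> t t0; rewrite mulr_ge0 ?powR_ge0// ltW.
Qed.

(** Integration by parts in the form of [integral_powR_layer], the function [exp (- t)] being its
    own tail integral. *)
Lemma Gamma_posS s : 0 < s -> Gamma_pos (s + 1) = s * Gamma_pos s.
Proof.
move=> s0; apply: EFin_inj; rewrite -Gamma_pos_integral ?addr_gt0//.
rewrite EFinM -Gamma_pos_integral// -ge0_integralZlR//; first last.
- exact: ltW.
- by move=> t _; exact: ker_ge0.
- by apply: measurable_funTS; exact: measurable_gamma_ker.
- exact: measurable_pos.
under eq_integral do rewrite addrK mulrC.
rewrite -integral_powR_layer//.
  apply: eq_integral => t _; rewrite integral_expR_oo -EFinM.
  by rewrite mulrA.
by apply: measurableT_comp.
Qed.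

(* Obtained without a change of variables, writing
   [expR (- c / t)] as the integral of [expR (- v)] over [c / t <= v]. *)
Lemma integral_powR_expR_inv b c : 0 < b -> 0 < c ->
  (\int[mu]_(t in pos) (t `^ (- b - 1) * expR (- (c / t)))%:E =
   (c `^ (- b) * Gamma_pos b)%:E)%E.
Proof.
move=> b0 c0.
pose h t v : \bar R := (t `^ (- b - 1) * expR (- v) *
  \1_[set p : R * R | c <= p.2 * p.1] (t, v))%:E.
have mh : measurable_fun setT (fun p : R * R => h p.1 p.2).
  apply/measurable_EFinP; apply: measurable_funM.
    apply: measurable_funM.
      apply: (@measurableT_comp _ _ _ _ _ _ (fun t => t `^ (- b - 1))) => //.
    by apply: measurableT_comp => //; apply: measurableT_comp.
  rewrite (_ : (fun _ => _) = \1_[set p : R * R | c <= p.2 * p.1]).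
    by apply/measurable_indicP; apply: measurable_set_le => //; exact: measurable_funM.
  by apply/funext => -[].
transitivity (\int[mu]_(t in pos) \int[mu]_(v in pos) h t v)%E.
  apply: eq_integral => t /[!inE] t0.
  rewrite EFinM -integral_expR_oo -ge0_integralZl//.
  - rewrite [RHS]integral_mkcond [LHS]integral_mkcond.
    apply: eq_integral => v _; rewrite !patchE in_pos in_itv_ge /h.
    rewrite (indic_le (cst c) (fun p => p.2 * p.1) (t, v))/= ler_pdivrMr//.
    have [ts|st] := leP c (v * t); last by rewrite mulr0; case: ifP.
    have v0 : 0 < v by rewrite -(pmulr_lgt0 _ t0) (lt_le_trans c0).
    by rewrite v0 mulr1 EFinM.
  - apply/measurable_EFinP; apply: measurable_funTS.
    by apply: measurableT_comp.
  - by rewrite lee_fin powR_ge0.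
rewrite ge0_tonelli//; last 3 first.
- exact: measurable_pos.
- exact: measurable_pos.
- by move=> t s /= t0 s0; rewrite lee_fin !mulr_ge0 ?powR_ge0 ?expR_ge0// indicE ler0n.
(* Integrating out [t] first leaves [(c / v)^(-b) / b], whose factor [v^b] produces the integrand of
   [Gamma_pos (b + 1)]. *)
have -> : Gamma_pos b = Gamma_pos (b + 1) / b.
  by rewrite Gamma_posS// mulrC mulKf// gt_eqF.
rewrite mulrCA mulrC EFinM -Gamma_pos_integral ?addr_gt0// -ge0_integralZlR//; first last.
- by rewrite divr_ge0 ?powR_ge0 ?ltW.
- by move=> t _; exact: ker_ge0.
- by apply: measurable_funTS; exact: measurable_gamma_ker.
- exact: measurable_pos.
apply: eq_integral => v /[!inE] v0.
have cv : 0 < c / v by rewrite divr_gt0.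
transitivity (\int[mu]_(t in `[(c / v)%R, +oo[) (expR (- v) * t `^ (- b - 1))%:E)%E.
  rewrite [RHS]integral_mkcond [LHS]integral_mkcond.
  apply: eq_integral => t _; rewrite !patchE in_pos in_itv_ge /h.
  rewrite (indic_le (cst c) (fun p => p.2 * p.1) (t, v))/= ler_pdivrMr//.
  rewrite [t * v]mulrC [X in X%:E]mulrC.
  have [ts|st] := leP c (v * t); last by rewrite mul0r; case: ifP.
  have t0 : 0 < t by rewrite -(pmulr_rgt0 _ v0) (lt_le_trans c0).
  by rewrite t0 mul1r [in RHS]mulrC.
rewrite ge0_integralZlR//; last 2 first.
- by apply: measurable_funTS; exact: measurable_powR.
- by move=> t _; exact: powR_ge0.
rewrite integral_powR_oo// -EFinM; congr EFin.
rewrite addrK powRM ?invr_ge0 ?ltW// -powR_inv1 ?ltW// -powRrM mulN1r opprK.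
by ring.
Qed.

End GammaFunction.

(** * The heat kernel *)

Section ExponentialSeries.
Variable R : realType.
Implicit Types (c : nat -> R) (M B K t : R).

Lemma cvg_pseries_exp c M B K :
  (forall n, `|c n| <= M * B ^+ n / n`!%:R) -> cvgn (pseries c K).
Proof.
move=> hc; apply: normed_cvg.
have M0 : 0 <= M.
  by have := hc 0%N; rewrite expr0 mulr1 fact0 invr1 mulr1; apply: le_trans.
apply: (@series_le_cvg _ _ (fun n => M * exp_coeff (`|B| * `|K|) n)) => //.
- by move=> n; exact: normr_ge0.
- by move=> n; rewrite mulr_ge0// exp_coeff_ge0// mulr_ge0.
- move=> n; rewrite /= normrM normrX /exp_coeff/= exprMn.
  rewrite (_ : M * _ = M * `|B| ^+ n / n`!%:R * `|K| ^+ n); last by ring.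
  rewrite ler_wpM2r ?exprn_ge0//; apply: (le_trans (hc n)).
  rewrite ler_wpM2r ?invr_ge0// ler_wpM2l// -normrX; exact: ler_norm.
- by apply: is_cvg_seriesZ; exact: is_cvg_series_exp_coeff.
Qed.

Lemma norm_pseries_exp c M B K : 0 <= B ->
  (forall n, `|c n| <= M * B ^+ n / n`!%:R) ->
  `|limn (pseries c K)| <= M * expR (B * `|K|).
Proof.
move=> B0 hc.
have M0 : 0 <= M.
  by have := hc 0%N; rewrite expr0 mulr1 fact0 invr1 mulr1; apply: le_trans.
have cK := cvg_pseries_exp (K := K) hc.
rewrite -lim_norm//; apply: limr_le; first exact: is_cvg_norm.
near=> n; rewrite /pseries/=.
apply: (le_trans (ler_norm_sum _ _ _)).
apply: (@le_trans _ _ (\sum_(0 <= k < n) M * exp_coeff (B * `|K|) k)).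
  apply: ler_sum_nat => k _; rewrite normrM normrX /exp_coeff/= exprMn.
  rewrite (_ : M * _ = M * B ^+ k / k`!%:R * `|K| ^+ k); last by ring.
  by rewrite ler_wpM2r ?exprn_ge0.
rewrite -mulr_sumr ler_wpM2l//.
have e0 : 0 <= B * `|K| by rewrite mulr_ge0.
rewrite /expR; apply: nondecreasing_cvgn_le.
  apply/nondecreasing_seqP => m; rewrite /series/= big_nat_recr//= lerDl.
  exact: exp_coeff_ge0.
exact: is_cvg_series_exp_coeff.
Unshelve. all: by end_near. Qed.

(** The shape [M B^n / n!] is stable under formal differentiation, with [M] replaced by [M B].
    Differentiating the sum requires convergence of the series and of its first two formal
    derivatives, and this yields all three at once. *)
Lemma pseries_diffs_exp c M B :
  (forall n, `|c n| <= M * B ^+ n / n`!%:R) ->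
  forall n, `|pseries_diffs c n| <= (M * B) * B ^+ n / n`!%:R.
Proof.
move=> hc n; rewrite /pseries_diffs normrM ger0_norm//.
have := hc n.+1; rewrite factS natrM invfM exprS.
rewrite -(@ler_pM2l _ n.+1%:R)// => /le_trans; apply.
rewrite [leLHS](_ : _ = (n.+1%:R / n.+1%:R) * (M * B * B ^+ n / n`!%:R)); last by ring.
by rewrite divff ?mul1r// pnatr_eq0.
Qed.

Lemma is_derive_pseries_exp c M B t :
  (forall n, `|c n| <= M * B ^+ n / n`!%:R) ->
  is_derive t 1 (fun t => limn (pseries c t)) (limn (pseries (pseries_diffs c) t)).
Proof.
move=> hc; have h1 := pseries_diffs_exp hc; have h2 := pseries_diffs_exp h1.
apply: (@pseries_snd_diffs _ _ (`|t| + 1)).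
- exact: cvg_pseries_exp hc.
- exact: cvg_pseries_exp h1.
- exact: cvg_pseries_exp h2.
- by rewrite [ltRHS]ger0_norm ?addr_ge0// ltrDl.
Qed.

End ExponentialSeries.

(** * Exponentials of nearest-neighbour operators on bounded functions *)

Section NearestNeighbourOperators.
Variables (R : realType) (d : nat).
Implicit Types (a b s t M T : R) (f : Zd d -> R) (x y : Zd d).

(** [nnop (-2) 1] is minus the Laplacian and [nnop 0 1] is the adjacency operator. They differ by a
    multiple of the identity, so positivity of the second passes to the exponential of the first. *)
Definition nnop a b f x : R :=
  \sum_(i < d) (a * f x + b * (f (x + unitv i) + f (x - unitv i))).

Arguments nnop : simpl never.

Lemma nnopE a b f x : nnop a b f x =
  \sum_(i < d) (a * f x + b * (f (x + unitv i) + f (x - unitv i))).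
Proof. by []. Qed.

Definition expop a b t f x : R :=
  limn (pseries (fun k => iter k (nnop a b) f x / k`!%:R) t).

Definition nnbound a b : R := d%:R * (`|a| + 2 * `|b|).

Lemma nnbound_ge0 a b : 0 <= nnbound a b.
Proof. by rewrite mulr_ge0// addr_ge0// mulr_ge0. Qed.

Lemma norm_nnop a b f M x :
  (forall y, `|f y| <= M) -> `|nnop a b f x| <= nnbound a b * M.
Proof.
move=> fM; apply: (le_trans (ler_norm_sum _ _ _)).
apply: (@le_trans _ _ (\sum_(i < d) (`|a| + 2 * `|b|) * M)).
  apply: ler_sum => i _; apply: (le_trans (ler_normD _ _)).
  rewrite !normrM mulrDl lerD// ?ler_wpM2l//.
  rewrite [2 * _]mulrC -mulrA ler_wpM2l// mulr_natl mulr2n.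
  by rewrite (le_trans (ler_normD _ _))// lerD.
by rewrite sumr_const card_ord -[leLHS]mulr_natl /nnbound mulrA.
Qed.

Lemma norm_iter_nnop a b f M k x :
  (forall y, `|f y| <= M) ->
  `|iter k (nnop a b) f x| <= M * nnbound a b ^+ k.
Proof.
move=> fM; elim: k x => [|k IH] x /=; first by rewrite mulr1.
by apply: (le_trans (norm_nnop _ _ _ IH)); rewrite exprS mulrCA.
Qed.

Let coeff_bound a b f M k x : (forall y, `|f y| <= M) ->
  `|iter k (nnop a b) f x / k`!%:R| <= M * nnbound a b ^+ k / k`!%:R.
Proof.
move=> fM; rewrite normrM normfV [`|k`!%:R|]ger0_norm// ler_wpM2r ?invr_ge0//.
exact: norm_iter_nnop.
Qed.

Lemma cvg_expop a b t f M x : (forall y, `|f y| <= M) ->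
  pseries (fun k => iter k (nnop a b) f x / k`!%:R) t @ \oo --> expop a b t f x.
Proof.
by move=> fM; apply: cvg_pseries_exp => k; exact: coeff_bound.
Qed.

Lemma norm_expop a b t f M x : (forall y, `|f y| <= M) ->
  `|expop a b t f x| <= M * expR (nnbound a b * `|t|).
Proof.
move=> fM; apply: norm_pseries_exp; first exact: nnbound_ge0.
by move=> k; exact: coeff_bound.
Qed.

Lemma cvg_nnop a b (u : nat -> Zd d -> R) f x :
  (forall y, u ^~ y @ \oo --> f y) ->
  (fun n => nnop a b (u n) x) @ \oo --> nnop a b f x.
Proof.
move=> uf; rewrite /nnop.
apply: (@cvg_sumr _ _ _ _ _ _ (fun n i =>
  a * u n x + b * (u n (x + unitv i) + u n (x - unitv i)))) => i.
apply: cvgD; first by apply: cvgMl_tmp; exact: uf.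
by apply: cvgMl_tmp; apply: cvgD; exact: uf.
Qed.

(** [nnop] involves finitely many values, hence commutes with the pointwise limit of the partial
    sums; applied to these it produces the differentiated series. *)
Lemma is_derive_expop a b t f M x : (forall y, `|f y| <= M) ->
  is_derive t 1 (fun s => expop a b s f x) (nnop a b (expop a b t f) x).
Proof.
move=> fM; apply: (is_derive_eq (is_derive_pseries_exp _ (fun k => coeff_bound a b k x fM))).
apply/cvg_lim => //.
rewrite (_ : pseries _ _ = fun n => nnop a b (fun y =>
    pseries (fun k => iter k (nnop a b) f y / k`!%:R) t n) x).
  by apply: cvg_nnop => y; exact: cvg_expop.
apply/funext => n; rewrite /pseries/= /series/= /nnop.
under [RHS]eq_bigr => i _ do rewrite -!big_split/= !mulr_sumr -big_split/=.
rewrite exchange_big/=; apply: eq_bigr => k _.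
rewrite /pseries_diffs factS natrM invfM.
rewrite [LHS](_ : _ = (k.+1%:R / k.+1%:R) *
  (iter k.+1 (nnop a b) f x * (k`!%:R^-1 * t ^+ k))); last by ring.
rewrite divff ?pnatr_eq0// mul1r.
by rewrite /= mulr_suml; apply: eq_bigr => i _; ring.
Qed.

(* Uniqueness of bounded solutions of [F' = nnop a b F]: iterating the
   equation bounds a solution vanishing at 0 by [M (B s)^N / N!]. *)
Lemma ode_zero a b T M (F : R -> Zd d -> R) :
  (forall s x, 0 <= s <= T -> is_derive s 1 (F ^~ x) (nnop a b (F s) x)) ->
  (forall s x, 0 <= s <= T -> `|F s x| <= M) -> (forall x, F 0 x = 0) ->
  forall s x, 0 <= s <= T -> F s x = 0.
Proof.
move=> dF bF F0.
set B := nnbound a b.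
have M0 s : 0 <= s <= T -> 0 <= M.
  by move=> sT; apply: le_trans (bF s 0 sT).
have main N s x : 0 <= s <= T -> `|F s x| <= M * B ^+ N * s ^+ N / N`!%:R.
  elim: N s x => [|N IH] s x sT.
    by rewrite !expr0 fact0 !mulr1 divr1 bF.
  have [s0 sT'] := andP sT.
  pose g r := M * B ^+ N.+1 * r ^+ N.+1 / N.+1`!%:R.
  pose g' r := B * (M * B ^+ N * r ^+ N / N`!%:R).
  have dg (r : R) : is_derive r 1 g (g' r).
    have h := derM (derM (derC (M * B ^+ N.+1) r) (derX N (derI r))) (derC (N.+1`!%:R)^-1 r).
    apply: (is_derive_eq h).
    rewrite /g' factS natrM invfM !exprS.
    rewrite [LHS](_ : _ = (N.+1%:R / N.+1%:R) * (B * (M * B ^+ N * r ^+ N / N`!%:R))).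
      by rewrite divff ?pnatr_eq0// mul1r.
    by ring.
  have g0 : g 0 = 0 by rewrite /g expr0n/= mulr0 mul0r.
  have key r : 0 < r < s -> `|nnop a b (F r) x| <= g' r.
    move=> /andP[r0 rs]; apply: norm_nnop => y; apply: IH.
    by rewrite (ltW r0) (le_trans (ltW rs)).
  rewrite ler_norml -/(g s); apply/andP; split.
    rewrite -subr_ge0 opprK.
    have := @derive_ge0_le _ (fun r => F r x + g r) (fun r => nnop a b (F r) x + g' r) 0 s s0.
    rewrite F0 g0 addr0; apply.
      move=> r /andP[r0 rs]; apply: is_deriveD; apply: dF.
      by rewrite r0 (le_trans rs).
    by move=> r /key; rewrite ler_norml => /andP[]; lra.
  rewrite -subr_ge0.
  have := @derive_ge0_le _ (fun r => g r - F r x) (fun r => g' r - nnop a b (F r) x) 0 s s0.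
  rewrite F0 g0 subr0; apply.
    move=> r /andP[r0 rs]; apply: is_deriveB; apply: dF.
    by rewrite r0 (le_trans rs).
  by move=> r /key; rewrite ler_norml => /andP[]; lra.
move=> s x sT; apply/eqP; rewrite -normr_le0.
have h : (fun N => M * exp_coeff (B * s) N) @ \oo --> (0 : R).
  rewrite -[X in _ --> X](mulr0 M); apply: cvgMl_tmp.
  exact: (cvg_series_cvg_0 (is_cvg_series_exp_coeff _)).
rewrite -(cvg_lim (@Rhausdorff R) h); apply: limr_ge; first by apply/cvg_ex; exists 0.
near=> N; apply: (le_trans (main N s x sT)).
suff -> : M * exp_coeff (B * s) N = M * B ^+ N * s ^+ N / N`!%:R by [].
by rewrite /exp_coeff/= exprMn; ring.
Unshelve. all: by end_near. Qed.

Lemma nnopB a b f g x :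
  nnop a b (fun y => f y - g y) x = nnop a b f x - nnop a b g x.
Proof. by rewrite /nnop -sumrB; apply: eq_bigr => i _; ring. Qed.

Lemma expop0 a b f x : expop a b 0 f x = f x.
Proof.
apply/cvg_lim => //; rewrite -cvg_shiftS/=.
rewrite (_ : (fun _ => _) = cst (f x)); first exact: cvg_cst.
apply/funext => n; rewrite /pseries/= /series/= big_nat_recl//= expr0 fact0.
rewrite divr1 mulr1 big1 ?addr0// => i _; by rewrite expr0n/= mulr0.
Qed.

(** The scalar shift, conservation of mass, the semigroup law and the product formula are all
    obtained from this, by exhibiting a bounded solution with the right initial value. *)
Lemma ode_unique a b T M (F : R -> Zd d -> R) :
  (forall s x, 0 <= s <= T -> is_derive s 1 (F ^~ x) (nnop a b (F s) x)) ->
  (forall s x, 0 <= s <= T -> `|F s x| <= M) ->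
  forall s x, 0 <= s <= T -> F s x = expop a b s (F 0) x.
Proof.
move=> dF bF s x sT; apply/eqP; rewrite -subr_eq0; apply/eqP.
have T0 : 0 <= T by case/andP : sT => /le_trans; apply.
have F0M y : `|F 0 y| <= M by apply: bF; rewrite lexx.
have M0 : 0 <= M by apply: le_trans (F0M 0).
apply: (@ode_zero a b T (M + M * expR (nnbound a b * T))
  (fun s x => F s x - expop a b s (F 0) x)) => //.
- move=> r y rT; rewrite nnopB; apply: is_deriveB; first exact: dF.
  exact: is_derive_expop F0M.
- move=> r y /[dup] rT /andP[r0 rT']; apply: (le_trans (ler_normB _ _)).
  apply: lerD; first exact: bF.
  apply: (le_trans (norm_expop _ _ _ _ F0M)); rewrite ler_wpM2l//.
  by rewrite ler_expR ler_wpM2l ?nnbound_ge0// ger0_norm.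
- by move=> y; rewrite expop0 subrr.
Qed.

(** The identity part of [nnop a b] contributes a scalar factor. For [a = -2], [b = 1] this replaces
    an alternating series by one with nonnegative terms. *)
Lemma expop_shift a b s f M x : 0 <= s -> (forall y, `|f y| <= M) ->
  expR (d%:R * a * s) * expop 0 b s f x = expop a b s f x.
Proof.
move=> s0 fM.
have M0 : 0 <= M by apply: le_trans (fM 0).
pose F s x := expR (d%:R * a * s) * expop 0 b s f x.
have F0 : F 0 = f by apply/funext => y; rewrite /F mulr0 expR0 mul1r expop0.
rewrite -[in RHS]F0.
apply: (@ode_unique a b s (expR (d%:R * `|a| * s) * (M * expR (nnbound 0 b * s))) F).
- move=> r y _; rewrite /F.
  have h := derM (der_exp (derM (derC (d%:R * a) r) (derI r)))
    (@is_derive_expop 0 b r f M y fM).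
  apply: (is_derive_eq h); rewrite mul0r add0r mulr1 /nnop.
  rewrite [X in X + _ = _](_ : _ = \sum_(i < d)
    (a * expR (d%:R * a * r) * expop 0 b r f y)); last first.
    by rewrite sumr_const card_ord -[RHS]mulr_natl; ring.
  rewrite mulr_sumr -big_split/=; apply: eq_bigr => i _; ring.
- move=> r y /andP[r0 rs]; rewrite normrM; apply: ler_pM => //.
    rewrite ger0_norm ?expR_ge0// ler_expR.
    apply: (@le_trans _ _ (d%:R * `|a| * r)); last by rewrite ler_wpM2l ?mulr_ge0.
    by rewrite ler_wpM2r// ler_wpM2l// ler_norm.
  apply: (le_trans (norm_expop _ _ _ _ fM)); rewrite ler_wpM2l// ler_expR.
  by rewrite ler_wpM2l ?nnbound_ge0// ger0_norm.
- by rewrite s0 lexx.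
Qed.

End NearestNeighbourOperators.

(** * Positivity, mass and semigroup law of the heat kernel *)

Section HeatKernel.
Variables (R : realType) (d : nat).
Implicit Types (a b s t M T : R) (f : Zd d -> R) (x y z : Zd d).

Definition delta0 x : R := if x == 0 then 1 else 0.

Lemma delta0_bound y : `|delta0 y| <= 1.
Proof. by rewrite /delta0; case: ifP; rewrite ?normr1 ?normr0. Qed.

Lemma Lap_powE n x : Lap_pow R n x = (-1) ^+ n * iter n (nnop (-2) 1) delta0 x.
Proof.
elim: n x => [|n IH] x; first by rewrite mul1r.
rewrite /= /Lap /nnop mulr_sumr; apply: eq_bigr => i _.
by rewrite !IH exprS; ring.
Qed.

Lemma heatE t x : heat t x = expop (-2) 1 t delta0 x.
Proof.
rewrite /heat /expop; congr (limn _); apply/funext => N.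
apply: eq_bigr => n _; rewrite Lap_powE [(- t) ^+ n]exprNn /=.
rewrite [LHS](_ : _ = ((-1) ^+ n * (-1) ^+ n) *
  (iter n (nnop (-2) 1) delta0 x / n`!%:R * t ^+ n)); last by ring.
by rewrite -exprMn mulrNN mulr1 expr1n mul1r.
Qed.

Lemma heat0 x : heat 0 x = delta0 x :> R.
Proof. by rewrite heatE expop0. Qed.

Lemma is_derive_heat t x :
  is_derive t 1 (fun s => heat s x) (nnop (-2) 1 (heat t) x).
Proof.
rewrite (_ : (fun _ => _) = fun s => expop (-2) 1 s delta0 x); last first.
  by apply/funext => s; exact: heatE.
rewrite (_ : heat t = expop (-2) 1 t delta0); last by apply/funext => y; exact: heatE.
exact: is_derive_expop delta0_bound.
Qed.

Lemma continuous_heat x : continuous (fun t : R => heat t x).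
Proof. by move=> t; exact: (is_derive_cts (is_derive_heat t x)). Qed.

Lemma measurable_heat x : measurable_fun setT (fun t : R => heat t x).
Proof. by apply: continuous_measurable_fun; exact: continuous_heat. Qed.

Lemma nnop_ge0 f x : (forall y, 0 <= f y) -> 0 <= nnop 0 1 f x.
Proof.
by move=> f0; apply: sumr_ge0 => i _; rewrite mul0r add0r mul1r addr_ge0.
Qed.

Lemma iter_nnop_ge0 f k x : (forall y, 0 <= f y) -> 0 <= iter k (nnop 0 1) f x.
Proof. by move=> f0; elim: k x => [|k IH] x //=; exact: nnop_ge0. Qed.

Lemma delta0_ge0 y : 0 <= delta0 y.
Proof. by rewrite /delta0; case: ifP. Qed.

(** The number of nearest-neighbour walks of length [k] from the origin to [y]. *)
Definition walks k y : R := iter k (nnop 0 1) delta0 y.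

Lemma walks_ge0 k y : 0 <= walks k y.
Proof. exact/iter_nnop_ge0/delta0_ge0. Qed.

Lemma addrI_bij (a : Zd d) : set_bij setT setT (fun y => y + a).
Proof.
split => //.
- by move=> x y _ _; exact: addIr.
- by move=> y _; exists (y - a); rewrite ?subrK.
Qed.

Lemma subrI_bij (a : Zd d) : set_bij setT setT (fun y => a - y).
Proof.
split => //.
- by move=> x y _ _ /addrI/oppr_inj.
- by move=> y _; exists (a - y); rewrite ?subKr.
Qed.

Lemma esum_shift (F : Zd d -> \bar R) (a : Zd d) :
  (\esum_(y in setT) F (y + a)%R = \esum_(y in setT) F y)%E.
Proof. by rewrite [RHS](reindex_esum _ _ _ _ (addrI_bij a)). Qed.

Lemma esum_reflect (F : Zd d -> \bar R) (a : Zd d) :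
  (\esum_(y in setT) F (a - y)%R = \esum_(y in setT) F y)%E.
Proof. by rewrite [RHS](reindex_esum _ _ _ _ (subrI_bij a)). Qed.

(** The adjacency operator commutes with translations, so its powers act by convolution with the
    walk counts. Extended sums make it unnecessary to follow supports. *)
Lemma iter_nnop_conv f k x : (forall y, 0 <= f y) ->
  ((iter k (nnop 0 1) f x)%:E =
   \esum_(y in setT) (walks k y * f (x - y))%:E)%E.
Proof.
move=> f0; elim: k x => [|k IH] x.
  rewrite (@esum_single _ _ _ 0) /walks/= /delta0 ?eqxx ?mul1r ?subr0//.
    by move=> y; rewrite lee_fin mulr_ge0//; case: ifP.
  by move=> y /negbTE ->; rewrite mul0r.
have W0 y : 0 <= walks k y := walks_ge0 k y.
rewrite /= /nnop -sumEFin.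
transitivity (\sum_(i < d) \esum_(y in setT)
  (walks k (y + unitv i) * f (x - y) + walks k (y - unitv i) * f (x - y))%:E)%E.
  apply: eq_bigr => i _; rewrite mul0r add0r mul1r EFinD !IH.
  under [RHS]eq_esum do rewrite EFinD.
  rewrite esumD; last 2 first.
    by move=> y _; rewrite lee_fin mulr_ge0.
    by move=> y _; rewrite lee_fin mulr_ge0.
  congr (_ + _)%E.
    rewrite -(esum_shift _ (unitv i)); apply: eq_esum => y _.
    by congr ((_ * f _)%:E); rewrite opprD addrACA subrr addr0.
  rewrite -(esum_shift _ (- unitv i)); apply: eq_esum => y _.
  by congr ((_ * f _)%:E); rewrite opprB addrA subrK.
rewrite -esum_sum; last first.
  by move=> y i _ _; rewrite lee_fin addr_ge0 ?mulr_ge0.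
apply: eq_esum => y _; rewrite sumEFin; congr EFin.
by rewrite mulr_suml; apply: eq_bigr => i _; ring.
Qed.

Lemma expop_series f M t x : 0 <= t -> (forall y, 0 <= f y) ->
  (forall y, `|f y| <= M) ->
  ((expop 0 1 t f x)%:E =
   \sum_(k <oo) (iter k (nnop 0 1) f x / k`!%:R * t ^+ k)%:E)%E.
Proof.
move=> t0 f0 fM; apply/esym/cvg_lim => //.
under eq_fun do rewrite sumEFin.
apply: cvg_EFin; first by near=> n.
exact: cvg_expop fM.
Unshelve. all: by end_near. Qed.

Lemma expop_ge0 f M t x : 0 <= t -> (forall y, 0 <= f y) ->
  (forall y, `|f y| <= M) -> 0 <= expop (-2) 1 t f x.
Proof.
move=> t0 f0 fM; rewrite -(expop_shift _ _ _ t0 fM) mulr_ge0 ?expR_ge0//.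
rewrite -lee_fin (expop_series _ t0 f0 fM); apply: nneseries_ge0 => n _ _.
by rewrite lee_fin !mulr_ge0 ?invr_ge0 ?exprn_ge0 ?iter_nnop_ge0.
Qed.

Lemma heat_ge0 t x : 0 <= t -> 0 <= heat t x :> R.
Proof. by move=> t0; rewrite heatE (expop_ge0 _ t0 delta0_ge0 delta0_bound). Qed.

(** After the scalar shift every term is nonnegative, so the sum over walk lengths and the sum over
    endpoints may be exchanged. *)
Lemma expop_conv f M t x : 0 <= t -> (forall y, 0 <= f y) ->
  (forall y, `|f y| <= M) ->
  ((expop (-2) 1 t f x)%:E = \esum_(y in setT) (heat t y * f (x - y))%:E)%E.
Proof.
move=> t0 f0 fM.
have e0 : (0 <= (expR (d%:R * -2 * t))%:E)%E by rewrite lee_fin expR_ge0.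
rewrite -(expop_shift _ _ _ t0 fM) EFinM (expop_series _ t0 f0 fM).
transitivity (\esum_(y in setT) ((expR (d%:R * -2 * t))%:E *
  \sum_(k <oo) (walks k y / k`!%:R * t ^+ k * f (x - y))%:E))%E; last first.
  apply: eq_esum => y _; rewrite heatE -(expop_shift _ _ _ t0 delta0_bound).
  rewrite -[X in _ = X%:E]mulrA EFinM; congr (_ * _)%E.
  rewrite [RHS]EFinM muleC (expop_series _ t0 delta0_ge0 delta0_bound).
  rewrite -nneseriesZl; first by apply: eq_eseriesr => k _; rewrite -EFinM mulrC.
  by move=> k _; rewrite lee_fin !mulr_ge0 ?invr_ge0 ?exprn_ge0 ?iter_nnop_ge0// => ?; exact: delta0_ge0.
under [RHS]eq_esum => y _.
  rewrite -nneseriesZl; last first.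
    by move=> k _; rewrite lee_fin !mulr_ge0 ?invr_ge0 ?exprn_ge0 ?walks_ge0.
  rewrite nneseries_esumT; last first.
    by move=> k; rewrite mule_ge0// lee_fin !mulr_ge0 ?invr_ge0 ?exprn_ge0 ?walks_ge0.
  over.
rewrite -nneseriesZl; last first.
  by move=> k _; rewrite lee_fin !mulr_ge0 ?invr_ge0 ?exprn_ge0 ?iter_nnop_ge0.
rewrite nneseries_esumT; last first.
  by move=> k; rewrite mule_ge0// lee_fin !mulr_ge0 ?invr_ge0 ?exprn_ge0 ?iter_nnop_ge0.
transitivity (\esum_(k in [set: nat]) \esum_(y in [set: Zd d])
  ((expR (d%:R * -2 * t))%:E * (walks k y / k`!%:R * t ^+ k * f (x - y))%:E))%E.
  apply: eq_esum => k _.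
  have c0 : 0 <= expR (d%:R * -2 * t) * (k`!%:R^-1 * t ^+ k).
    by rewrite !mulr_ge0 ?expR_ge0 ?invr_ge0 ?exprn_ge0.
  rewrite (_ : _ * _ = (expR (d%:R * -2 * t) * (k`!%:R^-1 * t ^+ k))%:E *
    (iter k (nnop 0 1) f x)%:E)%E; last by rewrite -!EFinM; congr EFin; ring.
  rewrite iter_nnop_conv// -esumZl//; last first.
    by move=> y; rewrite lee_fin mulr_ge0 ?walks_ge0.
  by apply: eq_esum => y _; rewrite -!EFinM; congr EFin; ring.
have h0 (k : nat) y : (0 <= (expR (d%:R * -2 * t))%:E * (walks k y / k`!%:R * t ^+ k * f (x - y))%:E)%E.
  by rewrite mule_ge0// lee_fin !mulr_ge0 ?invr_ge0 ?exprn_ge0 ?walks_ge0.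
rewrite (esum_esum (J := fun=> setT))// [RHS](esum_esum (J := fun=> setT))//.
rewrite [RHS](reindex_esum ([set: nat] `*`` (fun=> [set: Zd d])) _ (fun p => (p.2, p.1)))//.
split => //; first by move=> [i j] [i' j'] _ _ [-> ->].
by move=> [i j] _; exists (j, i).
Qed.

Lemma expop1 t x : 0 <= t -> expop (-2) 1 t (fun=> 1) x = 1.
Proof.
move=> t0; apply/esym.
apply: (@ode_unique _ _ (-2) 1 t 1 (fun _ _ => 1)).
- move=> s y _; apply: (is_derive_eq (derC _ _)).
  by rewrite /nnop big1// => i _; ring.
- by move=> s y _; rewrite normr1.
- by rewrite t0 lexx.
Qed.

Lemma heat_mass t : 0 <= t -> (\esum_(y in [set: Zd d]) (heat t y)%:E = 1 :> \bar R)%E.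
Proof.
move=> t0; rewrite -(expop1 0 t0) (@expop_conv _ 1)//; last by move=> y; rewrite normr1.
by apply: eq_esum => y _; rewrite mulr1.
Qed.

Lemma heat_le1 t x : 0 <= t -> heat t x <= 1 :> R.
Proof.
move=> t0; rewrite -lee_fin -(heat_mass t0).
by apply: (esum_ge_term (f := fun y => (heat t y)%:E)) => y; rewrite lee_fin heat_ge0.
Qed.

Lemma heat_norm_le1 t x : 0 <= t -> `|heat t x : R| <= 1.
Proof. by move=> t0; rewrite ger0_norm ?heat_ge0 ?heat_le1. Qed.

Lemma heat_semigroup t s x : 0 <= t -> 0 <= s ->
  ((heat (t + s) x : R)%:E = \esum_(y in setT) (heat s y * heat t (x - y))%:E)%E.
Proof.
move=> t0 s0; rewrite -(@expop_conv _ 1)//; first last.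
- by move=> y; exact: heat_norm_le1.
- by move=> y; exact: heat_ge0.
congr EFin.
pose F (r : R) (y : Zd d) : R := heat (t + r) y.
have F0 : F 0 = heat t by apply/funext => y; rewrite /F addr0.
rewrite -F0; apply: (@ode_unique R d (-2) 1 s 1 F).
- move=> r y _; have h := der_comp (is_derive_heat (t + r) y) (derD (derC t r) (derI r)).
  by apply: (is_derive_eq h); rewrite add0r mulr1.
- by move=> r y /andP[r0 _]; rewrite heat_norm_le1 ?addr_ge0.
- by rewrite s0 lexx.
Qed.

Lemma heat_sym t x : heat t (- x) = heat t x :> R.
Proof.
rewrite !heatE /expop; congr (limn _); congr pseries; apply/funext => k.
congr (_ / _); elim: k x => [|k IH] x /=.
  by rewrite /delta0 oppr_eq0.
rewrite !nnopE; apply: eq_bigr => i _.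
rewrite IH -(IH (x + unitv i)) -(IH (x - unitv i)) opprD opprB.
congr (_ + _ * _); rewrite [RHS]addrC; congr (_ + _).
by rewrite (addrC (- x)).
by rewrite opprD.
Qed.

(** Only the walk of length 0 is kept: the continuous-time walk, which jumps at rate [2 d], has not
    moved by time [t]. *)
Lemma heat00_ge t : 0 <= t -> expR (- (2 * d%:R * t)) <= heat t (0 : Zd d).
Proof.
move=> t0; rewrite heatE -(expop_shift _ _ _ t0 delta0_bound).
rewrite (_ : - (2 * d%:R * t) = d%:R * -2 * t); last by ring.
rewrite -[leLHS]mulr1 ler_pM2l ?expR_gt0//.
rewrite -lee_fin (expop_series _ t0 delta0_ge0 delta0_bound).
apply: le_trans (nneseries_lim_ge 1 _); last first.
  by move=> k _ _; rewrite lee_fin !mulr_ge0 ?invr_ge0 ?exprn_ge0 ?iter_nnop_ge0// => ?; exact: delta0_ge0.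
by rewrite big_nat1 lee_fin /= /delta0 eqxx fact0 divr1 expr0 mulr1.
Qed.

Lemma heat00_ge_linear t : 0 <= t -> 1 - 2 * d%:R * t <= heat t (0 : Zd d).
Proof. by move=> t0; apply: le_trans (heat00_ge t0); exact: expR_ge1Dx. Qed.

End HeatKernel.

(** * The one-dimensional kernel and its recurrence *)

Section OneDimension.
Variable R : realType.
Implicit Types (s t : R) (n m : int) (k : nat).

Definition heat1 t n : R := heat t (const_mx n : Zd 1).

Let L k n : R := iter k (nnop (-2) 1) (@delta0 R 1) (const_mx n).

Lemma const_mx_add1 n : (const_mx n : Zd 1) + unitv ord0 = const_mx (n + 1).
Proof. by apply/matrixP => i j; rewrite !mxE !ord1 !eqxx. Qed.

Lemma const_mx_sub1 n : (const_mx n : Zd 1) - unitv ord0 = const_mx (n - 1).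
Proof. by apply/matrixP => i j; rewrite !mxE !ord1 !eqxx. Qed.

Let LS k n : L k.+1 n = -2 * L k n + (L k (n + 1) + L k (n - 1)).
Proof.
by rewrite /L iterS nnopE big_ord1 mul1r const_mx_add1 const_mx_sub1.
Qed.

Let L0 n : n%:~R * L 0 n = 0.
Proof.
rewrite /L/= /delta0; case: eqP => [h|_]; last by rewrite mulr0.
by have := congr1 (fun x : Zd 1 => x 0 0) h; rewrite !mxE => ->; rewrite mul0r.
Qed.

(** The commutator of multiplication by [n] with the second difference is the central difference
    [f (n - 1) - f (n + 1)], which commutes with the second difference; and multiplication by [n]
    kills the initial delta. *)
Let L_rec k n : n%:~R * L k.+1 n = k.+1%:R * (L k (n - 1) - L k (n + 1)).
Proof.
elim: k n => [|k IH] n.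
  have h1 := L0 n; have h2 := L0 (n + 1); have h3 := L0 (n - 1).
  move: h2 h3; rewrite LS intrD intrB => h2 h3.
  by rewrite mul1r; lra.
have h1 := IH n; have h2 := IH (n + 1); have h3 := IH (n - 1).
move: h1 h2 h3; rewrite intrD intrB addrK subrK => h1 h2 h3.
have e1 := LS k (n - 1); have e2 := LS k (n + 1).
rewrite (_ : n - 1 + 1 = n) in e1; last by lia.
rewrite (_ : n + 1 - 1 = n) in e2; last by lia.
have k1 : k.+1%:R = k%:R + 1 :> R by rewrite natr1.
have k2 : k.+2%:R = k%:R + 2 :> R by rewrite -addn2 natrD.
rewrite (LS k.+1) k2; rewrite k1 in h1 h2 h3.
rewrite mulr1z in h2 h3.
rewrite [LHS](_ : _ =
  -2 * (n%:~R * L k.+1 n) + ((n%:~R + 1) * L k.+1 (n + 1) - L k.+1 (n + 1)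
   + ((n%:~R - 1) * L k.+1 (n - 1) + L k.+1 (n - 1)))); last by ring.
by rewrite h1 h2 h3 e1 e2; ring.
Qed.

Let cvgL t n : pseries (fun k => L k n / k`!%:R) t @ \oo --> heat1 t n.
Proof. by rewrite /heat1 heatE; exact: (@cvg_expop R 1 (-2) 1 t (@delta0 R 1) 1 (const_mx n) (@delta0_bound R 1)). Qed.

(** [heat1 t n] is [exp (- 2 t) I_n (2 t)], and this is the three-term recurrence of the modified
    Bessel functions, read off from the coefficients by [L_rec]. *)
Lemma heat1_rec t n : n%:~R * heat1 t n = t * (heat1 t (n - 1) - heat1 t (n + 1)).
Proof.
have h1 : (fun N => n%:~R * pseries (fun k => L k n / k`!%:R) t N.+1) @ \oo
    --> n%:~R * heat1 t n.
  apply: cvgMl_tmp; by have := @cvgL t n; rewrite -cvg_shiftS.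
have h2 : (fun N => t * (pseries (fun k => L k (n - 1) / k`!%:R) t N
    - pseries (fun k => L k (n + 1) / k`!%:R) t N)) @ \oo
    --> t * (heat1 t (n - 1) - heat1 t (n + 1)).
  by apply: cvgMl_tmp; apply: cvgB; exact: cvgL.
apply: (cvg_unique (@Rhausdorff R) h1).
rewrite (_ : (fun _ => _) = fun N => t * (pseries (fun k => L k (n - 1) / k`!%:R) t N
    - pseries (fun k => L k (n + 1) / k`!%:R) t N))//.
apply/funext => N; rewrite /pseries/= /series/= big_nat_recl//=.
rewrite mulrDr !mulrA L0 !mul0r add0r -sumrB !mulr_sumr.
apply: eq_bigr => k _.
rewrite factS natrM invfM exprS.
rewrite [LHS](_ : _ = (n%:~R * L k.+1 n) * (k.+1%:R^-1 / k`!%:R * (t * t ^+ k))); last by ring.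
rewrite L_rec.
rewrite [LHS](_ : _ = (k.+1%:R / k.+1%:R) * (t * (L k (n - 1) / k`!%:R * t ^+ k - L k (n + 1) / k`!%:R * t ^+ k))); last by ring.
by rewrite divff ?mul1r// pnatr_eq0.
Qed.

Lemma heat1_sym t n : heat1 t (- n) = heat1 t n.
Proof.
rewrite /heat1 -heat_sym; congr heat.
by apply/matrixP => i j; rewrite !mxE opprK.
Qed.

Lemma heat1_ge0 t n : 0 <= t -> 0 <= heat1 t n.
Proof. exact: heat_ge0. Qed.

Lemma heat1_norm_le1 t n : 0 <= t -> `|heat1 t n| <= 1.
Proof. exact: heat_norm_le1. Qed.

Lemma is_derive_heat1 t n : is_derive t 1 (heat1 ^~ n)
  (-2 * heat1 t n + (heat1 t (n + 1) + heat1 t (n - 1))).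
Proof.
apply: (is_derive_eq (is_derive_heat t (const_mx n : Zd 1))).
by rewrite nnopE big_ord1 mul1r const_mx_add1 const_mx_sub1.
Qed.

Lemma heat10 n : heat1 0 n = (n == 0)%:R.
Proof.
rewrite /heat1 heat0 /delta0 (_ : (const_mx n == 0) = (n == 0)).
  by case: ifP.
apply/eqP/eqP => [h|->]; last by apply/matrixP => i j; rewrite !mxE.
by have := congr1 (fun x : Zd 1 => x 0 0) h; rewrite !mxE.
Qed.

(* With [a = heat1 t n] and [b = heat1 t (n+1)], the function
   [D = t (a^2 - b^2) - (n + 1/2) a b] satisfies [D' + 4 D = (n + 1/2) a b / t]. *)
Lemma heat1_quadratic t (n : nat) : 0 <= t ->
  (n%:R + 2^-1) * (heat1 t n * heat1 t n.+1) <=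
  t * (heat1 t n ^+ 2 - heat1 t n.+1 ^+ 2).
Proof.
move=> t0.
pose a s := heat1 s n; pose b s := heat1 s n.+1.
pose c s := heat1 s (n%:Z - 1); pose e s := heat1 s (n%:Z + 2).
have da s : is_derive s 1 a (-2 * a s + (b s + c s)).
  have := is_derive_heat1 s n; rewrite -[n%:Z + 1]/((n + 1)%N%:Z) addn1.
  exact.
have db s : is_derive s 1 b (-2 * b s + (e s + a s)).
  have := is_derive_heat1 s n.+1.
  rewrite (_ : n.+1%:Z - 1 = n); last by lia.
  by rewrite (_ : n.+1%:Z + 1 = n%:Z + 2)//; lia.
(* [exp (4 s)] is the integrating factor for [D' + 4 D]. Since [heat1 0 (n + 1) = 0], [E] vanishes
   at 0, so [E' >= 0] is enough. *)
pose E s := expR (4 * s) * (s * (a s ^+ 2 - b s ^+ 2) - (n%:R + 2^-1) * (a s * b s)).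
pose E' s := expR (4 * s) * (4 * (s * (a s ^+ 2 - b s ^+ 2) - (n%:R + 2^-1) * (a s * b s))
  + ((a s ^+ 2 - b s ^+ 2) + s * (2 * a s * (-2 * a s + (b s + c s))
     - 2 * b s * (-2 * b s + (e s + a s)))
   - (n%:R + 2^-1) * ((-2 * a s + (b s + c s)) * b s + a s * (-2 * b s + (e s + a s))))).
have dE s : is_derive s 1 E (E' s).
  have h := derM (der_exp (derM (derC 4 s) (derI s)))
    (derB (derM (derI s) (derB (derX 1 (da s)) (derX 1 (db s))))
      (derM (derC (n%:R + 2^-1) s) (derM (da s) (db s)))).
  by apply: (is_derive_eq h); rewrite /E' !expr1; ring.
have E'0 s : 0 < s < t -> 0 <= E' s.
  move=> /andP[s0 st].
  (* The recurrence at [n] and at [n + 1] eliminates the outer neighbours [c] and [e]. *)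
  have r1 : n%:R * a s = s * (c s - b s).
    have := heat1_rec s n; rewrite -[n%:Z + 1]/((n + 1)%N%:Z) addn1; exact.
  have r2 : (n%:R + 1) * b s = s * (a s - e s).
    have := heat1_rec s n.+1; rewrite (_ : n.+1%:Z - 1 = n); last by lia.
    by rewrite (_ : n.+1%:Z + 1 = n%:Z + 2) ?natr1//; lia.
  have cE : c s = n%:R * a s / s + b s.
    by rewrite r1; field; rewrite gt_eqF.
  have eE : e s = a s - (n%:R + 1) * b s / s.
    by rewrite r2; field; rewrite gt_eqF.
  have -> : E' s = expR (4 * s) * ((n%:R + 2^-1) * (a s * b s) / s).
    by rewrite /E' cE eE; field; rewrite gt_eqF.
  rewrite mulr_ge0 ?expR_ge0// divr_ge0 ?(ltW s0)// !mulr_ge0 ?addr_ge0//;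
    exact/heat1_ge0/ltW.
have := derive_ge0_le t0 (fun s _ => dE s) E'0.
rewrite /E mulr0 expR0 mul0r mul1r sub0r /a /b !heat10 mulr0 mulr0 oppr0.
by rewrite pmulr_rge0 ?expR_gt0// subr_ge0.
Qed.

End OneDimension.

Section ProductFormula.
Variables (R : realType).

Lemma is_derive_prod d (f : 'I_d -> R -> R) (df : 'I_d -> R) (t : R) :
  (forall i, is_derive t 1 (f i) (df i)) ->
  is_derive t 1 (fun s => \prod_(i < d) f i s)
    (\sum_(i < d) \prod_(j < d) (if j == i then df j else f j t)).
Proof.
elim: d f df => [|d IH] f df hf.
  rewrite big_ord0 (_ : (fun _ => _) = fun=> 1); first exact: derC.
  by apply/funext => s; rewrite big_ord0.
rewrite (_ : (fun _ => _) = fun s => f ord0 s * \prod_(i < d) f (lift ord0 i) s); last first.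
  by apply/funext => s; rewrite big_ord_recl.
apply: (is_derive_eq (derM (hf ord0) (IH _ _ (fun i => hf (lift ord0 i))))).
rewrite big_ord_recl; congr (_ + _).
  by rewrite big_ord_recl eqxx.
rewrite mulr_sumr; apply: eq_bigr => i _; rewrite big_ord_recl/=.
by congr (_ * _); apply: eq_bigr => j _; rewrite (inj_eq lift_inj).
Qed.

(** The Laplacian is a sum of one-dimensional ones acting on separate coordinates, so the product
    solves the same equation with the same initial value. *)
Lemma heat_prod d (t : R) (x : Zd d) : 0 <= t ->
  heat t x = \prod_(i < d) heat1 t (x 0 i).
Proof.
move=> t0; pose F (s : R) (y : Zd d) := \prod_(i < d) heat1 s (y 0 i).
have F0 : F 0 = @delta0 R d.
  apply/funext => y; rewrite /F /delta0; case: eqP => [->|/eqP y0].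
    by rewrite big1// => i _; rewrite mxE heat10.
  have [i yi] : exists i, y 0 i != 0.
    apply/existsP; apply: contraNT y0; rewrite negb_exists => /forallP h.
    apply/eqP/rowP => i; rewrite mxE; apply/eqP.
    by have := h i; rewrite negbK.
  by rewrite (bigD1 i)//= heat10 (negbTE yi) mul0r.
rewrite heatE -F0; apply/esym; apply: (@ode_unique R d (-2) 1 t 1 F).
- move=> s y _; have h := is_derive_prod (fun i => is_derive_heat1 s (y 0 i)).
  apply: (is_derive_eq h); rewrite nnopE; apply: eq_bigr => i _.
  have shift (e : Zd d) (k : int) : (forall j, e 0 j = if j == i then k else 0) ->
    F s (y + e) = heat1 s (y 0 i + k) * \prod_(j < d | j != i) heat1 s (y 0 j).
    move=> he; rewrite /F (bigD1 i)//= mxE he eqxx; congr (_ * _).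
    by apply: eq_bigr => j ji; rewrite mxE he (negbTE ji) addr0.
  rewrite (shift _ 1); last by move=> j; rewrite mxE eqxx/=; case: eqP.
  rewrite (shift _ (-1)); last by move=> j; rewrite !mxE eqxx/=; case: eqP.
  rewrite (_ : F s y = heat1 s (y 0 i) * \prod_(j < d | j != i) heat1 s (y 0 j)); last first.
    by rewrite /F (bigD1 i).
  rewrite [LHS](bigD1 i)//= eqxx.
  rewrite (eq_bigr (fun j => heat1 s (y 0 j))); last by move=> j /negbTE ->.
  by ring.
- move=> s y /andP[s0 _]; rewrite /F normr_prod.
  apply: prodr_ile1 => i _.
  by rewrite normr_ge0 heat1_norm_le1.
- by rewrite t0 lexx.
Qed.

End ProductFormula.

(** * One-dimensional heat kernel asymptotics *)

Section ExponentialBounds.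
Variable R : realType.
Implicit Types (v y c : R).

Lemma expR_ge2 y : 0 <= y -> 1 + y + y ^+ 2 / 2 <= expR y.
Proof.
move=> y0.
have h := @derive_ge0_le R (fun s => expR s - (1 + s + s ^+ 2 / 2))
  (fun s => expR s - (1 + s)) 0 y y0.
rewrite expR0 expr0n/= mul0r !addr0 subrr in h.
rewrite -subr_ge0; apply: h => [s _|s /andP[s0 _]]; last first.
  by rewrite subr_ge0 expR_ge1Dx.
have h := derB (is_derive_expR s) (derD (derD (derC 1 s) (derI s))
  (derM (derX 1 (derI s)) (derC (2^-1) s))).
by apply: (is_derive_eq h); field.
Qed.

Lemma expRN_le2 y : 0 <= y -> expR (- y) <= 1 - y + y ^+ 2 / 2.
Proof.
move=> y0.
have h := @derive_ge0_le R (fun s => (1 - s + s ^+ 2 / 2) - expR (- s))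
  (fun s => expR (- s) - (1 - s)) 0 y y0.
rewrite oppr0 expR0 expr0n/= mul0r !addr0 subrr in h.
rewrite -subr_ge0; apply: h => [s _|s /andP[s0 _]]; last first.
  by rewrite subr_ge0 expR_ge1Dx.
have h := derB (derD (derB (derC 1 s) (derI s))
  (derM (derX 1 (derI s)) (derC (2^-1) s))) (der_exp (derN (derI s))).
by apply: (is_derive_eq h); field.
Qed.

Lemma expRN_ge3 y : 0 <= y -> 1 - y + y ^+ 2 / 2 - y ^+ 3 / 6 <= expR (- y).
Proof.
move=> y0.
have h := @derive_ge0_le R (fun s => expR (- s) - (1 - s + s ^+ 2 / 2 - s ^+ 3 / 6))
  (fun s => (1 - s + s ^+ 2 / 2) - expR (- s)) 0 y y0.
rewrite oppr0 expR0 !expr0n/= !mul0r !addr0 !subr0 subrr in h.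
rewrite -subr_ge0; apply: h => [s _|s /andP[s0 _]]; last first.
  by rewrite subr_ge0 expRN_le2// ltW.
have h := derB (der_exp (derN (derI s))) (derB (derD (derB (derC 1 s) (derI s))
  (derM (derX 1 (derI s)) (derC (2^-1) s))) (derM (derX 2 (derI s)) (derC (6^-1) s))).
by apply: (is_derive_eq h); field.
Qed.

Lemma expr_le_expR k c : 0 < c ->
  exists2 C, 0 < C & forall v, 0 <= v -> v ^+ k <= C * expR (c * v).
Proof.
move=> c0; have [C C0 h] := @powR_le_expR R k%:R c (ler0n _ _) c0.
by exists C => // v v0; have := h v v0; rewrite powR_mulrn.
Qed.

End ExponentialBounds.

Section OneDimensionalBounds.
Variable R : realType.
Implicit Types (t : R) (n N : nat).

(** With this quantity [heat1_quadratic] says that the ratio [r] of consecutive values satisfies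
    [r^2 + 2 y r <= 1], that is [r <= sqrt (1 + y^2) - y]. *)
Let y t n : R := (n%:R + 2^-1) / (2 * t).

Let y_ge0 t n : 0 < t -> 0 <= y t n.
Proof. by move=> t0; rewrite divr_ge0 ?addr_ge0 ?mulr_ge0// ltW. Qed.

Lemma heat1_recS t n : n.+1%:R * heat1 t n.+1 = t * (heat1 t n - heat1 t n.+2).
Proof.
have := heat1_rec t n.+1.
rewrite (_ : n.+1%:Z - 1 = n); last by lia.
by rewrite (_ : n.+1%:Z + 1 = n.+2)//; lia.
Qed.

Lemma heat1_decr t n : 0 < t -> heat1 t n.+1 <= heat1 t n.
Proof.
move=> t0; have h := heat1_quadratic n (ltW t0).
have a0 := heat1_ge0 n (ltW t0); have b0 := heat1_ge0 n.+1 (ltW t0).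
rewrite -(@ler_pXn2r _ 2)// ?nnegrE// -subr_ge0 -(pmulr_rge0 _ t0).
by apply: le_trans h; rewrite !mulr_ge0// addr_ge0.
Qed.

Lemma heat1_nat_gt0 t n : 0 < t -> 0 < heat1 t n.
Proof.
move=> t0; elim: n => [|n IH].
  rewrite /heat1 (_ : const_mx _ = 0 :> Zd 1); last by apply/matrixP => i j; rewrite !mxE.
  by apply: lt_le_trans (heat00_ge 1 (ltW t0)); exact: expR_gt0.
have b0 := heat1_ge0 n.+1 (ltW t0).
rewrite lt_def b0 andbT; apply/eqP => h.
have := heat1_recS t n; rewrite h mulr0 => /esym/eqP.
rewrite mulf_eq0 (gt_eqF t0)/= subr_eq0 => /eqP e.
by have := heat1_decr n.+1 t0; rewrite h -e leNgt IH.
Qed.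

Lemma heat1_gt0 t (n : int) : 0 < t -> 0 < heat1 t n.
Proof.
move=> t0; case: n => n; first exact: heat1_nat_gt0.
by rewrite NegzE heat1_sym heat1_nat_gt0.
Qed.

(** The quadratic increases in [r >= 0], so any [r] at which it reaches 1 bounds the ratio; rational
    bounds can then be tested without square roots. *)
Let quad_le t n (r : R) : 0 < t -> 0 <= r -> 1 <= r ^+ 2 + 2 * y t n * r ->
  heat1 t n.+1 <= r * heat1 t n.
Proof.
move=> t0 r0 hr; have h := heat1_quadratic n (ltW t0).
have a0 := heat1_nat_gt0 n t0; have b0 := heat1_nat_gt0 n.+1 t0.
have y0 := y_ge0 n t0.
set a := heat1 t n in h a0 *; set b := heat1 t n.+1 in h b0 *.
have {}h : 2 * y t n * (a * b) <= a ^+ 2 - b ^+ 2.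
  rewrite /y -(ler_pM2l t0); apply: le_trans h.
  by rewrite le_eqVlt; apply/orP; left; apply/eqP; field; rewrite gt_eqF.
rewrite leNgt; apply/negP => rab.
have : (r ^+ 2 + 2 * y t n * r) * a ^+ 2 < a ^+ 2.
  have h1 : r ^+ 2 * a ^+ 2 < b ^+ 2.
    by rewrite -exprMn ltr_pXn2r// ?nnegrE ?mulr_ge0// ltW.
  have h2 : 2 * y t n * r * a ^+ 2 <= 2 * y t n * (a * b).
    rewrite (_ : 2 * y t n * r * a ^+ 2 = 2 * y t n * a * (r * a)); last by ring.
    have ya : 0 <= 2 * y t n * a := mulr_ge0 (mulr_ge0 (ler0n _ 2) y0) (ltW a0).
    by have := ler_wpM2l ya (ltW rab); lra.
  lra.
by rewrite ltNge ler_peMl// exprn_ge0// ltW.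
Qed.

Let ratio1 t n : 0 < t -> heat1 t n.+1 * (1 + y t n) <= heat1 t n.
Proof.
move=> t0; have y0 := y_ge0 n t0.
have y1 : 0 < 1 + y t n by rewrite ltr_pwDl.
rewrite -ler_pdivlMr// mulrC; apply: quad_le => //; first by rewrite invr_ge0 ltW.
rewrite (_ : _ ^-1 ^+ 2 + _ = 1 + (y t n / (1 + y t n)) ^+ 2).
  by rewrite lerDl sqr_ge0.
by field; rewrite gt_eqF.
Qed.

(** The expansion of [sqrt (1 + y^2) - y] to second order. It is sharp for small [y], whereas
    [ratio1] is the bound for large [y]. *)
Let ratio2 t n : 0 < t -> heat1 t n.+1 <= (1 - y t n + y t n ^+ 2 / 2) * heat1 t n.
Proof. by move=> t0; have y0 := y_ge0 n t0; apply: quad_le => //; nra. Qed.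

(** The recurrence expresses a value through the next two, which turns the upper bound on the next
    ratio into a lower bound on this one. *)
Let ratio3 t n : 0 < t ->
  heat1 t n <= (1 + y t n + y t n.+1 ^+ 2 / 2) * heat1 t n.+1.
Proof.
move=> t0; have h := ratio2 n.+1 t0; have e := heat1_recS t n.
have -> : heat1 t n = heat1 t n.+2 + n.+1%:R / t * heat1 t n.+1.
  by rewrite mulrAC e; field; rewrite gt_eqF.
have -> : n.+1%:R / t = y t n + y t n.+1.
  by rewrite /y -natr1; field; rewrite gt_eqF.
by move: h; lra.
Qed.

(** A product of the bounds [ratio3]. The half in [y] makes the sum of [y t j] over [j < n] exactly
    [n^2 / (4 t)], and the factor [1 + t^-1] absorbs the appearance of [y t n.+1] in the quadratic
    term. *)
Lemma heat1_lower t n : 0 < t ->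
  heat1 t 0 * expR (- (n%:R ^+ 2 / (4 * t) * (1 + t^-1))) <= heat1 t n.
Proof.
move=> t0; elim: n => [|n IH].
  by rewrite expr0n/= mul0r mul0r oppr0 expR0 mulr1.
have y0 := y_ge0 n t0; have i0 : 0 < t^-1 by rewrite invr_gt0.
have step : heat1 t n * expR (- (y t n * (1 + t^-1))) <= heat1 t n.+1.
  rewrite expRN ler_pdivrMr ?expR_gt0// mulrC; apply: le_trans (ratio3 n t0) _.
  rewrite ler_wpM2r ?(ltW (heat1_nat_gt0 n.+1 t0))//.
  rewrite mulrDr mulr1 expRD.
  have e2 := expR_ge2 y0; have e1 := expR_ge1Dx (y t n * t^-1).
  have ey : y t n.+1 = y t n + t^-1 / 2.
    by rewrite /y -natr1; field; rewrite gt_eqF.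
  have yt : t^-1 / 4 <= y t n.
    rewrite /y (_ : t^-1 / 4 = 2^-1 / (2 * t)); last by field; rewrite gt_eqF.
    by rewrite ler_pM2r ?invr_gt0 ?mulr_gt0// lerDr.
  rewrite ey; set u := t^-1 in i0 e1 yt *; set z := y t n in y0 e2 e1 yt *.
  have zu : 0 <= z * u by rewrite mulr_ge0// ltW.
  apply: (@le_trans _ _ ((1 + z + z ^+ 2 / 2) * (1 + z * u))); last first.
    apply: ler_pM => //; last by rewrite addr_ge0.
    by rewrite !addr_ge0// divr_ge0 ?sqr_ge0.
  have : 0 <= z ^+ 2 / 2 * (z * u) by rewrite mulr_ge0// divr_ge0 ?sqr_ge0.
  have : 0 <= z * (z * u) by rewrite mulr_ge0.
  have : u * (u / 4) <= u * z by rewrite ler_wpM2l// ltW.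
  move=> *; nra.
apply: le_trans step; rewrite (le_trans _ (ler_wpM2r (expR_ge0 _) IH))//.
rewrite -[leRHS]mulrA -expRD ler_wpM2l ?(ltW (heat1_nat_gt0 0 t0))// ler_expR.
rewrite le_eqVlt; apply/orP; left; apply/eqP.
by rewrite /y -natr1; field; rewrite gt_eqF.
Qed.

Lemma heat1_upper t n : 0 < t ->
  heat1 t n <= heat1 t 0 * expR (- (n%:R ^+ 2 / (2 * (2 * t + n%:R)))).
Proof.
move=> t0.
(* A product of the bounds [ratio1], using [1 / (1 + y) <= exp (- y / (1 + y))]. Freezing the
   denominator at [2 t + N] makes the exponents add up to [m^2 / (2 (2 t + N))]. *)
suff main N m : (m <= N)%N ->
    heat1 t m <= heat1 t 0 * expR (- (m%:R ^+ 2 / (2 * (2 * t + N%:R)))) by exact: main.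
elim: m => [|m IH] mN; first by rewrite expr0n/= mul0r oppr0 expR0 mulr1.
have tN : 0 < 2 * t + N%:R by rewrite ltr_wpDr// mulr_gt0.
have y0 := y_ge0 m t0; have y1 : 0 < 1 + y t m by rewrite ltr_pwDl.
have step : heat1 t m.+1 <= heat1 t m * expR (- ((m%:R + 2^-1) / (2 * t + N%:R))).
  apply: (@le_trans _ _ (heat1 t m * (1 + y t m)^-1)).
    by rewrite ler_pdivlMr// ratio1.
  rewrite ler_wpM2l ?(ltW (heat1_nat_gt0 m t0))//.
  apply: le_trans (expR_ge1Dx _).
  rewrite lerBrDr -lerBrDl.
  have mN' : m%:R + 1 <= N%:R :> R by rewrite natr1 ler_nat.
  have m0 : 0 <= m%:R :> R by [].
  rewrite (_ : 1 - _ = (m%:R + 2^-1) / (2 * t + (m%:R + 2^-1))); last first.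
    rewrite /y; field; rewrite !gt_eqF//; rewrite ?ltr_pwDl//; lra.
  rewrite ler_wpM2l ?addr_ge0// lef_pV2 ?posrE//; first lra.
  by rewrite ltr_wpDr ?mulr_gt0// addr_ge0.
apply: (le_trans step); apply: (le_trans (ler_wpM2r (expR_ge0 _) (IH (ltnW mN)))).
rewrite -[leLHS]mulrA -expRD ler_wpM2l ?(ltW (heat1_nat_gt0 0 t0))// ler_expR.
rewrite le_eqVlt; apply/orP; left; apply/eqP.
by rewrite -natr1; field; rewrite gt_eqF.
Qed.

(** A product of the bounds [ratio2]. The range [n <= 2 t] keeps [y <= 1], where
    [1 - y + y^2 / 2 <= exp (- y + y^3 / 2)]; bounding each [y] by [n / (2 t)] in the cubic term
    gives the quartic correction. *)
Lemma heat1_upper_gauss t n : 0 < t -> n%:R <= 2 * t ->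
  heat1 t n <= heat1 t 0 * expR (- (n%:R ^+ 2 / (4 * t)) + n%:R ^+ 4 / (16 * t ^+ 3)).
Proof.
move=> t0 nt.
suff main m : (m <= n)%N -> heat1 t m <=
    heat1 t 0 * expR (- (m%:R ^+ 2 / (4 * t)) + m%:R * n%:R ^+ 3 / (16 * t ^+ 3)).
  by rewrite -[n%:R ^+ 4]/(n%:R ^+ 3.+1) exprS; exact: main.
elim: m => [|m IH] mn.
  by rewrite expr0n/= !mul0r oppr0 addr0 expR0 mulr1.
have y0 := y_ge0 m t0.
have mn' : m%:R + 1 <= n%:R :> R by rewrite natr1 ler_nat.
have yn : y t m <= n%:R / (2 * t).
  by rewrite /y ler_wpM2r ?invr_ge0 ?mulr_ge0 ?(ltW t0)//; lra.
have n1 : n%:R / (2 * t) <= 1 by rewrite ler_pdivrMr ?mul1r ?mulr_gt0.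
have y1 : y t m <= 1 by apply: le_trans yn n1.
have step : heat1 t m.+1 <= heat1 t m * expR (- y t m + n%:R ^+ 3 / (16 * t ^+ 3)).
  apply: (le_trans (ratio2 m t0)); rewrite mulrC.
  rewrite ler_wpM2l ?(ltW (heat1_nat_gt0 m t0))//.
  apply: (@le_trans _ _ (expR (- y t m + y t m ^+ 3 / 2))); last first.
    rewrite ler_expR lerD2l.
    rewrite (_ : n%:R ^+ 3 / _ = (n%:R / (2 * t)) ^+ 3 / 2); last first.
      by field; rewrite gt_eqF.
    by rewrite ler_wpM2r// lerXn2r ?nnegrE// (le_trans y0).
  have e3 := expRN_ge3 y0; have c3 := expR_ge1Dx (y t m ^+ 3 / 2).
  rewrite expRD; set z := y t m in y0 y1 e3 c3 *.
  have e4 : 1 / 3 <= expR (- z).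
    by apply: le_trans e3; nra.
  have z3 : 0 <= z ^+ 3 by rewrite exprn_ge0.
  apply: (@le_trans _ _ (expR (- z) * (1 + z ^+ 3 / 2))).
    by nra.
  by rewrite ler_wpM2l ?expR_ge0.
apply: (le_trans step); apply: (le_trans (ler_wpM2r (expR_ge0 _) (IH (ltnW mn)))).
rewrite -[leLHS]mulrA -expRD ler_wpM2l ?(ltW (heat1_nat_gt0 0 t0))// ler_expR.
rewrite le_eqVlt; apply/orP; left; apply/eqP.
by rewrite /y -natr1; field; rewrite gt_eqF.
Qed.

(** With [v = n / sqrt t] and [t >= 1], [heat1_upper] decays with exponent at least
    [v^2 / (2 (2 + v))], and this is at least [v / 2 - 1]. *)
Lemma heat1_tail t n : 1 <= t ->
  heat1 t n <= heat1 t 0 * (expR 1 * expR (- (n%:R / Num.sqrt t / 2))).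
Proof.
move=> t1; have t0 : 0 < t by rewrite (lt_le_trans _ t1).
apply: (le_trans (heat1_upper n t0)).
rewrite ler_wpM2l ?(ltW (heat1_nat_gt0 0 t0))// -expRD ler_expR.
set s := Num.sqrt t; have s0 : 0 < s by rewrite sqrtr_gt0.
have ts : t = s ^+ 2 by rewrite sqr_sqrtr// ltW.
have s1 : 1 <= s by rewrite -(@ler_pXn2r _ 2) ?nnegrE ?(ltW s0)// expr1n -ts.
rewrite ts; set v := n%:R / s.
have v0 : 0 <= v by rewrite divr_ge0// ltW.
have -> : n%:R = v * s by rewrite divfK// gt_eqF.
rewrite (_ : (v * s) ^+ 2 / _ = v ^+ 2 / (2 * (2 + v / s))); last first.
  have p1 : 0 < 2 * s + v by rewrite ltr_wpDr// mulr_gt0.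
  have p2 : 0 < 2 * s ^+ 2 + v * s.
    by have := mulr_gt0 s0 p1; lra.
  by field; rewrite ?(gt_eqF s0) ?(gt_eqF p1) ?(gt_eqF p2).
apply: (@le_trans _ _ (- (v ^+ 2 / (2 * (2 + v))))).
  rewrite lerN2 ler_wpM2l ?sqr_ge0// lef_pV2 ?posrE ?mulr_gt0 ?ltr_wpDr ?divr_ge0 ?(ltW s0)//.
  by rewrite ler_pM2l// lerD2l ler_pdivrMr// ler_peMr.
rewrite lerNl opprD opprK addrC ler_pdivlMr ?mulr_gt0 ?ltr_wpDr//.
nra.
Qed.

(** For [n > 2 t] both terms are below the tail bound and [v^2 >= t] makes the factor [1 / t]
    harmless. For [n <= 2 t] the exponents differ by at most [v^2 / t] on one side and [v^4 / t] on
    the other; these polynomials cost half of the exponential rate, which drops from [1/2] to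
    [1/4]. *)
Lemma heat1_gauss : exists2 C : R, 0 < C & forall t n, 1 <= t ->
  `|heat1 t n - heat1 t 0 * expR (- (n%:R ^+ 2 / (4 * t)))| <=
  heat1 t 0 * (C / t * expR (- (n%:R / Num.sqrt t / 4))).
Proof.
have c4 : 0 < 4^-1 :> R by [].
have [C4 C40 h4] := expr_le_expR 4 c4; have [C2 C20 h2] := expr_le_expR 2 c4.
exists (expR 1 * (C4 + C2)); first by rewrite mulr_gt0 ?expR_gt0 ?addr_gt0.
move=> t n t1; have t0 : 0 < t by rewrite (lt_le_trans _ t1).
have q0 := heat1_nat_gt0 0 t0.
set s := Num.sqrt t; have s0 : 0 < s by rewrite sqrtr_gt0.
have ts : t = s ^+ 2 by rewrite sqr_sqrtr// ltW.
set v := n%:R / s; have v0 : 0 <= v by rewrite divr_ge0// ltW.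
have nv : n%:R = v * s by rewrite divfK// gt_eqF.
set r := heat1 t n / heat1 t 0; set g := expR (- (n%:R ^+ 2 / (4 * t))).
have rE : heat1 t n = heat1 t 0 * r by rewrite mulrC divfK// gt_eqF.
rewrite rE -mulrBr normrM gtr0_norm// ler_pM2l//.
have r0 : 0 <= r by rewrite divr_ge0 ?ltW// heat1_nat_gt0.
have g0 : 0 <= g by exact: expR_ge0.
have rt : r <= expR 1 * expR (- (v / 2)).
  by rewrite /r ler_pdivrMr// mulrC; exact: heat1_tail.
have gE : g = expR (- (v ^+ 2 / 4)).
  by rewrite /g nv {1}ts; congr (expR (- _)); field; rewrite gt_eqF.
have gt : g <= expR 1 * expR (- (v / 2)).
  by rewrite gE -expRD ler_expR; nra.
have poly : (v ^+ 4 + v ^+ 2) * (expR 1 * expR (- (v / 2))) <=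
    expR 1 * (C4 + C2) * expR (- (v / 4)).
  rewrite mulrCA -mulrA ler_wpM2l ?expR_ge0//.
  rewrite (_ : - (v / 2) = - (4^-1 * v) + - (v / 4)); last by lra.
  rewrite expRD mulrA ler_wpM2r ?expR_ge0//.
  rewrite expRN -ler_pdivlMr ?invr_gt0 ?expR_gt0// invrK mulrDl.
  by rewrite lerD// ?h4 ?h2.
have i0 : 0 <= t^-1 by rewrite invr_ge0 ltW.
suff key : `|r - g| <= (v ^+ 4 + v ^+ 2) * (expR 1 * expR (- (v / 2))) * t^-1.
  apply: (le_trans key); rewrite (_ : _ / t * _ =
    expR 1 * (C4 + C2) * expR (- (v / 4)) * t^-1); last by ring.
  by rewrite ler_wpM2r.
have [tn|nt] := ltP (2 * t) n%:R.
  have h1 : 1 <= (v ^+ 4 + v ^+ 2) / t.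
    rewrite ler_pdivlMr// mul1r.
    have v2 : 2 * s <= v by rewrite ler_pdivlMr// -mulrA -expr2 -ts ltW.
    have v4 : 0 <= v ^+ 4 by rewrite exprn_ge0.
    have tv : t <= v ^+ 2 by rewrite ts ler_pXn2r ?nnegrE// ?(ltW s0)//; lra.
    by lra.
  rewrite mulrAC; apply: (@le_trans _ _ (1 * (expR 1 * expR (- (v / 2))))).
    by rewrite mul1r ler_norml; apply/andP; split; lra.
  by rewrite ler_wpM2r// mulr_ge0 ?expR_ge0.
have p0 : 0 <= expR 1 * expR (- (v / 2)) by rewrite mulr_ge0 ?expR_ge0.
have v40 : 0 <= v ^+ 4 by rewrite exprn_ge0.
have v20 : 0 <= v ^+ 2 by rewrite exprn_ge0.
rewrite ler_norml; apply/andP; split.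
  have lo : g * (1 - v ^+ 2 / t) <= r.
    have := heat1_lower n t0; rewrite rE ler_pM2l//; apply: le_trans.
    rewrite [in leRHS]mulrDr [in leRHS]mulr1 opprD expRD -/g ler_wpM2l//.
    apply: le_trans (expR_ge1Dx _); rewrite lerD2l lerN2.
    rewrite nv {1}ts (_ : _ / (4 * s ^+ 2) = v ^+ 2 / 4); last by field; rewrite gt_eqF.
    by rewrite ler_wpM2r//; lra.
  have k : g * (v ^+ 2 / t) <= (v ^+ 4 + v ^+ 2) * (expR 1 * expR (- (v / 2))) / t.
    rewrite mulrA ler_wpM2r// mulrC; apply: ler_pM => //; lra.
  by move: lo; rewrite mulrBr mulr1; lra.
have hi : r * (1 - v ^+ 4 / t) <= g.
  have := heat1_upper_gauss t0 nt; rewrite rE ler_pM2l// expRD -/g => h.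
  have : r * expR (- (n%:R ^+ 4 / (16 * t ^+ 3))) <= g.
    by rewrite expRN ler_pdivrMr ?expR_gt0.
  apply: le_trans; rewrite ler_wpM2l//; apply: le_trans (expR_ge1Dx _).
  rewrite lerD2l lerN2 nv (_ : _ / _ = v ^+ 4 / 16 / t); last first.
    by rewrite ts; field; rewrite gt_eqF.
  by rewrite ler_wpM2r//; lra.
have k : r * (v ^+ 4 / t) <= (v ^+ 4 + v ^+ 2) * (expR 1 * expR (- (v / 2))) / t.
  rewrite mulrA ler_wpM2r// mulrC; apply: ler_pM => //; lra.
by move: hi; rewrite mulrBr mulr1; lra.
Qed.

(* [S t = t * heat1 t 0 ^ 2] satisfies [|S'| <= 2 S / t^2], so that
   [S e^{-2/t}] increases, [S e^{2/t}] decreases, and both have the same limit. *)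
Lemma heat1_0_asymp : exists2 A : R, 0 < A & forall t, 1 <= t ->
  A * expR (- t^-1) <= Num.sqrt t * heat1 t 0 /\
  Num.sqrt t * heat1 t 0 <= A * expR t^-1.
Proof.
pose S t := t * heat1 t 0 ^+ 2.
pose S' t := heat1 t 0 ^+ 2 + t * (2 * heat1 t 0 * (- 2 * heat1 t 0 + 2 * heat1 t 1)).
have dS t : is_derive t 1 S (S' t).
  have h := derM (derI t) (derX 1 (is_derive_heat1 t 0)).
  apply: (is_derive_eq h); rewrite /S' add0r sub0r heat1_sym expr1; ring.
have S0 t : 0 < t -> 0 < S t by move=> t0; rewrite mulr_gt0 ?exprn_gt0 ?heat1_nat_gt0.
have bound t : 0 < t -> `|S' t| <= 2 / t ^+ 2 * S t.
  move=> t0; have q0 := heat1_nat_gt0 0 t0; have b0 := heat1_nat_gt0 1 t0.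
  have r2 := ratio2 0 t0; have r3 := ratio3 0 t0.
  have y0E : y t 0 = t^-1 / 4 by rewrite /y; field; rewrite gt_eqF.
  have y1E : y t 1 = 3 * t^-1 / 4 by rewrite /y; field; rewrite gt_eqF.
  rewrite y0E y1E in r2 r3.
  have i0 : 0 < t^-1 by rewrite invr_gt0.
  set u := t^-1 in r2 r3 i0 y0E y1E.
  set a := heat1 t 0 in q0 r2 r3 *; set b := heat1 t 1 in b0 r2 r3 *.
  have -> : 2 / t ^+ 2 * S t = a * (2 * u * a).
    by rewrite /S /u -/a; field; rewrite gt_eqF.
  have -> : S' t = a * (a + 4 * t * (b - a)) by rewrite /S' -/a -/b; ring.
  rewrite normrM gtr0_norm// ler_pM2l//.
  have ub : 4 * t * (b - a) <= (- 1 + u / 8) * a.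
    rewrite (_ : (-1 + u / 8) * a = 4 * t * ((- (u / 4) + u ^+ 2 / 32) * a)); last first.
      by rewrite /u; field; rewrite gt_eqF.
    by rewrite ler_pM2l ?mulr_gt0//; nra.
  have lb : (- 1 - 9 / 8 * u) * a <= 4 * t * (b - a).
    rewrite (_ : (-1 - 9 / 8 * u) * a = 4 * t * ((- (u / 4) - 9 / 32 * u ^+ 2) * a)); last first.
      by rewrite /u; field; rewrite gt_eqF.
    rewrite ler_pM2l ?mulr_gt0//.
    set z := u / 4 + 9 / 32 * u ^+ 2.
    have z0 : 0 < z by rewrite addr_gt0 ?divr_gt0 ?mulr_gt0 ?exprn_gt0.
    have r3' : a <= (1 + z) * b by move: r3; rewrite /z; nra.
    have : a * (1 - z) <= b.
      have [z1|z1] := leP 1 z.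
        by apply: le_trans (ltW b0); rewrite pmulr_rle0// subr_le0.
      have h1 : a * (1 - z) <= (1 + z) * b * (1 - z).
        by rewrite ler_wpM2r// subr_ge0 ltW.
      have h2 : 0 <= z ^+ 2 * b by rewrite mulr_ge0 ?sqr_ge0 ?ltW.
      by nra.
    by rewrite /z; nra.
  by rewrite ler_norml; apply/andP; split; nra.
pose G t := S t * expR (- (2 / t)); pose H t := S t * expR (2 / t).
have dinv t c : 0 < t -> is_derive t 1 (fun s => expR (c / s)) (expR (c / t) * (- c / t ^+ 2)).
  move=> t0; have h := der_exp (derM (derC c t) (is_deriveV (lt0r_neq0 t0) (derI t))).
  apply: (is_derive_eq h); rewrite /GRing.scale/=; field.
  by rewrite gt_eqF.
have dG (r : R) : 0 < r -> is_derive r 1 G (expR (- (2 / r)) * (S' r + 2 / r ^+ 2 * S r)).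
  move=> r0; have := derM (dS r) (dinv r (- 2) r0).
  rewrite (_ : (fun t => _) = G); last by apply/funext => z; rewrite /G mulNr.
  by move=> h; apply: (is_derive_eq h); rewrite opprK mulNr; ring.
have dH (r : R) : 0 < r -> is_derive r 1 H (expR (2 / r) * (S' r - 2 / r ^+ 2 * S r)).
  move=> r0; have h := derM (dS r) (dinv r 2 r0).
  by apply: (is_derive_eq h); ring.
have Gmon s t : 1 <= s -> s <= t -> G s <= G t.
  move=> s1 st; pose g (r : R) := expR (- (2 / r)) * (S' r + 2 / r ^+ 2 * S r).
  have D1 r : s <= r <= t -> is_derive r 1 G (g r).
    by move=> /andP[sr _]; exact: (dG r (lt_le_trans ltr01 (le_trans s1 sr))).
  have D2 r : s < r < t -> 0 <= g r.
    move=> /andP[sr _]; have r0 : 0 < r by rewrite (lt_le_trans _ (le_trans s1 (ltW sr))).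
    by have := bound r r0; rewrite ler_norml => /andP[h _]; rewrite mulr_ge0 ?expR_ge0//; lra.
  exact: (@derive_ge0_le R G g s t st D1 D2).
have Hmon s t : 1 <= s -> s <= t -> H t <= H s.
  move=> s1 st; pose g (r : R) := expR (2 / r) * (S' r - 2 / r ^+ 2 * S r).
  have D1 r : s <= r <= t -> is_derive r 1 H (g r).
    by move=> /andP[sr _]; exact: (dH r (lt_le_trans ltr01 (le_trans s1 sr))).
  have D2 r : s < r < t -> g r <= 0.
    move=> /andP[sr _]; have r0 : 0 < r by rewrite (lt_le_trans _ (le_trans s1 (ltW sr))).
    by have := bound r r0; rewrite ler_norml => /andP[_ h]; rewrite mulr_ge0_le0 ?expR_ge0//; lra.
  exact: (@derive_le0_ge R H g s t st D1 D2).
have GH s t : 1 <= s -> 1 <= t -> G s <= H t.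
  move=> s1 t1; pose m := Num.max s t.
  apply: (le_trans (Gmon s m s1 _)); first by rewrite le_max lexx.
  apply: (le_trans _ (Hmon t m t1 _)); last by rewrite le_max lexx orbT.
  have m0 : 0 < m by rewrite lt_max (lt_le_trans _ s1).
  have m2 : 0 < 2 / m by rewrite divr_gt0.
  by rewrite /G /H ler_pM2l ?S0// ler_expR; lra.
pose E := [set G t | t in [set t | 1 <= t]].
have E1 : E (G 1) by exists 1 => //=.
have supE : has_sup E.
  split; first by exists (G 1).
  by exists (H 1) => _ [s s1 <-]; exact: GH.
have A2G t : 1 <= t -> G t <= sup E by move=> t1; apply: ub_le_sup; [case: supE|exists t].
have A2H t : 1 <= t -> sup E <= H t.
  by move=> t1; apply: ge_sup; [case: supE|move=> _ [s s1 <-]; exact: GH].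
have A20 : 0 < sup E.
  by apply: lt_le_trans (A2G 1 (lexx _)); rewrite mulr_gt0 ?S0 ?expR_gt0.
exists (Num.sqrt (sup E)); first by rewrite sqrtr_gt0.
move=> t t1; have t0 : 0 < t by rewrite (lt_le_trans _ t1).
have q0 := heat1_nat_gt0 0 t0.
have sq : (Num.sqrt t * heat1 t 0) ^+ 2 = S t by rewrite exprMn sqr_sqrtr// ltW.
have e2 c : expR c ^+ 2 = expR (2 * c) by rewrite -expRM_natl.
split.
  rewrite -(@ler_pXn2r _ 2)// ?nnegrE ?mulr_ge0 ?sqrtr_ge0 ?expR_ge0 ?(ltW q0)//.
  rewrite sq exprMn sqr_sqrtr ?(ltW A20)// e2 mulrN expRN ler_pdivrMr ?expR_gt0//.
  exact: A2H.
rewrite -(@ler_pXn2r _ 2)// ?nnegrE ?mulr_ge0 ?sqrtr_ge0 ?expR_ge0 ?(ltW q0)//.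
rewrite sq exprMn sqr_sqrtr ?(ltW A20)// e2 -ler_pdivrMr ?expR_gt0// -expRN.
exact: A2G.
Qed.

End OneDimensionalBounds.

(** * Local limit theorem *)

Section LocalLimit.
Variable R : realType.
Implicit Types (t r v a b : R) (n : int).

Let expR_quad v : expR (- (v ^+ 2 / 4)) <= expR 1 * expR (- (v / 2)).
Proof.
rewrite -expRD ler_expR -subr_ge0.
rewrite (_ : _ - _ = (v / 2 - 2^-1) ^+ 2 + 3 / 4); last by field.
by rewrite addr_ge0 ?sqr_ge0.
Qed.

Lemma normz_natr n : `|n%:~R| = `|n|%N%:R :> R.
Proof. by rewrite -intr_norm -[`|n|%R]abszE. Qed.

Lemma heat1_abs t n : heat1 t n = heat1 t `|n|%N.
Proof.
by case: n => n //; rewrite NegzE heat1_sym abszN.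
Qed.

(* The Gaussian is left unnormalised: the constant [A] cancels in the quotient [wsa]. *)
Lemma heat1_local_limit : exists A C : R, [/\ 0 < A, 0 < C & forall t n, 1 <= t ->
  let E := expR (- (`|n%:~R| / Num.sqrt t / 4)) in
  let g := A / Num.sqrt t * expR (- (n%:~R ^+ 2 / (4 * t))) in
  [/\ heat1 t n <= C / Num.sqrt t * E, g <= C / Num.sqrt t * E
    & `|heat1 t n - g| <= t^-1 * (C / Num.sqrt t * E)] ].
Proof.
have [A A0 hA] := @heat1_0_asymp R; have [C C0 hC] := @heat1_gauss R.
set e := expR (1 : R); have e0 : 0 < e by exact: expR_gt0.
have e1 : 1 <= e by rewrite -expR0 ler_expR.
exists A, (A * e * (C + e)); split => //; first by rewrite !mulr_gt0 ?addr_gt0.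
move=> t n t1 E g; have t0 : 0 < t by rewrite (lt_le_trans _ t1).
set s := Num.sqrt t in E g *; have s0 : 0 < s by rewrite sqrtr_gt0.
have ts : t = s ^+ 2 by rewrite sqr_sqrtr// ltW.
pose v := `|n%:~R| / s : R; have v0 : 0 <= v by rewrite divr_ge0// ltW.
have EE : E = expR (- (v / 4)) by [].
have E0 : 0 < E by exact: expR_gt0.
have E2 : expR (- (v / 2)) <= E by rewrite EE ler_expR; lra.
have u0 : 0 < t^-1 by rewrite invr_gt0.
have u1 : t^-1 <= 1 by rewrite invf_le1.
have [lo hi] := hA t t1; rewrite -/s in lo hi.
set q := heat1 t 0 in lo hi.
have q0 : 0 < q by exact: heat1_nat_gt0.
pose G := expR (- (n%:~R ^+ 2 / (4 * t))) : R.
have gE : g = A / s * G by [].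
have GE : G <= e * E.
  rewrite /G (_ : n%:~R ^+ 2 / (4 * t) = v ^+ 2 / 4); last first.
    by rewrite /v exprMn real_normK ?num_real// {1}ts; field; rewrite gt_eqF.
  by apply: (le_trans (expR_quad v)); rewrite ler_wpM2l// ltW.
have G0 : 0 < G by exact: expR_gt0.
have eu : expR t^-1 <= e by rewrite ler_expR.
have sq : q <= A * e / s.
  rewrite ler_pdivlMr// mulrC; apply: (le_trans hi).
  by rewrite ler_wpM2l// ltW.
have sqA : `|q - A / s| <= t^-1 * (A * e / s).
  rewrite (_ : q - A / s = (s * q - A) / s); last by field; rewrite gt_eqF.
  rewrite normrM [`|s^-1|]gtr0_norm ?invr_gt0// [leRHS]mulrA ler_pM2r ?invr_gt0//.
  have h1 : A * (1 - t^-1) <= s * q.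
    by apply: le_trans lo; rewrite ler_wpM2l ?(ltW A0)//; exact: expR_ge1Dx.
  have h2 : s * q <= A * (1 + t^-1 * e).
    apply: (le_trans hi); rewrite ler_wpM2l ?(ltW A0)//.
    have := expR_ge1Dx (- t^-1); rewrite expRN => h3.
    have : (1 - t^-1) * expR t^-1 <= 1.
      by rewrite -ler_pdivlMr ?expR_gt0// mul1r.
    have : t^-1 * expR t^-1 <= t^-1 * e by rewrite ler_wpM2l// ltW.
    lra.
  have h3 : A * t^-1 <= t^-1 * (A * e).
    by rewrite mulrC ler_wpM2l ?(ltW u0)// ler_peMr// ltW.
  by rewrite ler_norml; apply/andP; split; lra.
have hE : heat1 t n = heat1 t `|n|%N by exact: heat1_abs.
have h1 : heat1 t n <= q * (e * E).
  rewrite hE; apply: (le_trans (heat1_tail _ t1)).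
  rewrite ler_wpM2l ?(ltW q0)// ler_wpM2l ?(ltW e0)//.
  by rewrite -normz_natr -/s -/v.
have h2 : `|heat1 t n - q * G| <= q * (C * t^-1 * E).
  rewrite hE /G -[n%:~R ^+ 2]real_normK ?num_real// normz_natr EE /v normz_natr.
  exact: hC.
have i0 : 0 < s^-1 by rewrite invr_gt0.
have Ce : 0 <= A * e * C by rewrite !mulr_ge0 ?(ltW A0) ?(ltW e0) ?(ltW C0).
have CC : A * e * e <= A * e * (C + e).
  by rewrite mulrDr lerDr.
split.
- apply: (le_trans h1); apply: (@le_trans _ _ (A * e / s * (e * E))).
    by rewrite ler_wpM2r// mulr_ge0 ?ltW.
  rewrite (_ : A * e / s * (e * E) = A * e * e / s * E); last by ring.
  by rewrite ler_pM2r// ler_pM2r.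
- rewrite gE; apply: (@le_trans _ _ (A / s * (e * E))).
    by rewrite ler_wpM2l// mulr_ge0 ?ltW.
  rewrite (_ : A / s * (e * E) = A * e / s * E); last by ring.
  rewrite ler_pM2r// ler_pM2r//; apply: le_trans CC.
  by rewrite ler_peMr// mulr_ge0 ?ltW.
- rewrite (_ : _ - g = (heat1 t n - q * G) + (q - A / s) * G); last by rewrite gE; ring.
  apply: (le_trans (ler_normD _ _)).
  rewrite normrM [`|G|]gtr0_norm//.
  rewrite (_ : t^-1 * _ = A * e / s * (C * t^-1 * E) + t^-1 * (A * e / s) * (e * E)); last by ring.
  apply: lerD.
    apply: (le_trans h2); rewrite ler_wpM2r// !mulr_ge0 ?(ltW C0) ?(ltW u0) ?(ltW E0)//.
  by apply: ler_pM => //; exact: ltW.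
Qed.

Lemma prod_diff_le d (a b M : 'I_d -> R) (eps : R) : 0 <= eps ->
  (forall i, 0 <= a i <= M i) -> (forall i, 0 <= b i <= M i) ->
  (forall i, `|a i - b i| <= eps * M i) ->
  `|\prod_i a i - \prod_i b i| <= d%:R * eps * \prod_i M i.
Proof.
move=> e0; elim: d a b M => [|d IH] a b M ha hb hab.
  by rewrite !big_ord0 subrr normr0 !mul0r.
rewrite !big_ord_recl.
set a0 := a ord0; set b0 := b ord0; set M0 := M ord0.
set pa := \prod_i a _; set pb := \prod_i b _; set pM := \prod_i M _.
have M00 i : 0 <= M i by have /andP[/le_trans] := ha i; apply.
have pa0 : 0 <= pa <= pM.
  rewrite prodr_ge0/=; last by move=> i _; have /andP[] := ha (lift ord0 i).
  by apply: ler_prod => i _; exact: ha.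
rewrite (_ : _ - _ = (a0 - b0) * pa + b0 * (pa - pb)); last by ring.
apply: (le_trans (ler_normD _ _)); rewrite !normrM.
have /andP[b00 b01] := hb ord0; have /andP[pa00 pa01] := pa0.
rewrite [`|pa|]ger0_norm// [`|b0|]ger0_norm//.
have h1 : `|a0 - b0| * pa <= eps * M0 * pM by apply: ler_pM => //; exact: hab.
have h2 : b0 * `|pa - pb| <= M0 * (d%:R * eps * pM).
  by apply: ler_pM => //; apply: IH => i; [exact: ha|exact: hb|exact: hab].
apply: (le_trans (lerD h1 h2)); rewrite -natr1.
by rewrite le_eqVlt; apply/orP; left; apply/eqP; ring.
Qed.

Variable d : nat.
Implicit Types (x : Zd d).

Lemma enorm_ge0 x : 0 <= enorm R x.
Proof. exact: sqrtr_ge0. Qed.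

Lemma enorm_sqr x : enorm R x ^+ 2 = \sum_(i < d) ((x 0 i)%:~R) ^+ 2.
Proof. by rewrite sqr_sqrtr// sumr_ge0// => i _; rewrite sqr_ge0. Qed.

Lemma enorm_le_l1 x : enorm R x <= \sum_(i < d) `|(x 0 i)%:~R|.
Proof.
have s0 (D : {pred 'I_d}) : 0 <= \sum_(i | D i) `|(x 0 i)%:~R| :> R by rewrite sumr_ge0.
rewrite -(@ler_pXn2r _ 2)// ?nnegrE ?enorm_ge0 ?s0// enorm_sqr expr2 mulr_suml.
apply: ler_sum => i _; rewrite -real_normK ?num_real// expr2 ler_wpM2l//.
by rewrite (bigD1 i)//= lerDl s0.
Qed.

Lemma prod_expR_l1 x c : 0 <= c ->
  \prod_(i < d) expR (- (`|(x 0 i)%:~R| * c)) <= expR (- (enorm R x * c)).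
Proof.
move=> c0; rewrite -expR_sum ler_expR sumrN -mulr_suml lerN2.
by rewrite ler_wpM2r// enorm_le_l1.
Qed.

(** The relative errors of the [d] factors add up to [d / t], and the exponentials in the
    coordinates multiply to one in the [l^1] norm, which dominates the Euclidean norm. *)
Lemma heat_local_limit : exists A C : R, [/\ 0 < A, 0 < C & forall t x, 1 <= t ->
  heat t x <= C / Num.sqrt t ^+ d /\
  `|heat t x - A / Num.sqrt t ^+ d * expR (- (enorm R x ^+ 2 / (4 * t)))| <=
    t^-1 * (C / Num.sqrt t ^+ d * expR (- (enorm R x / Num.sqrt t / 4)))].
Proof.
have [A [C [A0 C0 h]]] := heat1_local_limit.
exists (A ^+ d), (d.+1%:R * C ^+ d); split; first exact: exprn_gt0.
  by rewrite mulr_gt0// exprn_gt0.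
move=> t x t1; have t0 : 0 < t by rewrite (lt_le_trans _ t1).
set s := Num.sqrt t; have s0 : 0 < s by rewrite sqrtr_gt0.
have u0 : 0 <= t^-1 by rewrite invr_ge0 ltW.
pose M (i : 'I_d) := C / s * expR (- (`|(x 0 i)%:~R| / s / 4)).
have i0 : 0 <= C ^+ d / s ^+ d by rewrite divr_ge0 ?exprn_ge0 ?ltW.
have PM : \prod_i M i <= C ^+ d / s ^+ d * expR (- (enorm R x / s / 4)).
  rewrite /M big_split/= prodr_const card_ord exprMn exprVn.
  rewrite ler_wpM2l// -mulrA.
  under eq_bigr do rewrite -mulrA.
  by apply: prod_expR_l1; rewrite mulr_ge0// invr_ge0 ltW.
have M0 i : 0 <= M i by rewrite mulr_ge0 ?expR_ge0// divr_ge0 ?ltW.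
have PM1 : \prod_i M i <= C ^+ d / s ^+ d.
  apply: (le_trans PM); rewrite ler_piMr// -expR0 ler_expR oppr_le0.
  by rewrite mulr_ge0// divr_ge0 ?enorm_ge0 ?ltW.
pose b (i : 'I_d) := A / s * expR (- ((x 0 i)%:~R ^+ 2 / (4 * t))).
have PB : \prod_i b i = A ^+ d / s ^+ d * expR (- (enorm R x ^+ 2 / (4 * t))).
  rewrite /b big_split/= prodr_const card_ord exprMn exprVn; congr (_ * _).
  by rewrite -expR_sum sumrN enorm_sqr mulr_suml.
rewrite (heat_prod _ (ltW t0)); split.
  apply: (@le_trans _ _ (\prod_i M i)).
    apply: ler_prod => i _; rewrite heat1_ge0 ?(ltW t0)//=.
    by have [] := h t (x 0 i) t1.
  apply: (le_trans PM1); rewrite -mulrA ler_peMl// ler1n//.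
rewrite -PB; apply: (le_trans (@prod_diff_le _ _ _ M _ u0 _ _ _)).
- move=> i; rewrite heat1_ge0 ?(ltW t0)//=.
  by have [] := h t (x 0 i) t1.
- move=> i; have [_ ->] := h t (x 0 i) t1; rewrite andbT.
  by rewrite mulr_ge0 ?expR_ge0// divr_ge0 ?ltW.
- by move=> i; have [_ _] := h t (x 0 i) t1.
rewrite (_ : d%:R / t * _ = t^-1 * (d%:R * \prod_i M i)); last by ring.
rewrite ler_wpM2l// -[leRHS]mulrA -[leRHS]mulrA; apply: ler_pM => //.
- by rewrite prodr_ge0.
- by rewrite ler_nat.
- by rewrite mulrA.
Qed.

(** Complements the local limit theorem on short times: for [t <= 1] the exponent in [heat1_upper]
    is at least [n^2 / (2 (2 + n))], hence at least [n / 2 - 1]. *)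
Lemma heat_small_time t x : 0 < t -> t <= 1 ->
  heat t x <= expR d%:R * expR (- (enorm R x / 2)).
Proof.
move=> t0 t1; rewrite (heat_prod _ (ltW t0)).
apply: (@le_trans _ _ (\prod_(i < d) (expR 1 * expR (- (`|(x 0 i)%:~R| / 2))))).
  apply: ler_prod => i _; rewrite heat1_ge0 ?(ltW t0)//=.
  rewrite heat1_abs normz_natr; set n := absz (x 0 i).
  apply: (le_trans (heat1_upper n t0)).
  apply: (@le_trans _ _ (1 * expR (- (n%:R ^+ 2 / (2 * (2 * t + n%:R)))))).
    by rewrite ler_wpM2r ?expR_ge0// heat_le1// ltW.
  rewrite mul1r -expRD ler_expR.
  have n0 : 0 <= n%:R :> R by [].
  have p1 : 0 < 2 * (2 + n%:R) :> R by rewrite mulr_gt0// ltr_wpDr.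
  apply: (@le_trans _ _ (- (n%:R ^+ 2 / (2 * (2 + n%:R))))).
    rewrite lerN2 ler_wpM2l ?sqr_ge0// lef_pV2 ?posrE//; last first.
      by rewrite mulr_gt0// ltr_wpDr// mulr_gt0.
    by rewrite ler_pM2l// lerD2r; lra.
  rewrite lerNl opprD opprK addrC ler_pdivlMr//; nra.
rewrite big_split/= prodr_const card_ord -expRM_natl mulr1.
by rewrite ler_wpM2l ?expR_ge0//; exact: prod_expR_l1.
Qed.

Lemma heat_gt0 t x : 0 < t -> 0 < heat t x.
Proof.
by move=> t0; rewrite (heat_prod _ (ltW t0)) prodr_gt0// => i _; exact: heat1_gt0.
Qed.

Lemma sqrt_powR t : 0 < t -> (Num.sqrt t ^+ d)^-1 = t `^ (- (d%:R / 2)).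
Proof.
move=> t0; rewrite -powR12_sqrt ?ltW// -powR_mulrn ?powR_ge0// -powRrM powRN.
by congr (_ `^ _)^-1; rewrite mulrC.
Qed.

End LocalLimit.

(** * Riesz kernels *)

Section RieszKernel.
Variables (R : realType) (d : nat).
Implicit Types (a b c r t : R) (x y : Zd d).

Definition kint a x : \bar R :=
  (\int[mu]_(t in pos) (heat t x * t `^ (a - 1))%:E)%E.

Lemma measurable_kint a x : measurable_fun setT (fun t => heat t x * t `^ (a - 1)).
Proof. by apply: measurable_funM; [exact: measurable_heat|exact: measurable_powR]. Qed.

Lemma kint_integrand_ge0 a x t : 0 < t -> 0 <= heat t x * t `^ (a - 1).
Proof. by move=> t0; rewrite mulr_ge0 ?powR_ge0 ?heat_ge0// ltW. Qed.

Lemma kint_ge0 a x : (0 <= kint a x)%E.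
Proof. by apply: integral_ge0 => t t0; rewrite lee_fin kint_integrand_ge0. Qed.

Lemma heat_decay : exists2 C : R, 0 < C & forall t x, 1 <= t ->
  heat t x <= C * t `^ (- (d%:R / 2)).
Proof.
have [A [C [_ C0 h]]] := heat_local_limit R d; exists C => // t x t1.
have [+ _] := h t x t1; rewrite sqrt_powR//; exact: lt_le_trans t1.
Qed.

Lemma powR_mulD t a b : 0 < t -> t `^ a * t `^ b = t `^ (a + b).
Proof. by move=> t0; rewrite powRD// (gt_eqF t0) implybT. Qed.

Lemma kint_bounded a : 0 < a -> a < d%:R / 2 ->
  exists K : R, forall x, (kint a x <= K%:E)%E.
Proof.
move=> a0 ad; have [C C0 h] := heat_decay; have b0 : 0 < d%:R / 2 - a by rewrite subr_gt0.
eexists => x; apply: (@integral_pos_bound R a (d%:R / 2 - a) 1 1 C) => //.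
- exact: ltW.
- exact: measurable_kint.
- by move=> t t0; exact: kint_integrand_ge0.
- by move=> t t0 t1; rewrite ler_wpM2r ?powR_ge0 ?heat_le1// ltW.
- move=> t t1; have t0 : 0 < t by rewrite (lt_le_trans _ t1).
  rewrite [leRHS](_ : _ = (C * t `^ (- (d%:R / 2))) * t `^ (a - 1)).
    by rewrite ler_wpM2r ?powR_ge0 ?h.
  by rewrite -[RHS]mulrA powR_mulD//; congr (_ * _ `^ _); ring.
Qed.

Lemma kint_fin_num a x : 0 < a -> a < d%:R / 2 -> kint a x \is a fin_num.
Proof.
move=> a0 ad; have [K h] := kint_bounded a0 ad.
by rewrite ge0_fin_numE ?kint_ge0// (le_lt_trans (h x))// ltry.
Qed.

(** The kernel of the negative power [-a] of the Laplacian, as a normalised Mellin transform of the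
    heat kernel in time. *)
Definition riesz a x : R := fine (kint a x) / Gamma_pos a.

Lemma kappaN a x : 0 < a -> kappa (- a) x = riesz a x.
Proof.
move=> a0; rewrite /kappa oppr_eq0 (gt_eqF a0) (_ : (- a == 1) = false); last first.
  by rewrite -subr_eq0 lt_eqF// -opprD oppr_lt0 addr_gt0.
rewrite oppr_gt0 ltNge (ltW a0)/= /riesz /kint.
have -> : `|Gamma (- - a)| = Gamma_pos a.
  by rewrite opprK /Gamma a0 gtr0_norm// Gamma_pos_gt0.
apply: (congr1 (fun z => fine z / Gamma_pos a)); apply: eq_integral => t _.
by rewrite (_ : -1 - - a = a - 1)//; ring.
Qed.

(** The power of [r] is dictated by the scaling [t = r^2 tau]. Up to time [r^2], comparing the
    exponential with the power [2 (b + 2)] of [r / sqrt t] cancels the singularity; beyond it the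
    exponential is bounded by 1. *)
Lemma error_integral b : 0 < b -> exists2 K : R, 0 < K & forall r, 0 < r ->
  (\int[mu]_(t in pos) (t `^ (- b - 2) * expR (- (r * t `^ (- 2^-1) / 4)))%:E <=
   (K * r `^ (- (2 * b + 2)))%:E)%E.
Proof.
move=> b0; have m0 : 0 <= 2 * (b + 2) by rewrite mulr_ge0// addr_ge0// ltW.
have c0 : 0 < 4^-1 :> R by [].
have [C C0 h] := powR_le_expR m0 c0.
exists (C + (b + 1)^-1); first by rewrite addr_gt0// invr_gt0 addr_gt0.
move=> r r0; have r20 : 0 < r ^+ 2 by rewrite exprn_gt0.
have b10 : 0 < b + 1 by rewrite addr_gt0.
have rpow c : (r ^+ 2) `^ c = r `^ (2 * c).
  by rewrite -powR_mulrn ?ltW// -powRrM.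
have C10 : 0 <= C * r `^ (- (2 * (b + 2))) by rewrite mulr_ge0 ?powR_ge0// ltW.
apply: (le_trans (@integral_pos_bound R 1 (b + 1) (r ^+ 2)
  (C * r `^ (- (2 * (b + 2)))) 1 _ ltr01 b10 r20 C10 ler01 _ _ _ _)).
- apply: measurable_funM; first exact: measurable_powR.
  apply: measurableT_comp => //; apply: measurableT_comp => //.
  by apply: measurable_funM => //; apply: measurable_funM => //; exact: measurable_powR.
- by move=> t t0; rewrite mulr_ge0 ?powR_ge0 ?expR_ge0.
- move=> t t0 tr; rewrite subrr powRr0 mulr1.
  have v0 : 0 <= r * t `^ (- 2^-1) by rewrite mulr_ge0 ?powR_ge0 ?ltW.
  have hv := h _ v0.
  rewrite expRN ler_pdivrMr ?expR_gt0// powRN.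
  rewrite [leRHS](_ : _ = C * expR (4^-1 * (r * t `^ (- 2^-1))) / r `^ (2 * (b + 2))); last first.
    by rewrite [in LHS]mulrC; rewrite (mulrC 4^-1) mulrCA mulrA.
  rewrite ler_pdivlMr ?powR_gt0//; apply: le_trans hv.
  rewrite le_eqVlt; apply/orP; left; apply/eqP.
  rewrite powRM ?(ltW r0) ?powR_ge0// mulrC -powRrM; congr (_ * _ `^ _).
  by field.
- move=> t rt; have t0 : 0 < t by rewrite (lt_le_trans _ rt).
  rewrite mul1r (_ : - (b + 1) - 1 = - b - 2); last by ring.
  rewrite ler_piMr ?powR_ge0// -expR0 ler_expR oppr_le0.
  by rewrite !mulr_ge0 ?powR_ge0 ?ltW.
rewrite lee_fin [leRHS]mulrDl; apply: lerD.
  rewrite divr1 rpow -mulrA powR_mulD// ler_wpM2l ?(ltW C0)//.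
  by rewrite le_eqVlt; apply/orP; left; apply/eqP; congr (_ `^ _); ring.
rewrite mul1r rpow mulrC le_eqVlt; apply/orP; left; apply/eqP.
by congr (_ * _ `^ _); ring.
Qed.

(** The main term is the time integral of the Gaussian, and the extra [1 / t] in the error costs the
    factor [|x|^(-2)]. [A] is chosen before [a]: its independence of the exponent is what lets it
    cancel in the weight. *)
Lemma kint_asymp : exists2 A : R, 0 < A & forall a, 0 < a -> a < d%:R / 2 ->
  exists C : R, forall x, 1 <= enorm R x ->
  `|fine (kint a x) - A * (4 `^ (d%:R / 2 - a) * Gamma_pos (d%:R / 2 - a)) *
     enorm R x `^ (- (2 * (d%:R / 2 - a)))| <=
  C * enorm R x `^ (- (2 * (d%:R / 2 - a) + 2)).
Proof.
have [A [C [A0 C0 h]]] := heat_local_limit R d.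
exists A => // a a0 ad; set b := d%:R / 2 - a.
have b0 : 0 < b by rewrite subr_gt0.
have [K K0 hK] := error_integral b0.
have e0 : 0 <= 2 * b + 2 by rewrite addr_ge0// mulr_ge0// ltW.
have c0 : 0 < 2^-1 :> R by [].
have [D D0 hD] := powR_le_expR e0 c0.
(* [C] serves the local limit error for [t >= 1], and [A e] serves the Gaussian itself for [t <= 1],
   where nothing is compared. *)
pose K2 := C + A * expR 1.
have K20 : 0 < K2 by rewrite addr_gt0// mulr_gt0// expR_gt0.
exists (expR d%:R * expR 1 * D * Gamma_pos a + K2 * K) => x.
set r := enorm R x => r1.
have r0 : 0 < r by rewrite (lt_le_trans _ r1).
(* The factor [e] compensates the [exp (- t)] put into [E1], which makes its integral over the whole
   half-line a Gamma value. *)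
pose K1 := expR d%:R * expR 1 * expR (- (r / 2)).
have K10 : 0 < K1 by rewrite !mulr_gt0 ?expR_gt0.
pose P t := heat t x * t `^ (a - 1).
pose G t := A * (t `^ (- b - 1) * expR (- (r ^+ 2 / 4 * t `^ (-1)))).
pose E1 t := K1 * (t `^ (a - 1) * expR (- t)).
pose E2 t := K2 * (t `^ (- b - 2) * expR (- (r * t `^ (- 2^-1) / 4))).
have tG t : 0 < t -> G t = A / Num.sqrt t ^+ d * expR (- (r ^+ 2 / (4 * t))) * t `^ (a - 1).
  move=> t0; rewrite sqrt_powR// /G powR_inv1 ?(ltW t0)//.
  rewrite [RHS](_ : _ = A * (t `^ (- (d%:R / 2)) * t `^ (a - 1) *
    expR (- (r ^+ 2 / (4 * t))))); last by ring.
  rewrite powR_mulD//; congr (_ * (_ `^ _ * expR (- _))); first by rewrite /b; ring.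
  by field; rewrite gt_eqF.
have sqi t : 0 < t -> t `^ (- 2^-1) = (Num.sqrt t)^-1.
  by move=> t0; rewrite powRN powR12_sqrt// ltW.
have big t : 1 <= t -> `|P t - G t| <= E2 t.
  move=> t1; have t0 : 0 < t by rewrite (lt_le_trans _ t1).
  rewrite tG// /P -mulrBl normrM [`|_ `^ _|]ger0_norm ?powR_ge0//.
  have [_ hh] := h t x t1.
  apply: (le_trans (ler_wpM2r (powR_ge0 _ _) hh)).
  rewrite /E2 sqi// sqrt_powR// -/r -powR_inv1 ?(ltW t0)//.
  rewrite [leLHS](_ : _ = C * (t `^ (-1) * t `^ (- (d%:R / 2)) * t `^ (a - 1) *
     expR (- (r / Num.sqrt t / 4)))); last by ring.
  rewrite !powR_mulD// (_ : -1 - d%:R / 2 + (a - 1) = - b - 2); last by rewrite /b; ring.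
  by rewrite ler_wpM2r ?mulr_ge0 ?powR_ge0 ?expR_ge0// lerDl mulr_ge0 ?expR_ge0// ltW.
have E1_ge0 t : 0 <= E1 t by rewrite !mulr_ge0 ?powR_ge0 ?expR_ge0// ltW.
have E2_ge0 t : 0 <= E2 t by rewrite !mulr_ge0 ?powR_ge0 ?expR_ge0// ltW.
have P_ge0 t : 0 < t -> 0 <= P t by exact: kint_integrand_ge0.
have G_ge0 t : 0 <= G t by rewrite !mulr_ge0 ?powR_ge0 ?expR_ge0// ltW.
have smallP t : 0 < t -> t <= 1 -> P t <= E1 t.
  move=> t0 t1; rewrite /P /E1 /K1.
  apply: (le_trans (ler_wpM2r (powR_ge0 _ _) (heat_small_time x t0 t1))).
  rewrite -/r [leRHS](_ : _ = expR d%:R * expR (- (r / 2)) * t `^ (a - 1) *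
     (expR 1 * expR (- t))); last by ring.
  rewrite ler_peMr ?mulr_ge0 ?powR_ge0 ?expR_ge0//.
  by rewrite -expRD -[leLHS]expR0 ler_expR subr_ge0.
have smallG t : 0 < t -> t <= 1 -> G t <= E2 t.
  move=> t0 t1; have s0 : 0 < Num.sqrt t by rewrite sqrtr_gt0.
  rewrite /G /E2 sqi// powR_inv1 ?(ltW t0)//; apply: (@le_trans _ _ (A * expR 1 * (t `^ (- b - 2) *
     expR (- (r / Num.sqrt t / 4))))); last first.
    by rewrite ler_wpM2r ?mulr_ge0 ?powR_ge0 ?expR_ge0// lerDr ltW.
  rewrite -[leRHS]mulrA ler_wpM2l ?(ltW A0)// [leRHS]mulrCA; apply: ler_pM.
  - exact: powR_ge0.
  - exact: expR_ge0.
  - rewrite (_ : - b - 1 = - b - 2 + 1); last by ring.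
    by rewrite powRD ?(gt_eqF t0) ?implybT// powRr1 ?(ltW t0)// ler_piMr ?powR_ge0.
  - rewrite -expRD ler_expR; set v := r / Num.sqrt t.
    have v0 : 0 <= v by rewrite divr_ge0 ?ltW.
    rewrite (_ : r ^+ 2 / 4 / t = v ^+ 2 / 4); last first.
      by rewrite /v -[in LHS](sqr_sqrtr (ltW t0)); field; rewrite gt_eqF.
    rewrite -subr_ge0 (_ : _ - _ = (v / 2 - 4^-1) ^+ 2 + 15 / 16); last by field.
    by rewrite addr_ge0 ?sqr_ge0.
have PG t : 0 < t -> P t <= G t + (E1 t + E2 t).
  move=> t0; have [t1|t1] := leP t 1.
    have := smallP t t0 t1; have := G_ge0 t; have := E2_ge0 t; lra.
  by have := big t (ltW t1); rewrite ler_norml => /andP[]; have := E1_ge0 t; lra.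
have GP t : 0 < t -> G t <= P t + (E1 t + E2 t).
  move=> t0; have [t1|t1] := leP t 1.
    have := smallG t t0 t1; have := P_ge0 t t0; have := E1_ge0 t; lra.
  by have := big t (ltW t1); rewrite ler_norml => /andP[]; have := E1_ge0 t; lra.
have mP : measurable_fun setT P by exact: measurable_kint.
have mG : measurable_fun setT G.
  apply: measurable_funM => //; apply: measurable_funM; first exact: measurable_powR.
  apply: measurableT_comp => //; apply: measurableT_comp => //; exact: measurable_powRZ.
have mE1 : measurable_fun setT E1.
  by apply: measurable_funM => //; exact: measurable_gamma_ker.
have mE2' : measurable_fun setT (fun t => t `^ (- b - 2) * expR (- (r * t `^ (- 2^-1) / 4))).
  apply: measurable_funM; first exact: measurable_powR.
  apply: measurableT_comp => //; apply: measurableT_comp => //.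
  by apply: measurable_funM => //; exact: measurable_powRZ.
have mE2 : measurable_fun setT E2 by exact: measurable_funM.
have IG : (\int[mu]_(t in pos) (G t)%:E =
    (A * (4 `^ b * Gamma_pos b) * r `^ (- (2 * b)))%:E)%E.
  have r40 : 0 < r ^+ 2 / 4 by rewrite divr_gt0 ?exprn_gt0.
  rewrite ge0_integralZlR ?(ltW A0)//.
  - rewrite [X in (_ * X)%E](_ : _ = \int[mu]_(t in pos)
        (t `^ (- b - 1) * expR (- (r ^+ 2 / 4 / t)))%:E)%E; last first.
      by apply: eq_integral => t /[!inE] t0; rewrite powR_inv1// ltW.
    rewrite integral_powR_expR_inv// -EFinM; congr EFin.
    rewrite powRM ?invr_ge0 ?exprn_ge0 ?(ltW r0)//.
    rewrite -[r ^+ 2]powR_mulrn ?(ltW r0)// -[4^-1]powR_inv1// -!powRrM.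
    rewrite (_ : -1 * - b = b); last by ring.
    by rewrite (_ : 2 * - b = - (2 * b)); ring.
  - exact: measurable_pos.
  - apply: measurable_funTS; apply: measurable_funM; first exact: measurable_powR.
    apply: measurableT_comp => //; apply: measurableT_comp => //; exact: measurable_powRZ.
  - by move=> t _; rewrite mulr_ge0 ?powR_ge0 ?expR_ge0.
have IE1 : (\int[mu]_(t in pos) (E1 t)%:E = (K1 * Gamma_pos a)%:E)%E.
  rewrite ge0_integralZlR ?(ltW K10)//.
  - by rewrite Gamma_pos_integral// -EFinM.
  - exact: measurable_pos.
  - by apply: measurable_funTS; exact: measurable_gamma_ker.
  - by move=> t _; rewrite mulr_ge0 ?powR_ge0 ?expR_ge0.
have IE2 : (\int[mu]_(t in pos) (E2 t)%:E <= (K2 * (K * r `^ (- (2 * b + 2))))%:E)%E.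
  rewrite ge0_integralZlR ?(ltW K20)//.
  - by rewrite EFinM lee_pmul2l ?lte_fin//; exact: hK.
  - exact: measurable_pos.
  - exact: measurable_funTS.
  - by move=> t _; rewrite mulr_ge0 ?powR_ge0 ?expR_ge0.
pose e := K1 * Gamma_pos a + K2 * (K * r `^ (- (2 * b + 2))).
have IE : (\int[mu]_(t in pos) (E1 t + E2 t)%:E <= e%:E)%E.
  under eq_integral do rewrite EFinD.
  rewrite ge0_integralD//.
  - by rewrite IE1 EFinD leeD.
  - exact: measurable_pos.
  - by move=> t _; rewrite lee_fin mulr_ge0 ?(ltW K10)// mulr_ge0 ?powR_ge0 ?expR_ge0.
  - by apply/measurable_EFinP; exact: measurable_funTS.
  - by move=> t _; rewrite lee_fin mulr_ge0 ?(ltW K20)// mulr_ge0 ?powR_ge0 ?expR_ge0.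
  - by apply/measurable_EFinP; exact: measurable_funTS.
have addint (F H : R -> R) : measurable_fun setT F -> measurable_fun setT H ->
    (forall t, 0 < t -> 0 <= F t) -> (forall t, 0 < t -> F t <= H t + (E1 t + E2 t)) ->
    (forall t, 0 < t -> 0 <= H t) ->
    (\int[mu]_(t in pos) (F t)%:E <= \int[mu]_(t in pos) (H t)%:E + e%:E)%E.
  move=> mF mH F0 FH H0.
  apply: (@le_trans _ _ (\int[mu]_(t in pos) (H t + (E1 t + E2 t))%:E)%E).
    apply: le_integralR => //; first exact: measurable_pos.
    - exact: measurable_funTS.
    - by apply: measurable_funTS; apply: measurable_funD => //; exact: measurable_funD.
  under eq_integral do rewrite EFinD.
  rewrite ge0_integralD//.
  - by rewrite leeD2l.
  - exact: measurable_pos.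
  - by apply/measurable_EFinP; exact: measurable_funTS.
  - by move=> t _; rewrite lee_fin addr_ge0 // mulr_ge0 ?(ltW K10) ?(ltW K20)// mulr_ge0 ?powR_ge0 ?expR_ge0.
  - by apply/measurable_EFinP; apply: measurable_funTS; exact: measurable_funD.
have fk := kint_fin_num x a0 ad.
have h1 := addint P G mP mG P_ge0 PG (fun t _ => G_ge0 t).
have h2 := addint G P mG mP (fun t _ => G_ge0 t) GP P_ge0.
rewrite -/(kint a x) IG -[kint a x]fineK// -EFinD lee_fin in h1.
rewrite -/(kint a x) IG -[kint a x]fineK// -EFinD lee_fin in h2.
apply: (@le_trans _ _ e).
  by rewrite ler_distl lerBlDr h1 h2.
rewrite /e [leRHS]mulrDl; apply: lerD; last by rewrite mulrA.
have hr : expR (- (r / 2)) <= D * r `^ (- (2 * b + 2)).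
  rewrite expRN [r `^ _]powRN ler_pdivlMr ?powR_gt0// mulrC ler_pdivrMr ?expR_gt0//.
  by rewrite (mulrC r); apply: hD; exact: ltW.
rewrite /K1 [leLHS](_ : _ = (expR d%:R * expR 1 * Gamma_pos a) * expR (- (r / 2))); last by ring.
rewrite [leRHS](_ : _ = (expR d%:R * expR 1 * Gamma_pos a) * (D * r `^ (- (2 * b + 2)))); last by ring.
by rewrite ler_wpM2l// !mulr_ge0 ?expR_ge0// ltW// Gamma_pos_gt0.
Qed.

End RieszKernel.

(** * Ground states: Hardy inequality, criticality, null-criticality *)

Section EsumPairs.
Variables (R : realType) (T : choiceType).
Implicit Types (F : T -> T -> \bar R).

Lemma esum_pair F : (forall x y, (0 <= F x y)%E) ->
  (\esum_(p in [set: T * T]) F p.1 p.2 = \esum_(x in setT) \esum_(y in setT) F x y)%E.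
Proof.
move=> F0; rewrite esum_esum//; congr esum.
by apply/seteqP; split.
Qed.

Lemma esum_exchange F : (forall x y, (0 <= F x y)%E) ->
  (\esum_(x in setT) \esum_(y in setT) F x y = \esum_(y in setT) \esum_(x in setT) F x y)%E.
Proof.
move=> F0; rewrite -!esum_pair//.
rewrite (@reindex_esum R (T * T)%type (T * T)%type setT setT (fun p => (p.2, p.1)))//.
split => //; first by move=> [a b] [c e] _ _ [-> ->].
by move=> [a b] _; exists (b, a).
Qed.

Lemma esum_seq (s : seq T) (g : T -> R) : uniq s -> (forall x, 0 <= g x) ->
  (forall x, x \notin s -> g x = 0) ->
  (\esum_(x in setT) (g x)%:E = (\sum_(x <- s) g x)%:E)%E.
Proof.
move=> us g0 gs; rewrite (esumID [set` s])//; last by move=> x _; rewrite lee_fin.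
rewrite !setTI [X in (_ + X)%E]esum1 ?adde0; last first.
  by move=> x /= /negP xs; rewrite gs.
rewrite esum_fset; [|exact: finite_seq|by move=> x _; rewrite lee_fin].
by rewrite -fsbig_seq// sumEFin.
Qed.

Lemma esum_ge_seq (s : seq T) (g : T -> R) : uniq s -> (forall x, 0 <= g x) ->
  ((\sum_(x <- s) g x)%:E <= \esum_(x in setT) (g x)%:E)%E.
Proof.
move=> us g0; apply: esum_ge; exists [set` s]; first by split => //; exact: finite_seq.
by rewrite -fsbig_seq// sumEFin.
Qed.

Lemma esum_approx (g : T -> R) (U e : R) : (forall x, 0 <= g x) -> 0 < e ->
  (\esum_(x in setT) (g x)%:E = U%:E)%E ->
  exists s : seq T, uniq s /\ U - e <= \sum_(x <- s) g x.
Proof.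
move=> g0 e0 gU.
have : ((U - e)%:E < \esum_(x in setT) (g x)%:E)%E by rewrite gU lte_fin ltrBlDr ltrDl.
move=> /ereal_sup_gt[_ [X [fX _] <-]] /ltW h.
exists (finmap.enum_fset (fset_set X)); split; first exact: finmap.fset_uniq.
by move: h; rewrite fsbig_finite// sumEFin lee_fin.
Qed.

End EsumPairs.

Section Connected.
Variable d : nat.

(** Connectedness of the lattice as an induction principle: it propagates convergence at a point,
    and the constancy of [v / u], along edges. *)
Lemma lattice_ind (P : Zd d -> Prop) : P 0 ->
  (forall x i, P x -> P (x + unitv i)) -> (forall x i, P x -> P (x - unitv i)) ->
  forall x, P x.
Proof.
move=> P0 Pp Pm.
have nat_step i (n : nat) x : P x -> P (x + unitv i *+ n) /\ P (x - unitv i *+ n).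
  move=> Px; elim: n => [|n [IH1 IH2]]; first by rewrite mulr0n subr0 addr0.
  rewrite mulrSr opprD !addrA; split; [exact: Pp|exact: Pm].
have int_step i (n : int) x : P x -> P (x + n *: unitv i).
  move=> Px; case: n => n.
    by rewrite -[Posz n]natz scaler_nat; case: (nat_step i n x Px).
  by rewrite NegzE -[Posz n.+1]natz scaleNr scaler_nat; case: (nat_step i n.+1 x Px).
move=> x; rewrite [x]row_sum_delta -[X in P X]add0r.
suff H s y : P y -> P (y + \sum_(i <- s) x 0 i *: unitv i) by exact: H.
elim: s y => [|i s IH] y Py; first by rewrite big_nil addr0.
by rewrite big_cons addrA; apply: IH; exact: int_step.
Qed.

End Connected.

(** * Ground state representation for a symmetric summable kernel *)

Section AbstractForm.
Variables (R : realType) (d : nat) (k : Zd d -> R).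

(** For [k = kappa s] this is [Qs s]. Working with an abstract kernel treats [sigma = 1] and
    [sigma < 1] together. *)
Definition kform (g : Zd d -> R) : \bar R :=
  ((2^-1)%:E * \esum_(p in [set: Zd d * Zd d])
       (k (p.1 - p.2) * (g p.1 - g p.2) ^+ 2)%:E)%E.

(** The terms of the form [h] of the overview: the Doob transform by [u], with conductances
    [k (x - y) u x u y]. *)
Definition sqform (u g : Zd d -> R) (p : Zd d * Zd d) : R :=
  k (p.1 - p.2) * (u p.1 * u p.2 * (g p.1 / u p.1 - g p.2 / u p.2) ^+ 2).

Variables (u f : Zd d -> R) (m : R).
Hypothesis k0 : forall z, 0 <= k z.
Hypothesis ksym : forall z, k (- z) = k z.
Hypothesis km : (\esum_(z in setT) (k z)%:E = m%:E)%E.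
Hypothesis u0 : forall x, 0 < u x.
Hypothesis f0 : forall x, 0 <= f x.
(** In the extended reals the equation includes the convergence of the convolution sum. *)
Hypothesis eqn : forall x,
  ((m * u x)%:E = (f x)%:E + \esum_(y in setT) (k (x - y) * u y)%:E)%E.

Local Notation w := (fun x => f x / u x).

Lemma esum_kl (g : Zd d -> R) : (forall x, 0 <= g x) ->
  (\esum_(p in [set: Zd d * Zd d]) (k (p.1 - p.2) * g p.1)%:E =
   m%:E * \esum_(x in setT) (g x)%:E)%E.
Proof.
move=> g0; rewrite (@esum_pair _ _ (fun x y => (k (x - y) * g x)%:E)); last first.
  by move=> x y; rewrite lee_fin mulr_ge0.
have m0 : 0 <= m by rewrite -lee_fin -km; apply: esum_ge0 => z _; rewrite lee_fin.
rewrite -esumZl//.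
apply: eq_esum => x _; under eq_esum do rewrite EFinM muleC.
rewrite esumZl//; last by move=> y; rewrite lee_fin.
by rewrite (esum_reflect (fun z => (k z)%:E)) km muleC.
Qed.

Lemma esum_swap (F : Zd d -> Zd d -> \bar R) : (forall x y, (0 <= F x y)%E) ->
  (\esum_(p in [set: Zd d * Zd d]) F p.1 p.2 = \esum_(p in [set: Zd d * Zd d]) F p.2 p.1)%E.
Proof.
by move=> F0; rewrite esum_pair// (@esum_pair _ _ (fun x y => F y x))// esum_exchange.
Qed.

Lemma ksymB x y : k (x - y) = k (y - x).
Proof. by rewrite -ksym opprB. Qed.

Lemma esum_kr (g : Zd d -> R) : (forall x, 0 <= g x) ->
  (\esum_(p in [set: Zd d * Zd d]) (k (p.1 - p.2) * g p.2)%:E =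
   m%:E * \esum_(x in setT) (g x)%:E)%E.
Proof.
move=> g0; rewrite -esum_kl// (@esum_swap (fun x y => (k (x - y) * g y)%:E)).
  by apply: eq_esum => p _; rewrite ksymB.
by move=> x y; rewrite lee_fin mulr_ge0.
Qed.

Definition pot x : R := m * u x - f x.

Lemma potE x : (\esum_(y in setT) (k (x - y) * u y)%:E = (pot x)%:E)%E.
Proof.
rewrite /pot EFinB eqn addeC; case: (esum _ _) (eqn x) => [s||].
- by rewrite -EFinN -!EFinD addKr.
- by [].
- by [].
Qed.

Lemma pot_ge0 x : 0 <= pot x.
Proof.
by rewrite -lee_fin -potE; apply: esum_ge0 => y _; rewrite lee_fin mulr_ge0// ltW.
Qed.

Lemma esum_ku (g : Zd d -> R) : (forall x, 0 <= g x) ->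
  (\esum_(p in [set: Zd d * Zd d]) (k (p.1 - p.2) * (g p.1 * u p.2))%:E =
   \esum_(x in setT) (g x * pot x)%:E)%E.
Proof.
move=> g0; rewrite (@esum_pair _ _ (fun x y => (k (x - y) * (g x * u y))%:E)); last first.
  by move=> x y; rewrite lee_fin mulr_ge0// mulr_ge0// ltW.
apply: eq_esum => x _; rewrite EFinM -potE -esumZl//.
  by apply: eq_esum => y _; rewrite -EFinM; congr EFin; ring.
by move=> y; rewrite lee_fin mulr_ge0// ltW.
Qed.

Lemma fset_support (g : Zd d -> R) : fin_supp g ->
  exists s, uniq s /\ forall x, x \notin s -> g x = 0.
Proof.
move=> gf; exists (finmap.enum_fset (fset_set [set x | g x != 0])); split; first exact: finmap.fset_uniq.
move=> x; rewrite in_fset_set// => /negP xs; apply/eqP/negPn/negP => gx.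
by apply: xs; rewrite inE.
Qed.

(* Ground state representation: with [h = g^2 / u],
   [(g x - g y)^2 + u x h y + u y h x
      = u x u y (g x / u x - g y / u y)^2 + u x h x + u y h y],
   and [eqn] turns the sum of [k (x - y) u y] into [m u x - f x]. *)
Lemma hardy_identity g : fin_supp g ->
  (kform g = (2^-1)%:E * (\esum_(p in [set: Zd d * Zd d]) (sqform u g p)%:E)
             + wsum w g)%E.
Proof.
move=> /fset_support[s [us gs]].
pose h x := g x ^+ 2 / u x.
have h0 x : 0 <= h x by rewrite divr_ge0 ?sqr_ge0 ?ltW.
pose E (F : (Zd d * Zd d)%type -> R) := (\esum_(p in [set: Zd d * Zd d]) (F p)%:E)%E.
have ED (F G : (Zd d * Zd d)%type -> R) : (forall p, 0 <= F p) -> (forall p, 0 <= G p) ->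
    E (fun p => F p + G p) = (E F + E G)%E.
  by move=> F0 G0; rewrite /E -esumD//; move=> p _; rewrite lee_fin.
pose Q (p : Zd d * Zd d) := k (p.1 - p.2) * (g p.1 - g p.2) ^+ 2.
pose a (p : Zd d * Zd d) := k (p.1 - p.2) * (h p.1 * u p.2).
pose a' (p : Zd d * Zd d) := k (p.1 - p.2) * (h p.2 * u p.1).
pose b (p : Zd d * Zd d) := k (p.1 - p.2) * (h p.1 * u p.1).
pose b' (p : Zd d * Zd d) := k (p.1 - p.2) * (h p.2 * u p.2).
have u0' x := ltW (u0 x).
have Q0 p : 0 <= Q p by rewrite /Q mulr_ge0 ?sqr_ge0.
have s0 p : 0 <= sqform u g p by rewrite /sqform mulr_ge0// mulr_ge0 ?sqr_ge0// mulr_ge0.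
have a0 p : 0 <= a p by rewrite /a mulr_ge0// mulr_ge0.
have a'0 p : 0 <= a' p by rewrite /a' mulr_ge0// mulr_ge0.
have b0 p : 0 <= b p by rewrite /b mulr_ge0// mulr_ge0.
have b'0 p : 0 <= b' p by rewrite /b' mulr_ge0// mulr_ge0.
have main : E (fun p => Q p + (a p + a' p)) = E (fun p => sqform u g p + (b p + b' p)).
  apply: eq_esum => p _; congr EFin; rewrite /Q /sqform /a /a' /b /b' /h.
  have p1 := lt0r_neq0 (u0 p.1); have p2 := lt0r_neq0 (u0 p.2).
  by field; rewrite p1 p2.
rewrite ED ?ED// in main; last 2 first.
- by move=> p; rewrite addr_ge0.
- by move=> p; rewrite addr_ge0.
have hs (v : Zd d -> R) x : x \notin s -> h x * v x = 0.
  by move=> xs; rewrite /h gs// expr0n /= !mul0r.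
have Ea : (E a = (\sum_(x <- s) h x * pot x)%:E)%E.
  rewrite /E esum_ku// (@esum_seq _ _ s)//.
  - by move=> x; rewrite mulr_ge0 ?pot_ge0.
  - by move=> x; exact: hs.
have Ea' : (E a' = E a)%E.
  rewrite /E (@esum_swap (fun x y => (k (x - y) * (h y * u x))%:E)).
    by apply: eq_esum => p _; rewrite ksymB.
  by move=> x y; rewrite lee_fin mulr_ge0// mulr_ge0.
have Eb : (E b = (m * \sum_(x <- s) h x * u x)%:E)%E.
  rewrite /E (@esum_kl (fun x => h x * u x)); last by move=> x; rewrite mulr_ge0.
  rewrite (@esum_seq _ _ s)//.
  - by move=> x; rewrite mulr_ge0.
  - by move=> x; exact: hs.
have Eb' : (E b' = E b)%E.
  rewrite /E (@esum_kr (fun x => h x * u x)); last by move=> x; rewrite mulr_ge0.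
  by rewrite (@esum_kl (fun x => h x * u x))// => x; rewrite mulr_ge0.
have W : (wsum w g = (\sum_(x <- s) h x * f x)%:E)%E.
  rewrite /wsum -(@esum_seq _ _ s)//.
  - by apply: eq_esum => x _; congr EFin; rewrite /h; ring.
  - by move=> x; rewrite mulr_ge0.
  - by move=> x; exact: hs.
rewrite Ea' Ea Eb' Eb -!EFinD in main.
have bE : m * (\sum_(x <- s) h x * u x) =
    \sum_(x <- s) h x * pot x + \sum_(x <- s) h x * f x.
  rewrite mulr_sumr -big_split/=; apply: eq_bigr => x _; rewrite /pot; ring.
rewrite W /kform -/Q -/(E Q) -/(E (sqform u g)).
have : (0 <= E Q)%E by apply: esum_ge0 => p _; rewrite lee_fin.
have : (0 <= E (sqform u g))%E by apply: esum_ge0 => p _; rewrite lee_fin.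
move: main; rewrite bE; case: (E Q) => [q||]; case: (E _) => [r||] //=.
  rewrite -!EFinD => -[] e _ _; congr EFin; lra.
by move=> _ _ _; rewrite gt0_muley ?lte_fin ?invr_gt0.
Qed.

Lemma hardy_ineq g : fin_supp g -> (wsum w g <= kform g)%E.
Proof.
move=> gf; rewrite hardy_identity// -[leLHS]add0e leeD2r// mule_ge0 ?lee_fin ?invr_ge0//.
apply: esum_ge0 => p _; rewrite lee_fin /sqform mulr_ge0// mulr_ge0 ?sqr_ge0// mulr_ge0// ltW //.
Qed.

(** For [g >= 0] the cross terms have a sign, so the square can be expanded inside the extended
    sums. *)
Lemma kform_seq g s : uniq s -> (forall x, 0 <= g x) -> (forall x, x \notin s -> g x = 0) ->
  (kform g = (m * \sum_(x <- s) g x ^+ 2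
     - \sum_(x <- s) \sum_(y <- s) k (x - y) * (g x * g y))%:E)%E.
Proof.
move=> us g0 gs.
pose E (F : (Zd d * Zd d)%type -> R) := (\esum_(p in [set: Zd d * Zd d]) (F p)%:E)%E.
have ED (F G : (Zd d * Zd d)%type -> R) : (forall p, 0 <= F p) -> (forall p, 0 <= G p) ->
    E (fun p => F p + G p) = (E F + E G)%E.
  by move=> F0 G0; rewrite /E -esumD//; move=> p _; rewrite lee_fin.
pose Q (p : Zd d * Zd d) := k (p.1 - p.2) * (g p.1 - g p.2) ^+ 2.
pose a (p : Zd d * Zd d) := k (p.1 - p.2) * (g p.1 * g p.2).
pose b (p : Zd d * Zd d) := k (p.1 - p.2) * (g p.1 ^+ 2).
pose b' (p : Zd d * Zd d) := k (p.1 - p.2) * (g p.2 ^+ 2).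
have Q0 p : 0 <= Q p by rewrite /Q mulr_ge0 ?sqr_ge0.
have a0 p : 0 <= a p by rewrite /a mulr_ge0// mulr_ge0.
have b0 p : 0 <= b p by rewrite /b mulr_ge0// sqr_ge0.
have b'0 p : 0 <= b' p by rewrite /b' mulr_ge0// sqr_ge0.
have main : E (fun p => Q p + (a p + a p)) = E (fun p => b p + b' p).
  by apply: eq_esum => p _; congr EFin; rewrite /Q /a /b /b'; ring.
rewrite ED ?ED// in main; last by move=> p; rewrite addr_ge0.
have gs2 x : x \notin s -> g x ^+ 2 = 0 by move=> xs; rewrite gs// expr0n.
have Eb : (E b = (m * \sum_(x <- s) g x ^+ 2)%:E)%E.
  by rewrite /E (@esum_kl (fun x => g x ^+ 2))// ?(@esum_seq _ _ s)// => x; exact: sqr_ge0.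
have Eb' : (E b' = (m * \sum_(x <- s) g x ^+ 2)%:E)%E.
  by rewrite /E (@esum_kr (fun x => g x ^+ 2))// ?(@esum_seq _ _ s)// => x; exact: sqr_ge0.
have Ea : (E a = (\sum_(x <- s) \sum_(y <- s) k (x - y) * (g x * g y))%:E)%E.
  rewrite /E (@esum_pair _ _ (fun x y => (k (x - y) * (g x * g y))%:E)); last first.
    by move=> x y; rewrite lee_fin mulr_ge0// mulr_ge0.
  transitivity (\esum_(x in [set: Zd d]) (\sum_(y <- s) k (x - y) * (g x * g y))%:E)%E.
    apply: eq_esum => x _; apply: esum_seq => //.
    - by move=> y; rewrite mulr_ge0// mulr_ge0.
    - by move=> y ys; rewrite (gs y)// !mulr0.
  apply: esum_seq => //.
  - by move=> x; apply: sumr_ge0 => y _; rewrite mulr_ge0// mulr_ge0.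
  - by move=> x xs; rewrite big1// => y _; rewrite (gs x)// mul0r mulr0.
rewrite Ea Eb Eb' -!EFinD in main.
rewrite /kform -/Q -/(E Q).
have : (0 <= E Q)%E by apply: esum_ge0 => p _; rewrite lee_fin.
move: main; case: (E Q) => [q||] //=.
by rewrite -!EFinD => -[] e _; congr EFin; lra.
Qed.

(* Polarisation of [kform - wsum w] on functions supported in [s]. *)
Definition bform (s : seq (Zd d)) (g h : Zd d -> R) : R :=
  \sum_(x <- s) g x * ((m - w x) * h x - \sum_(y <- s) k (x - y) * h y).

Lemma wuE x : w x * u x = f x.
Proof. by rewrite divfK// lt0r_neq0. Qed.

Lemma w_ge0 x : 0 <= w x.
Proof. by rewrite divr_ge0// ltW. Qed.

Lemma potE' x : pot x = (m - w x) * u x.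
Proof. by rewrite mulrBl wuE. Qed.

Lemma wsum_seq g (w' : Zd d -> R) s : uniq s -> (forall x, 0 <= w' x) ->
  (forall x, x \notin s -> g x = 0) ->
  (wsum w' g = (\sum_(x <- s) w' x * g x ^+ 2)%:E)%E.
Proof.
move=> us w0 gs; apply: esum_seq => // x; first by rewrite mulr_ge0// sqr_ge0.
by move=> xs; rewrite gs// expr0n mulr0.
Qed.

Lemma kform_bform g s : uniq s -> (forall x, 0 <= g x) -> (forall x, x \notin s -> g x = 0) ->
  (kform g = (bform s g g + \sum_(x <- s) w x * g x ^+ 2)%:E)%E.
Proof.
move=> us g0 gs; rewrite (kform_seq us)//; congr EFin.
rewrite /bform mulr_sumr -sumrB -big_split /=; apply: eq_bigr => x _.
have -> : \sum_(y <- s) k (x - y) * (g x * g y) = g x * \sum_(y <- s) k (x - y) * g y.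
  by rewrite mulr_sumr; apply: eq_bigr => y _; ring.
by ring.
Qed.

(** Both sides equal [kform g] minus [wsum w g], which does not refer to the list. Functions with
    different supports can thus be compared on a common larger list. *)
Lemma bform_indep g s s' : uniq s -> uniq s' -> (forall x, 0 <= g x) ->
  (forall x, x \notin s -> g x = 0) -> (forall x, x \notin s' -> g x = 0) ->
  bform s g g = bform s' g g.
Proof.
move=> us us' g0 gs gs'.
have := kform_bform us g0 gs; rewrite (kform_bform us' g0 gs') => -[].
have := wsum_seq us w_ge0 gs; rewrite (wsum_seq us' w_ge0 gs') => -[] ->.
by move=> /addIr.
Qed.

Lemma bform_sym s g h : bform s g h = bform s h g.
Proof.
have E g' h' : bform s g' h' = \sum_(x <- s) (m - w x) * (g' x * h' x) -
    \sum_(x <- s) \sum_(y <- s) k (x - y) * (g' x * h' y).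
  rewrite /bform -sumrB; apply: eq_bigr => x _; rewrite mulrBr mulr_sumr; congr (_ - _).
    by ring.
  by apply: eq_bigr => y _; ring.
rewrite !E; congr (_ - _); first by apply: eq_bigr => x _; ring.
rewrite exchange_big; apply: eq_bigr => x _; apply: eq_bigr => y _.
by rewrite ksymB; ring.
Qed.

Lemma bform_lin s g h l a b : bform s g (fun x => a * h x + b * l x) =
  a * bform s g h + b * bform s g l.
Proof.
rewrite /bform !mulr_sumr -big_split /=; apply: eq_bigr => x _.
have -> : \sum_(y <- s) k (x - y) * (a * h y + b * l y) =
    a * (\sum_(y <- s) k (x - y) * h y) + b * (\sum_(y <- s) k (x - y) * l y).
  by rewrite !mulr_sumr -big_split /=; apply: eq_bigr => y _; ring.
by ring.
Qed.

Lemma bform_comb s g h a b : bform s (fun x => a * g x + b * h x) (fun x => a * g x + b * h x) =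
  a ^+ 2 * bform s g g + b ^+ 2 * bform s h h + 2 * (a * b) * bform s g h.
Proof.
set P := fun x => a * g x + b * h x.
have E l : bform s P l = a * bform s g l + b * bform s h l.
  by rewrite bform_sym bform_lin !(bform_sym s l).
by rewrite bform_lin !E (bform_sym s h g); ring.
Qed.

(** * Truncations of the ground state and criticality *)

Definition cut (e : R) x : R := Num.max 0 (u x - e).

Lemma cut_ge0 e x : 0 <= cut e x.
Proof. by rewrite /cut le_max lexx. Qed.

Lemma cut_geB e x : u x - e <= cut e x.
Proof. by rewrite /cut le_max lexx orbT. Qed.

Lemma cut_le e x : 0 <= e -> cut e x <= u x.
Proof. by move=> e0; rewrite /cut ge_max ltW// lerBlDr lerDl. Qed.

Lemma m_ge0 : 0 <= m.
Proof. by rewrite -lee_fin -km; apply: esum_ge0 => z _; rewrite lee_fin. Qed.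

Lemma seq_ku_le s h x : uniq s -> (forall y, 0 <= h y) -> (forall y, h y <= u y) ->
  \sum_(y <- s) k (x - y) * h y <= pot x.
Proof.
move=> us h0 hu; rewrite -lee_fin -potE.
apply: (@le_trans _ _ (\esum_(y in setT) (k (x - y) * h y)%:E)%E).
  by apply: esum_ge_seq => // y; rewrite mulr_ge0.
by apply: le_esum => y _; rewrite lee_fin ler_wpM2l.
Qed.

(** Pointwise [u <= cut e + e], and [k] has total mass [m]. *)
Lemma cut_ku_ge e s x : 0 <= e -> uniq s -> (forall y, y \notin s -> cut e y = 0) ->
  pot x - e * m <= \sum_(y <- s) k (x - y) * cut e y.
Proof.
move=> e0 us cs; rewrite lerBlDr -lee_fin -potE EFinD EFinM -km.
rewrite -(esum_reflect _ x) -esumZl//; last by move=> y; rewrite lee_fin.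
rewrite -(@esum_seq _ _ s (fun y => k (x - y) * cut e y))//; last 2 first.
- by move=> y; rewrite mulr_ge0// cut_ge0.
- by move=> y ys; rewrite cs// mulr0.
rewrite -esumD; last 2 first.
- by move=> y _; rewrite lee_fin mulr_ge0// cut_ge0.
- by move=> y _; rewrite -EFinM lee_fin mulr_ge0.
apply: le_esum => y _; rewrite -EFinM -EFinD lee_fin mulrC (mulrC e) -mulrDr mulrC.
by rewrite ler_wpM2l// -lerBlDr cut_geB.
Qed.

Variable C : R.
Hypothesis level_finite : forall e, 0 < e -> finite_set [set x | e < u x].
Hypothesis level_bound : forall e s, 0 < e -> e <= 1 -> uniq s ->
  (forall x, x \in s -> e < u x) -> e * \sum_(x <- s) f x <= C.

(* Where [u > e], [eqn] gives [(m - w) (u - e) - k * (u - e)_+ <= e w]. *)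
Lemma cut_bform e s : 0 < e -> e <= 1 -> uniq s -> (forall x, x \notin s -> cut e x = 0) ->
  bform s (cut e) (cut e) <= C.
Proof.
move=> e0 e1 us cs.
pose L := finmap.enum_fset (fset_set [set x | e < u x]).
have uL : uniq L by exact: finmap.fset_uniq.
have inL x : (x \in L) = (e < u x).
  by rewrite /L in_fset_set ?mem_setE//; exact: level_finite.
have cL x : x \notin L -> cut e x = 0.
  by rewrite inL -leNgt => h; apply/max_idPl; rewrite subr_le0.
rewrite (bform_indep us uL)//; last by move=> x; exact: cut_ge0.
apply: le_trans (level_bound e0 e1 uL _); last by move=> x; rewrite inL.
rewrite /bform mulr_sumr big_seq [leRHS]big_seq; apply: ler_sum => x; rewrite inL => xL.
have c : cut e x = u x - e by apply/max_idPr; rewrite subr_ge0 ltW.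
have h := cut_ku_ge x (ltW e0) uL cL.
have h2 : (m - w x) * cut e x - \sum_(y <- L) k (x - y) * cut e y <= e * w x.
  rewrite c mulrBr -potE'; lra.
apply: (@le_trans _ _ (cut e x * (e * w x))).
  by rewrite ler_wpM2l// cut_ge0.
rewrite mulrCA ler_wpM2l ?(ltW e0)// -[leRHS]wuE mulrC ler_wpM2l ?w_ge0//.
by rewrite cut_le// ltW.
Qed.

Lemma common_threshold (P : Zd d -> R -> Prop) (s : seq (Zd d)) :
  (forall x, exists2 e0, 0 < e0 & forall e, 0 < e -> e <= e0 -> P x e) ->
  exists2 e0, 0 < e0 & forall e, 0 < e -> e <= e0 -> forall x, x \in s -> P x e.
Proof.
move=> h; elim: s => [|a s [e1 p1 h1]]; first by exists 1.
have [e2 p2 h2] := h a.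
exists (Num.min e1 e2); first by rewrite lt_min p1.
move=> e e0; rewrite le_min => /andP[l1 l2] x; rewrite inE => /orP[/eqP ->|xs].
  exact: h2.
exact: h1.
Qed.

(** Replacing [(m - w) (cut e)] by [(m - w) u = pot] only increases the form, and by [cut_ku_ge]
    what remains is at most [e m] at each point of the fixed support of [g]. The threshold must not
    depend on [s], since [s] contains the support of [cut e] and grows as [e] decreases. *)
Lemma cross_small s0 g eta : uniq s0 -> (forall x, 0 <= g x) -> (forall x, g x <= u x) ->
  (forall x, x \notin s0 -> g x = 0) -> 0 < eta ->
  exists2 e0, 0 < e0 & forall e s, 0 < e -> e <= e0 -> uniq s ->
    (forall x, x \notin s -> cut e x = 0) -> (forall x, x \notin s -> g x = 0) ->
    bform s g (cut e) <= eta.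
Proof.
move=> us0 g0 gu gs0 eta0.
pose S := 1 + \sum_(x <- s0) g x.
have S0 : 0 < S by rewrite ltr_pwDl// sumr_ge0.
pose h := eta / S.
have h0 : 0 < h by rewrite divr_gt0.
have [e0 e00 he0] : exists2 e0, 0 < e0 & forall e, 0 < e -> e <= e0 ->
    forall x, x \in s0 -> e * m <= h.
  apply: (@common_threshold (fun _ e => e * m <= h)) => x.
  exists (h / (m + 1)); first by rewrite divr_gt0// ltr_wpDl ?m_ge0.
  move=> e e0; have m1 : 0 < m + 1 by rewrite ltr_wpDl ?m_ge0.
  rewrite ler_pdivlMr// => hh; apply: le_trans hh; rewrite ler_wpM2l ?ltW//; lra.
exists e0 => // e s ep ee us cs gs.
pose G x := g x * (pot x - \sum_(y <- s) k (x - y) * cut e y).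
have G0 x : 0 <= G x.
  rewrite /G mulr_ge0// subr_ge0 seq_ku_le// => y; first exact: cut_ge0.
  by rewrite cut_le// ltW.
apply: (@le_trans _ _ (\sum_(x <- s) G x)).
  rewrite /bform; apply: ler_sum => x _; rewrite /G ler_wpM2l// lerD2r potE'.
  have : 0 <= (m - w x) * u x by rewrite -potE' pot_ge0.
  rewrite pmulr_lge0 ?u0// => mw; rewrite ler_wpM2l//.
  by rewrite cut_le// ltW.
have -> : \sum_(x <- s) G x = \sum_(x <- s0) G x.
  have E s' : uniq s' -> (forall x, x \notin s' -> g x = 0) ->
      (\esum_(x in setT) (G x)%:E = (\sum_(x <- s') G x)%:E)%E.
    by move=> us' gs'; apply: esum_seq => // x xs; rewrite /G gs'// mul0r.
  by have := E s us gs; rewrite (E s0 us0 gs0) => -[].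
apply: (@le_trans _ _ (\sum_(x <- s0) g x * h)).
  rewrite big_seq [leRHS]big_seq; apply: ler_sum => x xs.
  rewrite /G ler_wpM2l//.
  have := cut_ku_ge x (ltW ep) us cs; have := he0 e ep ee x xs; lra.
rewrite -mulr_suml /h mulrA ler_pdivrMr// mulrC ler_wpM2l ?(ltW eta0)// /S; lra.
Qed.

(* Since [cut e] increases to [u] as [e -> 0] and [(m - w) u = k * u], the form pairs
   any fixed [g] with [cut e] to something small. The energies of the cuts being bounded,
   successive averages g_(n+1) = (n+1)/(n+2) g_n + 1/(n+2) (cut e) have energy O(1/n). *)
Lemma small_energy x0 : forall n : nat, exists s g,
  [/\ uniq s, (forall x, 0 <= g x <= u x), (forall x, x \notin s -> g x = 0),
      u x0 / 2 <= g x0 & bform s g g <= (C + 1) / n.+1%:R].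
Proof.
(* A cut at a level up to [u x0 / 2] keeps at least [u x0 / 2] at [x0]; the bound 1 is the range of
   [level_bound]. *)
pose e1 := Num.min 1 (u x0 / 2).
have e10 : 0 < e1 by rewrite lt_min ltr01 divr_gt0.
have C0 : 0 <= C.
  by have := @level_bound 1 [::] ltr01 (lexx _) isT; rewrite big_nil mulr0; apply.
have cutL e : 0 < e -> exists s, uniq s /\ forall x, x \notin s -> cut e x = 0.
  move=> e0; apply: fset_support; rewrite /fin_supp.
  apply: sub_finite_set (level_finite e0) => x /=; rewrite /cut.
  move=> h; rewrite ltNge; apply/negP => ue; move: h.
  by rewrite (max_idPl _) ?subr_le0// eqxx.
have cutx e : 0 < e -> e <= e1 -> u x0 / 2 <= cut e x0.
  move=> _; rewrite le_min => /andP[_ h]; apply: le_trans (cut_geB _ _); lra.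
have e11 : e1 <= 1 by rewrite ge_min lexx.
elim=> [|n [s0 [g [us0 gu gs0 gx gb]]]].
  have [s [us cs]] := cutL e1 e10; exists s, (cut e1); split => //.
  - by move=> x; rewrite cut_ge0 cut_le// ltW.
  - exact: cutx.
  - by rewrite divr1; apply: le_trans (cut_bform e10 e11 us cs) _; rewrite lerDl.
have g0 x : 0 <= g x by case/andP: (gu x).
have gu' x : g x <= u x by case/andP: (gu x).
have N0 : 0 < n.+1%:R :> R by rewrite ltr0n.
(* With [N = n + 1] and [t = 1 / (N + 1)], the cross term has weight [2 N t^2] and so contributes at
   most [t^2]. The total is then [t^2 (N (C + 1) + C + 1) = t (C + 1)]. *)
pose eta : R := 1 / (2 * n.+1%:R).
have eta0 : 0 < eta by rewrite divr_gt0// mulr_gt0.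
have [e0 e00 he0] := cross_small us0 g0 gu' gs0 eta0.
pose e := Num.min e0 e1.
have ep : 0 < e by rewrite lt_min e00.
have ee0 : e <= e0 by rewrite ge_min lexx.
have ee1 : e <= e1 by rewrite ge_min lexx orbT.
have [s2 [us2 cs2]] := cutL e ep.
pose s := undup (s0 ++ s2).
have us : uniq s by exact: undup_uniq.
have ns x : x \notin s -> x \notin s0 /\ x \notin s2.
  by rewrite mem_undup mem_cat negb_or => /andP[].
have gs x : x \notin s -> g x = 0 by move=> /ns[/gs0].
have cs x : x \notin s -> cut e x = 0 by move=> /ns[_ /cs2].
have B1 := he0 e s ep ee0 us cs gs.
have B2 := cut_bform ep (le_trans ee1 e11) us cs.
have B3 : bform s g g <= (C + 1) / n.+1%:R by rewrite (bform_indep us us0).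
pose N : R := n.+1%:R.
have NE : n.+2%:R = N + 1 by rewrite /N -natr1.
have M0 : 0 < N + 1 by rewrite addr_gt0.
pose t := (N + 1)^-1.
have t0 : 0 < t by rewrite invr_gt0.
have t1 : 1 - t = N * t by rewrite /t; field; rewrite lt0r_neq0.
have t1' : 0 <= 1 - t by rewrite t1 mulr_ge0 ?ltW.
exists s, (fun x => (1 - t) * g x + t * cut e x); split => //.
- move=> x; rewrite addr_ge0 ?mulr_ge0 ?cut_ge0 ?(ltW t0)//=.
  have := ler_wpM2l t1' (gu' x); have := ler_wpM2l (ltW t0) (cut_le x (ltW ep)); lra.
- by move=> x xs; rewrite gs// cs// !mulr0 addr0.
- have := ler_wpM2l t1' gx; have := ler_wpM2l (ltW t0) (cutx e ep ee1); lra.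
rewrite bform_comb NE t1 exprMn.
have D1 : N ^+ 2 * t ^+ 2 * bform s g g <= t ^+ 2 * (N * (C + 1)).
  rewrite [leRHS](_ : _ = N ^+ 2 * t ^+ 2 * ((C + 1) / N)); last first.
    by field; rewrite lt0r_neq0.
  by rewrite ler_wpM2l// mulr_ge0 ?sqr_ge0.
have D2 : t ^+ 2 * bform s (cut e) (cut e) <= t ^+ 2 * C.
  by rewrite ler_wpM2l ?sqr_ge0.
have D3 : 2 * (N * t * t) * bform s g (cut e) <= t ^+ 2 * 1.
  rewrite [leRHS](_ : _ = 2 * (N * t * t) * eta); last first.
    by rewrite /eta -/N; field; rewrite lt0r_neq0.
  by rewrite ler_wpM2l// !mulr_ge0// ltW.
rewrite [leRHS](_ : _ = t ^+ 2 * (N * (C + 1)) + t ^+ 2 * C + t ^+ 2 * 1).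
  by rewrite lerD// lerD.
by rewrite /t; field; rewrite lt0r_neq0.
Qed.

Lemma critical (w' : Zd d -> R) : (forall x, 0 <= w' x) ->
  (forall g, fin_supp g -> (wsum w' g <= kform g)%E) ->
  (forall x, w x <= w' x) -> w' = w.
Proof.
move=> w'0 hw ww; apply/funext => x0; apply/eqP; rewrite eq_le ww andbT.
pose c := u x0 / 2.
have c0 : 0 < c by rewrite divr_gt0.
have C0 : 0 <= C.
  by have := @level_bound 1 [::] ltr01 (lexx _) isT; rewrite big_nil mulr0; apply.
rewrite -subr_le0 -(pmulr_rle0 _ (exprn_gt0 2 c0)).
apply/ler_addgt0Pr => e e0; rewrite add0r.
have [n hn] : exists n : nat, (C + 1) / e < n%:R.
  exists (Num.truncn ((C + 1) / e)).+1; exact: truncnS_gt.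
have [s [g [us gu gs gx gb]]] := small_energy x0 n.
have g0 x : 0 <= g x by case/andP: (gu x).
have gf : fin_supp g.
  apply: (@sub_finite_set _ _ [set` s]); last exact: finite_seq.
  by move=> x /= h; apply/negP => /negP /gs h'; move: h; rewrite h' eqxx.
have := hw g gf; rewrite (wsum_seq us)// (kform_bform us)// lee_fin.
rewrite -lerBlDr -sumrB => h.
have x0s : x0 \in s.
  by apply: contraT => /gs h'; move: gx; rewrite h' -/c leNgt c0.
have h1 : c ^+ 2 * (w' x0 - w x0) <= bform s g g.
  apply: le_trans h; rewrite (bigD1_seq x0)//= -[leLHS]addr0 lerD//.
    rewrite -mulrBl mulrC ler_wpM2l ?subr_ge0//.
    by rewrite ler_pXn2r// ?nnegrE ?(ltW c0)// (g0 x0).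
  by apply: sumr_ge0 => x _; rewrite -mulrBl mulr_ge0 ?sqr_ge0// subr_ge0.
apply: (le_trans h1); apply: (le_trans gb).
rewrite ler_pdivrMr ?ltr0n// mulrC -ler_pdivrMr//.
by apply: ltW; apply: (lt_le_trans hn); rewrite ler_nat.
Qed.

(** * Passage to the completion and absence of a minimiser *)

(** Young's inequality with a parameter. Letting [t] tend to 0 keeps the constant 1 in front of
    [kform g], which an exact comparison of energies in the limit requires. *)
Lemma kformD_le g h t : 0 < t ->
  (kform (fun x => (g x - h x)%R) <= (1 + t)%:E * kform g + (1 + t^-1)%:E * kform h)%E.
Proof.
move=> t0; have h0 : (0 <= 2^-1 :> R) by rewrite invr_ge0.
have a0 : 0 <= 1 + t by rewrite addr_ge0// ltW.
have b0 : 0 <= 1 + t^-1 by rewrite addr_ge0// ltW// invr_gt0.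
pose Q (g' : Zd d -> R) (p : (Zd d * Zd d)%type) := k (p.1 - p.2) * (g' p.1 - g' p.2) ^+ 2.
have Q0 g' p : (0 <= (Q g' p)%:E)%E by rewrite lee_fin mulr_ge0 ?sqr_ge0.
rewrite /kform -/(Q g) -/(Q h) (muleCA (1 + t)%:E) (muleCA (1 + t^-1)%:E).
rewrite -muleDr//; last first.
  by rewrite ge0_adde_def// inE mule_ge0// ?lee_fin//; apply: esum_ge0 => p _; exact: Q0.
apply: lee_wpmul2l; first by rewrite lee_fin.
rewrite -!esumZl; [|exact: b0|by move=> p; exact: Q0|exact: a0|by move=> p; exact: Q0].
rewrite -esumD; last 2 first.
- by move=> p _; rewrite mule_ge0 ?lee_fin//; exact: Q0.
- by move=> p _; rewrite mule_ge0 ?lee_fin//; exact: Q0.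
apply: le_esum => p _; rewrite -!EFinM -EFinD lee_fin /Q.
set X := g p.1 - g p.2; set Y := h p.1 - h p.2.
rewrite [X in k _ * X ^+ 2](_ : _ = X - Y); last by rewrite /X /Y; ring.
rewrite -subr_ge0.
rewrite [leRHS](_ : _ = k (p.1 - p.2) * (t^-1 * (t * X + Y) ^+ 2)); last first.
  by field; rewrite lt0r_neq0.
by rewrite mulr_ge0// mulr_ge0 ?sqr_ge0// invr_ge0 ltW.
Qed.

Lemma kform_fin g : fin_supp g -> (kform g < +oo)%E.
Proof.
move=> /fset_support[s [us gs]].
have gs2 x : x \notin s -> g x ^+ 2 = 0 by move=> /gs ->; rewrite expr0n.
have h := kform_seq us (fun x => normr_ge0 (g x)) _.
have Q0 (g' : Zd d -> R) (p : (Zd d * Zd d)%type) : 0 <= k (p.1 - p.2) * (g' p.1 - g' p.2) ^+ 2.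
  by rewrite mulr_ge0 ?sqr_ge0.
apply: (@le_lt_trans _ _ ((2^-1)%:E * (2%:E * (m * \sum_(x <- s) g x ^+ 2)%:E
   + 2%:E * (m * \sum_(x <- s) g x ^+ 2)%:E))%E); last by rewrite ltey.
rewrite /kform; apply: lee_wpmul2l; first by rewrite lee_fin invr_ge0.
rewrite EFinM -(@esum_seq _ _ s (fun x => g x ^+ 2))//; last by move=> x; exact: sqr_ge0.
rewrite -{1}(@esum_kl (fun x => g x ^+ 2)); last by move=> x; exact: sqr_ge0.
rewrite -(@esum_kr (fun x => g x ^+ 2)); last by move=> x; exact: sqr_ge0.
rewrite -!esumZl//; [|by move=> p; rewrite lee_fin mulr_ge0 ?sqr_ge0..].
rewrite -esumD; last 2 first.
- by move=> p _; rewrite mule_ge0 ?lee_fin// mulr_ge0 ?sqr_ge0.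
- by move=> p _; rewrite mule_ge0 ?lee_fin// mulr_ge0 ?sqr_ge0.
apply: le_esum => p _; rewrite -!EFinM -EFinD lee_fin -subr_ge0.
rewrite [leRHS](_ : _ = k (p.1 - p.2) * (g p.1 + g p.2) ^+ 2); last by ring.
by rewrite mulr_ge0 ?sqr_ge0.
Qed.

Hypothesis k_unit : forall i, 0 < k (unitv i).

Section Limit.
Variables (v : Zd d -> R) (un : nat -> Zd d -> R).
Let del n x := v x - un n x.
Hypothesis un_fin : forall n, fin_supp (un n).
Hypothesis un_cvg : (fun n => (kform (del n) + (`|v 0 - un n 0| ^+ 2)%R%:E)%E) @ \oo --> 0%E.

Lemma del_small eta : 0 < eta ->
  \forall n \near \oo, (kform (del n) <= eta%:E)%E /\ `|v 0 - un n 0| ^+ 2 <= eta.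
Proof.
move=> e0.
have ge0 n : (0 <= kform (del n))%E.
  rewrite mule_ge0 ?lee_fin ?invr_ge0//; apply: esum_ge0 => p _.
  by rewrite lee_fin mulr_ge0 ?sqr_ge0.
have : \forall n \near \oo, (kform (del n) + (`|v 0 - un n 0| ^+ 2)%R%:E < eta%:E)%E.
  have h0 : nbhs (0%E : \bar R) (fun y => (y < eta%:E)%E).
    by apply: open_ereal_lt'; rewrite lte_fin.
  exact: (un_cvg h0).
apply: filterS => n /ltW h; split.
- by apply: le_trans h; rewrite leeDl// lee_fin sqr_ge0.
- by rewrite -lee_fin; apply: le_trans h; rewrite leeDr.
Qed.

(** The norm controls the value at the origin, and the energy controls differences across each edge
    on which [k] is positive; connectedness does the rest. *)
Lemma del_pointwise x : (fun n => un n x) @ \oo --> v x.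
Proof.
suff H : forall eta, 0 < eta -> \forall n \near \oo, `|v x - un n x| <= eta.
  by apply/cvgrPdist_le => e e0; exact: H.
have sq_small a e : 0 < e -> a ^+ 2 <= e ^+ 2 -> `|a| <= e :> R.
  by move=> e0 h; rewrite -(@ler_pXn2r _ 2)// ?nnegrE ?(ltW e0)// real_normK ?num_real.
have step y z : 0 < k (y - z) ->
  (forall eta, 0 < eta -> \forall n \near \oo, `|v y - un n y| <= eta) ->
  forall eta, 0 < eta -> \forall n \near \oo, `|v z - un n z| <= eta.
  move=> kp hy eta e0.
  have e2 : 0 < eta / 2 by rewrite divr_gt0.
  have e3 : 0 < 2^-1 * (k (y - z) * (eta / 2) ^+ 2) by rewrite !mulr_gt0// exprn_gt0.
  near=> n.
  have h1 : `|v y - un n y| <= eta / 2 by near: n; exact: hy.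
  have [h2 _] : (kform (del n) <= (2^-1 * (k (y - z) * (eta / 2) ^+ 2))%:E)%E /\
      `|v 0 - un n 0| ^+ 2 <= 2^-1 * (k (y - z) * (eta / 2) ^+ 2) by near: n; exact: del_small.
  have h3 : `|del n y - del n z| <= eta / 2.
    apply: sq_small => //.
    rewrite -(ler_pM2l kp) -(ler_pM2l (_ : 0 < 2^-1)) ?invr_gt0// -lee_fin.
    apply: le_trans h2; rewrite /kform EFinM; apply: lee_wpmul2l; first by rewrite lee_fin invr_ge0.
    apply: (@esum_ge_term _ _ (fun p : (Zd d * Zd d)%type =>
       (k (p.1 - p.2) * (del n p.1 - del n p.2) ^+ 2)%:E) (y, z)) => p.
    by rewrite lee_fin mulr_ge0 ?sqr_ge0.
  rewrite (_ : v z - un n z = (v y - un n y) - (del n y - del n z)); last by rewrite /del; ring.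
  by apply: le_trans (ler_normB _ _) _; rewrite [eta]splitr lerD.
elim/lattice_ind: x => [|x i|x i].
- move=> eta e0; have e1 : 0 < eta ^+ 2 by rewrite exprn_gt0.
  apply: filterS (del_small e1) => n [_ h]; apply: sq_small => //.
  by rewrite -[leLHS]real_normK ?num_real.
- by apply: step; rewrite opprD addrA subrr sub0r ksym.
- by apply: step; rewrite opprB addrCA subrr addr0.
Unshelve. all: by end_near. Qed.

Lemma kform_v_fin : (kform v < +oo)%E.
Proof.
have [N _ h] := del_small ltr01; have [h1 _] := h N (leqnn N).
have E : v = (fun x => del N x - (- un N x)) by apply/funext => x; rewrite /del; ring.
rewrite [in X in (X < _)%E]E; apply: le_lt_trans (kformD_le _ _ ltr01) _.
rewrite lte_add_pinfty// lte_mul_pinfty ?lee_fin ?fin_num_fun//.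
- by apply: le_lt_trans h1 _; rewrite ltey.
- apply: kform_fin; apply: sub_finite_set (un_fin N) => x /=; by rewrite oppr_eq0.
Qed.

(* Only one term of [sqform] is kept: its vanishing for every [p] is all that is
   needed to make [v / u] constant. *)
Lemma limit_ineq s p : uniq s -> forall V, kform v = V%:E ->
  2^-1 * sqform u v p + \sum_(x <- s) w x * v x ^+ 2 <= V.
Proof.
move=> us V VE; apply/ler_addgt0Pr => e e0.
have V0 : 0 <= V.
  rewrite -lee_fin -VE mule_ge0 ?lee_fin ?invr_ge0//; apply: esum_ge0 => q _.
  by rewrite lee_fin mulr_ge0 ?sqr_ge0.
(* [t] and [eta] make [t V] and [(1 + t^-1) eta] at most [e / 2] each. *)
pose t := e / (2 * (V + 1)).
have t0 : 0 < t by rewrite divr_gt0// mulr_gt0// ltr_wpDl.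
pose eta := e / (2 * (1 + t^-1)).
have tp : 0 < 1 + t^-1 by rewrite addr_gt0// invr_gt0.
have eta0 : 0 < eta by rewrite divr_gt0// mulr_gt0.
pose F (g : Zd d -> R) := 2^-1 * sqform u g p + \sum_(x <- s) w x * g x ^+ 2.
have cF : (fun n => F (un n)) @ \oo --> F v.
  have cx x := del_pointwise (x := x).
  apply: cvgD.
    apply: cvgM; first exact: cvg_cst.
    apply: cvgM; first exact: cvg_cst.
    apply: cvgM; first exact: cvg_cst.
    have cB : (fun n => un n p.1 / u p.1 - un n p.2 / u p.2) @ \oo -->
        v p.1 / u p.1 - v p.2 / u p.2.
      by apply: cvgB; apply: cvgM => //; exact: cvg_cst.
    rewrite expr2; under eq_fun do rewrite expr2.
    exact: cvgM.
  apply: cvg_sumr => x; apply: cvgM; first exact: cvg_cst.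
  by rewrite expr2; under eq_fun do rewrite expr2; exact: cvgM.
rewrite -/(F v); apply: (cvgr_to_le cF).
apply: filterS (del_small eta0) => n [h _].
rewrite -lee_fin.
apply: (@le_trans _ _ (kform (un n))).
  rewrite (hardy_identity (un_fin n)) /F EFinD; apply: leeD.
    rewrite EFinM; apply: lee_wpmul2l; first by rewrite lee_fin invr_ge0.
    apply: (@esum_ge_term _ _ (fun q => (sqform u (un n) q)%:E)) => q.
    rewrite lee_fin /sqform mulr_ge0// mulr_ge0 ?sqr_ge0// mulr_ge0// ltW//.
  by apply: esum_ge_seq => // x; rewrite mulr_ge0 ?sqr_ge0 ?w_ge0.
have E : un n = (fun x => v x - del n x) by apply/funext => x; rewrite /del; ring.
rewrite [in X in (X <= _)%E]E; apply: (le_trans (kformD_le _ _ t0)).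
rewrite VE; apply: (@le_trans _ _ ((1 + t)%:E * V%:E + (1 + t^-1)%:E * eta%:E)%E).
  by rewrite leeD2l//; apply: lee_wpmul2l => //; rewrite lee_fin ltW.
rewrite -!EFinM -EFinD lee_fin.
have E1 : (1 + t^-1) * eta = e / 2 by rewrite /eta; move: (lt0r_neq0 tp); set z := 1 + t^-1 => z0; field.
have E2 : t * V <= e / 2.
  rewrite /t mulrAC ler_pdivrMr; last by rewrite mulr_gt0// ltr_wpDl.
  rewrite (_ : e / 2 * (2 * (V + 1)) = e * V + e); last by field.
  by rewrite lerDl ltW.
rewrite mulrDl mul1r E1; lra.
Qed.

Lemma null_critical : (\esum_(x in setT) (f x * u x)%:E = +oo)%E ->
  kform v = wsum w v -> v = (fun=> 0).
Proof.
move=> foo vE.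
have Vfin : kform v \is a fin_num.
  rewrite ge0_fin_numE ?kform_v_fin// mule_ge0 ?lee_fin ?invr_ge0//.
  by apply: esum_ge0 => q _; rewrite lee_fin mulr_ge0 ?sqr_ge0.
pose V := fine (kform v).
have VE : kform v = V%:E by rewrite fineK.
(* Finite sums of [w v^2] come arbitrarily close to [V], so [limit_ineq] leaves nothing for the
   extra term. *)
have sq0 p : sqform u v p = 0.
  have s0 : 0 <= sqform u v p.
    by rewrite /sqform mulr_ge0// mulr_ge0 ?sqr_ge0// mulr_ge0// ltW.
  apply/eqP; rewrite eq_le s0 andbT; apply/ler_addgt0Pr => e e0; rewrite add0r.
  have e2 : 0 < e / 2 by rewrite divr_gt0.
  have [s [us hs]] := @esum_approx _ _ (fun x => w x * v x ^+ 2) V (e / 2)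
    (fun x => mulr_ge0 (w_ge0 x) (sqr_ge0 _)) e2 (etrans (esym vE) VE).
  have := limit_ineq p us VE; lra.
have step x y : 0 < k (x - y) -> v x / u x = v y / u y.
  move=> kp; have /eqP := sq0 (x, y).
  rewrite /sqform /= mulf_eq0 (gt_eqF kp) mulf_eq0 mulf_eq0 (gt_eqF (u0 x)) (gt_eqF (u0 y)) /= sqrf_eq0.
  by rewrite subr_eq0 => /eqP.
pose c := v 0 / u 0.
have vc x : v x / u x = c.
  elim/lattice_ind: x => [//|x i <-|x i <-]; apply/esym/step.
    by rewrite opprD addrA subrr sub0r ksym.
  by rewrite opprB addrCA subrr addr0.
have vcu x : v x = c * u x by rewrite -(vc x) divfK// lt0r_neq0.
have : (wsum w v = (c ^+ 2)%:E * \esum_(x in setT) (f x * u x)%:E)%E.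
  rewrite -esumZl; [|exact: sqr_ge0|by move=> x; rewrite lee_fin mulr_ge0// ltW].
  apply: eq_esum => x _; rewrite -EFinM; congr EFin; rewrite vcu.
  by field; rewrite lt0r_neq0.
rewrite -vE VE foo.
have [c0 _|c0] := eqVneq c 0.
  by apply/funext => x; rewrite vcu c0 mul0r.
by rewrite gt0_muley// lte_fin exprn_even_gt0.
Qed.

End Limit.

End AbstractForm.

(** * Fractional differences of powers *)

Section EsumIntegral.
Variables (R : realType) (T : countType).
Local Open Scope ereal_scope.

(** Turns an unordered sum into a series along the encoding of [T], so that monotone convergence for
    series applies. *)
Lemma esum_countable (a : T -> \bar R) : (forall x, 0 <= a x) ->
  \esum_(x in setT) a x = \sum_(n <oo) (oapp a 0 (pickle_inv n : option T)).
Proof.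
move=> a0; pose h n : \bar R := oapp a 0 (pickle_inv n : option T).
have h0 n : 0 <= h n by rewrite /h; case: pickle_inv.
rewrite nneseries_esumT; last exact: h0.
rewrite -/h (esumID (range (@pickle T)) setT h); last by move=> n _; exact: h0.
rewrite setTI [X in _ + X]esum1 ?adde0; last first.
  move=> n [_ /= ni]; rewrite /h; case E : (pickle_inv n) => [x|]//=.
  exfalso; apply: ni; exists x => //.
  by have := @pickle_invK T n; rewrite /ocancel /oapp E.
rewrite esum_image; last by move=> x y _ _; exact: (pcan_inj (@pickleK_inv T)).
by apply: eq_esum => x _; rewrite /h pickleK_inv.
Qed.

Lemma integral_esum (D : set R) (F : T -> R -> \bar R) : measurable D ->
  (forall x, measurable_fun D (F x)) -> (forall x t, D t -> 0 <= F x t) ->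
  \int[mu]_(t in D) (\esum_(x in setT) F x t) = \esum_(x in setT) (\int[mu]_(t in D) F x t).
Proof.
move=> mD mF F0; rewrite esum_countable; last first.
  by move=> x; apply: integral_ge0 => t Dt; exact: F0.
transitivity (\int[mu]_(t in D) (\sum_(n <oo)
    (fun n t => oapp (fun x => F x t) 0 (pickle_inv n : option T)) n t)).
  apply: eq_integral => t /[!inE] Dt; rewrite (@esum_countable (fun x => F x t))//.
  by move=> x; exact: F0.
rewrite integral_nneseries//.
- congr (limn _); apply/funext => N; apply: eq_bigr => n _.
  by case: pickle_inv => [x|]//=; rewrite integral0.
- by move=> n; case: (pickle_inv n) => [x|] /=; [exact: mF|exact: measurable_cst].
- by move=> n t Dt; case: pickle_inv => [x|]//=; exact: F0.
Qed.

Lemma measurable_esum (D : set R) (F : T -> R -> \bar R) : measurable D ->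
  (forall x, measurable_fun D (F x)) -> (forall x t, D t -> 0 <= F x t) ->
  measurable_fun D (fun t => \esum_(x in setT) F x t).
Proof.
move=> mD mF F0.
apply: (eq_measurable_fun (fun t => \sum_(n <oo)
    (fun n t => oapp (fun x => F x t) 0 (pickle_inv n : option T)) n t)).
  move=> t /[!inE] Dt; rewrite (@esum_countable (fun x => F x t))//.
  by move=> x; exact: F0.
apply: ge0_emeasurable_sum.
- by move=> n t Dt _; case: pickle_inv => [x|]//=; exact: F0.
- by move=> n _; case: pickle_inv => [x|]//=; exact: measurable_cst.
Qed.

End EsumIntegral.

Section HalfLineSubstitution.
Variable R : realType.
Implicit Types (F : R -> R) (r t : R).

Lemma integral_pos_scale F r : 0 < r -> measurable_fun setT F ->
  (forall x, 0 < x -> 0 <= F x) ->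
  (\int[mu]_(x in pos) (F x)%:E = r%:E * \int[mu]_(x in pos) (F (r * x))%:E)%E.
Proof.
move=> r0 mF F0.
pose G := (fun x => (F x)%:E) \_ pos.
have mG : measurable_fun setT G.
  apply/(measurable_restrict _ _ measurableT); first exact: measurable_pos.
  by rewrite setTI; apply/measurable_EFinP; exact: measurable_funTS.
have G0 x : (0 <= G x)%E.
  by rewrite /G patchE; case: ifP => //; rewrite in_pos => x0; rewrite lee_fin F0.
rewrite [LHS]integral_mkcond -/G.
have := ge0_integral_affine 0 r0 mG G0; rewrite [in X in _ -> _ = X]integral_mkcond => h.
rewrite (_ : ((fun x => (F (r * x))%:E) \_ pos) = (fun x => G (r * x + 0)%R)).
  by rewrite h muleA -EFinM divff ?gt_eqF// mul1e.
apply/funext => x; rewrite /G !patchE !in_pos addr0 pmulr_rgt0//.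
Qed.

Lemma integral_pos_shift F t : 0 <= t -> measurable_fun setT F ->
  (forall x, t < x -> 0 <= F x) ->
  (\int[mu]_(x in pos) (F (t + x)%R)%:E = \int[mu]_(x in pos) ((t < x)%R%:R * F x)%:E)%E.
Proof.
move=> t0 mF F0.
pose G := (fun x => (F x)%:E) \_ [set x | t < x].
have mt : measurable [set x : R | t < x].
  by rewrite (_ : [set x | _] = `]t, +oo[%classic)//; apply/seteqP; split => x/=; rewrite in_itv/= andbT.
have mG : measurable_fun setT G.
  apply/(measurable_restrict _ _ measurableT); first exact: mt.
  by rewrite setTI; apply/measurable_EFinP; exact: measurable_funTS.
have int : forall x, (x \in [set x | t < x]) = (t < x) by move=> x; apply/idP/idP; rewrite inE.
have G0 x : (0 <= G x)%E.
  by rewrite /G patchE; case: ifP => //; rewrite int => x0; rewrite lee_fin F0.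
rewrite [LHS]integral_mkcond [RHS]integral_mkcond.
have := ge0_integral_affine t ltr01 mG G0; rewrite invr1 mul1e => h.
transitivity (\int[mu]_x G (1 * x + t)%R)%E; last rewrite h.
  apply: eq_integral => x _; rewrite /G !patchE in_pos int mul1r ltrDr addrC.
  by [].
apply: eq_integral => x _; rewrite /G !patchE in_pos int.
case: (ltP t x) => tx; first by rewrite (le_lt_trans t0 tx) mul1r.
by rewrite mul0r; case: ifP.
Qed.

Lemma measurable_powR_comp d (T : measurableType d) (g : T -> R) b :
  measurable_fun setT g -> measurable_fun setT (fun x => g x `^ b).
Proof.
move=> mg; apply: (measurableT_comp (f := fun x : R => x `^ b)) => //.
Qed.

Lemma measurable_section1 (h : R -> R -> R) t :
  measurable_fun setT (fun p : R * R => h p.1 p.2) -> measurable_fun setT (h t).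
Proof.
move=> mh; apply: (measurableT_comp (f := fun p : R * R => h p.1 p.2) (g := pair t)) => //.
Qed.

Lemma measurable_section2 (h : R -> R -> R) r :
  measurable_fun setT (fun p : R * R => h p.1 p.2) -> measurable_fun setT (h ^~ r).
Proof.
move=> mh; apply: (measurableT_comp (f := fun p : R * R => h p.1 p.2) (g := pair^~ r)) => //.
Qed.

Lemma measurable_lt_ind : measurable_fun setT (fun p : R * R => ((p.1 < p.2)%R%:R : R)).
Proof.
have mlt : measurable [set p : R * R | p.1 < p.2].
  have h := measurable_fun_ltr (measurable_fst (T1 := R) (T2 := R)) measurable_snd.
  by have := h measurableT [set true]; rewrite setTI; exact.
rewrite (_ : (fun _ => _) = \1_[set p : R * R | p.1 < p.2]).
  exact: measurable_indic.
apply/funext => p; rewrite indicE; congr ((nat_of_bool _)%:R).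
by apply/idP/idP; rewrite inE.
Qed.

End HalfLineSubstitution.

(** Eliminates [Kpos - Kneg], here [kp - kn], between [gamma_balance] and [fractional_balance]. *)
Lemma balance_arith (F : fieldType) (ga gs g kp kn x y p : F) : gs != 0 ->
  ga * g + kn * gs = kp * gs -> x + kn * p = y + kp * p -> x = ga / gs * g * p + y.
Proof.
move=> gs0 e h; have -> : ga / gs * g = kp - kn.
  by apply: (mulIf gs0); rewrite mulrBl -e addrK; field.
by rewrite mulrBl; apply: (addIr (kn * p)); rewrite h; ring.
Qed.

(** * The difference of a power and its translate, integrated against t^(-s-1) *)

Section FractionalDifference.
Variables (R : realType) (a s : R).
Hypotheses (s0 : 0 < s) (s1 : s < 1) (sa : s < a).
Implicit Types (r t : R) (q : R -> R).

Let a0 : 0 < a := lt_trans s0 sa.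

(* [spow t r] is (r - t)_+^(a-1); the indicator is needed because [x `^ y] is not [0]
   for [x <= 0]. *)
Definition spow t r : R := (t < r)%R%:R * (r - t) `^ (a - 1).
(** For [a < 1] and [t > 0] the difference is positive when [0 < r <= t] and negative when [r > t];
    its two parts are therefore integrated separately. *)
Definition dpos t r : R := Num.max 0 (r `^ (a - 1) - spow t r).
Definition dneg t r : R := Num.max 0 (spow t r - r `^ (a - 1)).

Lemma spow_ge0 t r : 0 <= spow t r.
Proof. by rewrite mulr_ge0 ?powR_ge0. Qed.

Lemma dpos_ge0 t r : 0 <= dpos t r.
Proof. by rewrite le_max lexx. Qed.

Lemma dneg_ge0 t r : 0 <= dneg t r.
Proof. by rewrite le_max lexx. Qed.

Lemma dpos_dneg t r : r `^ (a - 1) + dneg t r = spow t r + dpos t r.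
Proof.
rewrite /dpos /dneg; case: (lerP (r `^ (a - 1)) (spow t r)) => h.
  rewrite (max_idPr _) ?subr_ge0// (max_idPl _) ?subr_le0//; ring.
by rewrite (max_idPl _) ?subr_le0 ?(ltW h)// (max_idPr _) ?subr_ge0 ?(ltW h)//; ring.
Qed.

Lemma measurable_spow : measurable_fun setT (fun p : R * R => spow p.1 p.2).
Proof.
apply: measurable_funM; first exact: measurable_lt_ind.
apply: measurable_powR_comp.
by apply: measurable_funB; [exact: measurable_snd|exact: measurable_fst].
Qed.

Lemma measurable_snd_powR : measurable_fun setT (fun p : R * R => p.2 `^ (a - 1)).
Proof.
by apply: measurable_powR_comp; exact: measurable_snd.
Qed.

Lemma measurable_dpos : measurable_fun setT (fun p : R * R => dpos p.1 p.2).
Proof.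
apply: measurable_maxr; first exact: measurable_cst.
by apply: measurable_funB; [exact: measurable_snd_powR|exact: measurable_spow].
Qed.

Lemma measurable_dneg : measurable_fun setT (fun p : R * R => dneg p.1 p.2).
Proof.
apply: measurable_maxr; first exact: measurable_cst.
by apply: measurable_funB; [exact: measurable_spow|exact: measurable_snd_powR].
Qed.

Lemma spow_homog t r : 0 < r -> 0 < t -> spow (r * t) r = r `^ (a - 1) * spow t 1.
Proof.
move=> r0 t0; rewrite /spow -{2}[r]mulr1 ltr_pM2l//.
case: (ltP t 1) => t1; last by rewrite !mul0r mulr0.
rewrite (_ : r - r * t = r * (1 - t)); last by ring.
rewrite powRM ?(ltW r0) ?subr_ge0 ?(ltW t1)//; ring.
Qed.

Lemma dpos_homog t r : 0 < r -> 0 < t -> dpos (r * t) r = r `^ (a - 1) * dpos t 1.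
Proof.
move=> r0 t0; rewrite /dpos spow_homog// powR1 -{1}[r `^ _]mulr1 -mulrBr.
by rewrite maxr_pMr ?powR_ge0// mulr0.
Qed.

Lemma dneg_homog t r : 0 < r -> 0 < t -> dneg (r * t) r = r `^ (a - 1) * dneg t 1.
Proof.
move=> r0 t0; rewrite /dneg spow_homog// powR1 -{2}[r `^ _]mulr1 -mulrBr.
by rewrite maxr_pMr ?powR_ge0// mulr0.
Qed.

Lemma integral_homog (h : R -> R -> R) r : 0 < r ->
  measurable_fun setT (fun p : R * R => h p.1 p.2) -> (forall t r, 0 <= h t r) ->
  (forall t, 0 < t -> h (r * t) r = r `^ (a - 1) * h t 1) ->
  (\int[mu]_(t in pos) (t `^ (- s - 1) * h t r)%:E =
   (r `^ (a - s - 1))%:E * \int[mu]_(t in pos) (t `^ (- s - 1) * h t 1)%:E)%E.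
Proof.
move=> r0 mh h0 hh.
have mhr r' : measurable_fun setT (fun t => t `^ (- s - 1) * h t r').
  apply: measurable_funM; first exact: measurable_powR.
  exact: measurable_section2.
rewrite (integral_pos_scale r0)//; last by move=> x x0; rewrite mulr_ge0 ?powR_ge0.
transitivity (r%:E * \int[mu]_(t in pos) (r `^ (a - s - 2) * (t `^ (- s - 1) * h t 1))%:E)%E.
  congr (_ * _)%E; apply: eq_integral => t /[!in_pos] t0; congr EFin; rewrite hh// powRM ?(ltW r0) ?(ltW t0)//.
  rewrite (_ : a - s - 2 = (- s - 1) + (a - 1)); last by ring.
  by rewrite -(@powR_mulD R r (- s - 1) (a - 1) r0); ring.
rewrite ge0_integralZlR.
- rewrite muleA -EFinM; congr (_%:E * _)%E.
  rewrite -{1}[r]powRr1 ?(ltW r0)// powR_mulD//; congr (_ `^ _); ring.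
- exact: measurable_pos.
- exact: measurable_funTS.
- by move=> t _; rewrite mulr_ge0 ?powR_ge0.
- exact: powR_ge0.
Qed.

Definition Kpos : \bar R := (\int[mu]_(t in pos) (t `^ (- s - 1) * dpos t 1)%:E)%E.
Definition Kneg : \bar R := (\int[mu]_(t in pos) (t `^ (- s - 1) * dneg t 1)%:E)%E.

Lemma integral_weighted q (h : R -> R -> R) :
  measurable_fun setT q -> (forall r, 0 < r -> 0 <= q r) ->
  measurable_fun setT (fun p : R * R => h p.1 p.2) -> (forall t r, 0 <= h t r) ->
  (forall t r, 0 < r -> 0 < t -> h (r * t) r = r `^ (a - 1) * h t 1) ->
  (\int[mu]_(t in pos) ((t `^ (- s - 1))%:E * \int[mu]_(r in pos) (q r * h t r)%:E) =
   \int[mu]_(t in pos) (t `^ (- s - 1) * h t 1)%:E *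
     \int[mu]_(r in pos) (q r * r `^ (a - s - 1))%:E)%E.
Proof.
move=> mq q0 mh h0 hh.
have mF : measurable_fun setT (fun p : R * R => q p.2 * h p.1 p.2).
  by apply: measurable_funM => //; apply: measurableT_comp => //; exact: measurable_snd.
have mG : measurable_fun setT (fun p : R * R => (p.1 `^ (- s - 1) * (q p.2 * h p.1 p.2))%:E).
  apply/measurable_EFinP; apply: measurable_funM => //.
  by apply: measurable_powR_comp; exact: measurable_fst.
transitivity (\int[mu]_(t in pos) \int[mu]_(r in pos) (t `^ (- s - 1) * (q r * h t r))%:E)%E.
  apply: eq_integral => t _; rewrite ge0_integralZlR//.
  - exact: measurable_pos.
  - apply: measurable_funTS.
    exact: (@measurable_section1 R (fun t r => q r * h t r)).
  - by move=> r r0; rewrite mulr_ge0 ?q0.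
  - exact: powR_ge0.
rewrite (@ge0_tonelli R pos pos (fun t r => (t `^ (- s - 1) * (q r * h t r))%:E))//; last 3 first.
- exact: measurable_pos.
- exact: measurable_pos.
- by move=> t r _ r0; rewrite lee_fin mulr_ge0 ?powR_ge0// mulr_ge0// q0.
have mhr r' : measurable_fun setT (fun t => t `^ (- s - 1) * h t r').
  apply: measurable_funM; first exact: measurable_powR.
  exact: measurable_section2.
rewrite -ge0_integralZl; last 4 first.
- exact: measurable_pos.
- apply/measurable_EFinP; apply: measurable_funTS; apply: measurable_funM => //; exact: measurable_powR.
- by move=> r r0; rewrite lee_fin mulr_ge0 ?powR_ge0 ?q0.
- by apply: integral_ge0 => t _; rewrite lee_fin mulr_ge0 ?powR_ge0.
apply: eq_integral => r /[!in_pos] r0.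
transitivity (\int[mu]_(t in pos) (q r * (t `^ (- s - 1) * h t r))%:E)%E.
  by apply: eq_integral => t _; congr EFin; ring.
rewrite ge0_integralZlR//; last 4 first.
- exact: measurable_pos.
- exact: measurable_funTS.
- by move=> t _; rewrite mulr_ge0 ?powR_ge0.
- exact: q0.
rewrite (integral_homog r0 mh h0); last by move=> t t0; exact: hh.
by rewrite [RHS]muleC EFinM muleA.
Qed.

(* Both differences are homogeneous in [(t, r)], so integrating them against
   [t^(-s-1)] produces constants [Kpos], [Kneg] times [r^(a-s-1)]. *)
Lemma fractional_balance q (D T : R -> \bar R) (P : R) :
  measurable_fun setT q -> (forall r, 0 < r -> 0 <= q r) ->
  measurable_fun (pos : set R) D -> (forall t, 0 < t -> (0 <= D t)%E) ->
  measurable_fun (pos : set R) T -> (forall t, 0 < t -> (0 <= T t)%E) ->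
  (\int[mu]_(r in pos) (q r * r `^ (a - 1))%:E = P%:E)%E ->
  (forall t, 0 < t -> (\int[mu]_(r in pos) (q (t + r)%R * r `^ (a - 1))%:E)%E \is a fin_num) ->
  (forall t, 0 < t -> (D t + \int[mu]_(r in pos) (q (t + r)%R * r `^ (a - 1))%:E
      = P%:E + T t)%E) ->
  (\int[mu]_(t in pos) ((t `^ (- s - 1))%:E * D t) +
     Kneg * \int[mu]_(r in pos) (q r * r `^ (a - s - 1))%:E =
   \int[mu]_(t in pos) ((t `^ (- s - 1))%:E * T t) +
     Kpos * \int[mu]_(r in pos) (q r * r `^ (a - s - 1))%:E)%E.
Proof.
move=> mq q0 mD D0 mT T0 PE Sfin DST.
pose H (h : R -> R -> R) t := (\int[mu]_(r in pos) (q r * h t r)%:E)%E.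
have mt h t : measurable_fun setT (fun p : R * R => h p.1 p.2) ->
    measurable_fun setT (fun r => q r * h t r).
  move=> mh; apply: measurable_funM => //.
  exact: measurable_section1.
have H0 h t : (forall t r, 0 <= h t r) -> (0 <= H h t)%E.
  by move=> h0; apply: integral_ge0 => r r0; rewrite lee_fin mulr_ge0// q0.
have mH (h : R -> R -> R) : measurable_fun setT (fun p : R * R => h p.1 p.2) -> (forall t r, 0 <= h t r) ->
    measurable_fun (pos : set R) (H h).
  move=> mh h0; apply: (@measurable_integral_snd R pos pos (fun t r => (q r * h t r)%:E)).
  - exact: measurable_pos.
  - apply/measurable_EFinP; apply: measurable_funM => //.
    by apply: measurableT_comp => //; exact: measurable_snd.
  - by move=> t r r0; rewrite lee_fin mulr_ge0// q0.
have mp : measurable_fun (pos : set R) (fun t => (t `^ (- s - 1))%:E).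
  by apply/measurable_EFinP; apply: measurable_funTS; exact: measurable_powR.
have SE t : 0 < t -> (\int[mu]_(r in pos) (q (t + r)%R * r `^ (a - 1))%:E = H spow t)%E.
  move=> t0; pose F r := q r * (r - t) `^ (a - 1).
  have mF : measurable_fun setT F.
    by apply: measurable_funM => //; apply: measurable_powR_comp; exact: measurable_funB.
  transitivity (\int[mu]_(r in pos) (F (t + r)%R)%:E)%E.
    by apply: eq_integral => r _; rewrite /F (addrC t) addrK.
  rewrite (integral_pos_shift (ltW t0) mF); last first.
    by move=> x tx; rewrite mulr_ge0 ?powR_ge0// q0// (lt_trans t0).
  by apply: eq_integral => r _; congr EFin; rewrite /F /spow; ring.
have bal t : 0 < t -> (D t + H dneg t = T t + H dpos t)%E.
  move=> t0.
  have e1 : (P%:E + H dneg t = H spow t + H dpos t)%E.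
    rewrite -PE /H -!ge0_integralD//.
    - by apply: eq_integral => r _; rewrite -!EFinD -!mulrDr dpos_dneg.
    - exact: measurable_pos.
    - by move=> r r0; rewrite lee_fin mulr_ge0 ?spow_ge0 ?q0.
    - by apply/measurable_EFinP; apply: measurable_funTS; exact: (mt _ _ measurable_spow).
    - by move=> r r0; rewrite lee_fin mulr_ge0 ?dpos_ge0 ?q0.
    - by apply/measurable_EFinP; apply: measurable_funTS; exact: (mt _ _ measurable_dpos).
    - exact: measurable_pos.
    - by move=> r r0; rewrite lee_fin mulr_ge0 ?powR_ge0 ?q0.
    - apply/measurable_EFinP; apply: measurable_funTS; apply: measurable_funM => //; exact: measurable_powR.
    - by move=> r r0; rewrite lee_fin mulr_ge0 ?dneg_ge0 ?q0.
    - by apply/measurable_EFinP; apply: measurable_funTS; exact: (mt _ _ measurable_dneg).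
  have := DST t t0; have := Sfin t t0; rewrite SE// => Sf e2.
  (* The integrals of [dpos] and [dneg] are not known to be finite here, so only this finite
     quantity is added to both sides and then cancelled. *)
  have zf : (P%:E + H spow t)%E \is a fin_num by rewrite fin_numD Sf.
  have e3 : ((D t + H dneg t) + (P%:E + H spow t) = (T t + H dpos t) + (P%:E + H spow t))%E.
    by rewrite addeACA (addeC (H dneg t)) addeACA e2 e1 addeACA addeC.
  by rewrite -[LHS](addeK _ zf) e3 addeK.
rewrite -/(H _) -(integral_weighted mq q0 measurable_dneg dneg_ge0 dneg_homog).
rewrite -(integral_weighted mq q0 measurable_dpos dpos_ge0 dpos_homog).
have IW (D' : R -> \bar R) (h : R -> R -> R) : measurable_fun (pos : set R) D' -> (forall t, 0 < t -> (0 <= D' t)%E) ->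
    measurable_fun setT (fun p : R * R => h p.1 p.2) -> (forall t r, 0 <= h t r) ->
    (\int[mu]_(t in pos) ((t `^ (- s - 1))%:E * D' t) +
     \int[mu]_(t in pos) ((t `^ (- s - 1))%:E * H h t) =
     \int[mu]_(t in pos) ((t `^ (- s - 1))%:E * (D' t + H h t)))%E.
  move=> mD' D'0 mh h0.
  transitivity (\int[mu]_(t in pos)
      ((t `^ (- s - 1))%:E * D' t + (t `^ (- s - 1))%:E * H h t))%E; last first.
    by apply: eq_integral => t /[!in_pos] t0; apply/esym/ge0_muleDr; [exact: D'0|exact: H0].
  rewrite ge0_integralD.
  - by [].
  - exact: measurable_pos.
  - by move=> t t0; rewrite mule_ge0 ?lee_fin ?powR_ge0// D'0.
  - exact: emeasurable_funM.
  - by move=> t t0; rewrite mule_ge0 ?lee_fin ?powR_ge0// H0.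
  - by apply: emeasurable_funM => //; exact: mH.
rewrite (IW D dneg mD D0 measurable_dneg dneg_ge0) (IW T dpos mT T0 measurable_dpos dpos_ge0).
by apply: eq_integral => t /[!in_pos] t0; rewrite bal.
Qed.

(** The value is [|Gamma (- s)|]. Write [1 - exp (- t)] as the integral of [exp (- v)] over [v <= t]
    and integrate in [t] first. *)
Lemma integral_1mexp :
  (\int[mu]_(t in pos) (t `^ (- s - 1) * (1 - expR (- t)))%:E = (Gamma_pos (1 - s) / s)%:E)%E.
Proof.
have exps c : 0 < c -> (\int[mu]_(t in `]0%R, c]) (expR (- t))%:E = (1 - expR (- c))%:E :> \bar R)%E.
  have dd (x : R) : is_derive x 1 (fun t => - expR (- t)) (expR (- x)).
    have h := is_deriveN (is_derive1_comp (is_derive_expR (- x)) (is_deriveN (is_derive_id x (1:R)))).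
    apply: (is_derive_eq h).
    by rewrite /GRing.scale/= mulrN1 opprK.
  move=> c0.
  rewrite integral_itv_obnd_cbnd; last first.
    by apply: measurable_funTS; apply/measurable_EFinP; apply: measurableT_comp.
  rewrite (@continuous_FTC2 _ _ (fun t => - expR (- t)))//.
  - by rewrite oppr0 expR0 -EFinB opprK addrC.
  - by apply: continuous_subspaceT => x; apply: continuous_comp; [exact: opp_continuous|exact: continuous_expR].
  - split.
    + by move=> x _; have [] := dd x.
    + apply: cvg_at_right_filter; exact: (is_derive_cts (dd 0)).
    + apply: cvg_at_left_filter; exact: (is_derive_cts (dd c)).
  - by move=> x _; rewrite derive1E; have [_ ->] := dd x.
transitivity (\int[mu]_(v in pos) ((expR (- v))%:E * \int[mu]_(t in `[v, +oo[) (t `^ (- s - 1))%:E))%E.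
  rewrite (@tonelli_triangle R (fun v => expR (- v)) (fun t => t `^ (- s - 1)))//.
  - by apply: eq_integral => t /[!in_pos] t0; rewrite exps// EFinM.
  - by apply: measurableT_comp.
  - by move=> t _; exact: powR_ge0.
transitivity (\int[mu]_(v in pos) (s^-1 * (v `^ ((1 - s) - 1) * expR (- v)))%:E)%E.
  apply: eq_integral => v /[!in_pos] v0; rewrite integral_powR_oo// -EFinM; congr EFin.
  rewrite (_ : 1 - s - 1 = - s); [ring|by ring].
have s10 : 0 < 1 - s by rewrite subr_gt0.
rewrite ge0_integralZlR; last 4 first.
- exact: measurable_pos.
- by apply: measurable_funTS; exact: measurable_gamma_ker.
- by move=> t _; rewrite mulr_ge0 ?powR_ge0 ?expR_ge0.
- by rewrite invr_ge0 ltW.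
by rewrite Gamma_pos_integral// -EFinM mulrC.
Qed.

Lemma Kneg_ge0 : (0 <= Kneg)%E.
Proof. by apply: integral_ge0 => t _; rewrite lee_fin mulr_ge0 ?powR_ge0 ?dneg_ge0. Qed.

Lemma Kpos_ge0 : (0 <= Kpos)%E.
Proof. by apply: integral_ge0 => t _; rewrite lee_fin mulr_ge0 ?powR_ge0 ?dpos_ge0. Qed.

(* Evaluates [Kpos - Kneg] by testing the balance on [q r = exp (-r)]. *)
Lemma gamma_balance :
  ((Gamma_pos a * (Gamma_pos (1 - s) / s))%:E + Kneg * (Gamma_pos (a - s))%:E =
   Kpos * (Gamma_pos (a - s))%:E)%E.
Proof.
have as0 : 0 < a - s by rewrite subr_gt0.
have mexp : measurable_fun setT (fun r : R => expR (- r)) by apply: measurableT_comp.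
have exp0 r : 0 < r -> 0 <= expR (- r) by move=> _; exact: expR_ge0.
have G (b : R) : 0 < b -> (\int[mu]_(r in pos) (expR (- r) * r `^ (b - 1))%:E = (Gamma_pos b)%:E)%E.
  by move=> b0; rewrite -Gamma_pos_integral//; apply: eq_integral => r _; rewrite mulrC.
have S t : (\int[mu]_(r in pos) (expR (- (t + r)) * r `^ (a - 1))%:E
    = (expR (- t) * Gamma_pos a)%:E)%E.
  rewrite EFinM -G// -ge0_integralZlR//.
  - by apply: eq_integral => r _; rewrite opprD expRD mulrA.
  - exact: measurable_pos.
  - by apply: measurable_funTS; apply: measurable_funM => //; exact: measurable_powR.
  - by move=> r _; rewrite mulr_ge0 ?powR_ge0 ?expR_ge0.
have := @fractional_balance (fun r => expR (- r))
  (fun t => (Gamma_pos a * (1 - expR (- t)))%:E) (fun=> 0%E) (Gamma_pos a) mexp exp0.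
have Ga := ltW (Gamma_pos_gt0 a0).
have mD : measurable_fun setT (fun t : R => 1 - expR (- t)) by exact: measurable_funB.
rewrite G// G// [X in _ -> _ -> _ -> _ -> _ -> _ -> _ -> (_ = X + _)%E]integral0_eq; last first.
  by move=> t _; rewrite mule0.
rewrite add0e => h; rewrite -h.
- congr (_ + _)%E; rewrite EFinM -integral_1mexp -ge0_integralZlR//.
  + by apply: eq_integral => t _; rewrite -EFinM; congr EFin; ring.
  + exact: measurable_pos.
  + by apply: measurable_funTS; apply: measurable_funM => //; exact: measurable_powR.
  + move=> t t0; rewrite mulr_ge0 ?powR_ge0// subr_ge0 -expR0 ler_expR oppr_le0 ltW//.
- by apply/measurable_EFinP; apply: measurable_funTS; exact: measurable_funM.
- by move=> t t0; rewrite lee_fin mulr_ge0// subr_ge0 -expR0 ler_expR oppr_le0 ltW.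
- exact: measurable_cst.
- by move=> t _.
- by [].
- by move=> t _; rewrite S.
- by move=> t _; rewrite S -!EFinD; congr EFin; ring.
Qed.

(** For [a <= 1], [dpos t 1] vanishes when [0 < t < 1] and is at most 1, so the integral converges.
    For [a > 1] the negative part vanishes instead, and [gamma_balance] bounds [Kpos]. *)
Lemma Kpos_fin : Kpos \is a fin_num.
Proof.
have as0 : 0 < a - s by rewrite subr_gt0.
have G0 := Gamma_pos_gt0 as0.
have [a1|a1] := leP a 1.
  have h t : 0 < t -> t < 1 -> dpos t 1 = 0.
    move=> t0 t1; rewrite /dpos /spow t1 mul1r powR1; apply/max_idPl; rewrite subr_le0.
    have h1 : 0 < 1 - t by rewrite subr_gt0.
    rewrite -[leLHS](powRr0 (1 - t)); apply: ger_powR; last by rewrite subr_le0.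
    by rewrite h1 /= gerBl ltW.
  have h' t : dpos t 1 <= 1.
    by rewrite /dpos powR1 ge_max ler01 gerBl spow_ge0.
  rewrite ge0_fin_numE ?Kpos_ge0//; apply: le_lt_trans (ltry _).
  apply: (@integral_pos_bound R 1 s 1 1 1) => //.
  - apply: measurable_funM; first exact: measurable_powR.
    exact: measurable_section2 measurable_dpos.
  - by move=> t _; rewrite mulr_ge0 ?powR_ge0 ?dpos_ge0.
  - move=> t t0; rewrite subrr powRr0 mul1r le_eqVlt => /predU1P[->|t1].
      by rewrite powR1 mul1r.
    by rewrite h// mulr0.
  - by move=> t _; rewrite mul1r -[leRHS]mulr1 ler_wpM2l ?powR_ge0.
have K0 : Kneg = 0%E.
  apply: integral0_eq => t t0; congr EFin; rewrite (_ : dneg t 1 = 0) ?mulr0//.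
  apply/max_idPl; rewrite subr_le0 powR1 /spow.
  case: (ltP t 1) => t1; last by rewrite mul0r.
  have h1 : 0 < 1 - t by rewrite subr_gt0.
  rewrite mul1r -[leRHS](powRr0 (1 - t)); apply: ger_powR; last by rewrite subr_ge0 ltW.
  by rewrite h1 /= gerBl ltW.
have := gamma_balance; rewrite K0 mul0e adde0 => h.
have := Kpos_ge0; case: Kpos h => [k||]//; rewrite gt0_mulye//.
Qed.

Lemma Kneg_fin : Kneg \is a fin_num.
Proof.
have as0 : 0 < a - s by rewrite subr_gt0.
have G0 := Gamma_pos_gt0 as0.
have := gamma_balance; have := Kneg_ge0; rewrite -[Kpos]fineK ?Kpos_fin//.
by case: Kneg => [k||]//; rewrite gt0_mulye.
Qed.

(** The form in which the balance is used: with [q] the heat kernel at a point, [D] the loss at the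
    diagonal and [T] the gain from the other points. *)
Lemma fractional_identity q (D T : R -> \bar R) (P P' : R) :
  measurable_fun setT q -> (forall r, 0 < r -> 0 <= q r) ->
  measurable_fun (pos : set R) D -> (forall t, 0 < t -> (0 <= D t)%E) ->
  measurable_fun (pos : set R) T -> (forall t, 0 < t -> (0 <= T t)%E) ->
  (\int[mu]_(r in pos) (q r * r `^ (a - 1))%:E = P%:E)%E ->
  (\int[mu]_(r in pos) (q r * r `^ (a - s - 1))%:E = P'%:E)%E ->
  (forall t, 0 < t -> (\int[mu]_(r in pos) (q (t + r)%R * r `^ (a - 1))%:E)%E \is a fin_num) ->
  (forall t, 0 < t -> (D t + \int[mu]_(r in pos) (q (t + r)%R * r `^ (a - 1))%:E
      = P%:E + T t)%E) ->
  (\int[mu]_(t in pos) ((t `^ (- s - 1))%:E * D t) =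
   (Gamma_pos a / Gamma_pos (a - s) * (Gamma_pos (1 - s) / s) * P')%:E +
   \int[mu]_(t in pos) ((t `^ (- s - 1))%:E * T t))%E.
Proof.
move=> mq q0 mD D0 mT T0 PE P'E Sf e.
have as0 : 0 < a - s by rewrite subr_gt0.
have G0 := Gamma_pos_gt0 as0.
have := fractional_balance mq q0 mD D0 mT T0 PE Sf e; rewrite P'E.
have := gamma_balance; rewrite -[Kpos]fineK ?Kpos_fin// -[Kneg]fineK ?Kneg_fin//.
rewrite -!EFinM -EFinD => -[gb].
have ge E : (forall t, 0 < t -> (0 <= E t)%E) ->
    (0 <= \int[mu]_(t in pos) ((t `^ (- s - 1))%:E * E t))%E.
  by move=> E0; apply: integral_ge0 => t t0; rewrite mule_ge0 ?lee_fin ?powR_ge0// E0.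
have := ge D D0; have := ge T T0.
case: (\int[mu]_(t in pos) ((t `^ (- s - 1))%:E * D t))%E => [x||]//;
case: (\int[mu]_(t in pos) ((t `^ (- s - 1))%:E * T t))%E => [y||]// _ _.
rewrite -!EFinD => -[h]; congr EFin.
exact: (balance_arith (lt0r_neq0 G0) gb h).
Qed.

End FractionalDifference.

(** * The equation satisfied by the Riesz kernel *)

Section PositiveIntegral.
Variable R : realType.

Lemma measurable_tail (g : R -> R) : measurable_fun setT g ->
  (forall t, 0 < t -> 0 <= g t) ->
  measurable_fun (pos : set R) (fun t => \int[mu]_(s in `[t, +oo[) (g s)%:E)%E.
Proof.
move=> mg g0.
pose h t s : \bar R := (g s * \1_[set p : R * R | p.1 <= p.2] (t, s))%:E.
apply: (eq_measurable_fun (fun t => \int[mu]_(s in pos) h t s)%E).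
  move=> t /[!in_pos] t0; rewrite [RHS]integral_mkcond [LHS]integral_mkcond.
  apply: eq_integral => s _.
  rewrite !patchE in_pos in_itv_ge /h (indic_le fst snd)/=.
  have [ts|st] := leP t s; last by rewrite mulr0; case: ifP.
  by rewrite (lt_le_trans t0 ts) mulr1.
apply: measurable_integral_snd; first exact: measurable_pos.
- apply/measurable_EFinP; apply: measurable_funM; first exact: measurableT_comp.
  rewrite (_ : (fun _ => _) = \1_[set p : R * R | p.1 <= p.2]).
    by apply/measurable_indicP; exact: measurable_set_le.
  by apply/funext => -[].
- by move=> t s /g0 gs; rewrite lee_fin mulr_ge0// indicE ler0n.
Qed.

Lemma integral_pos_gt0 (F : R -> R) : measurable_fun setT F ->
  (forall t, 0 < t -> 0 < F t) -> (0 < \int[mu]_(t in pos) (F t)%:E)%E.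
Proof.
move=> mF F0.
have I0 : (0 <= \int[mu]_(t in pos) (F t)%:E)%E.
  by apply: integral_ge0 => t t0; rewrite lee_fin ltW// F0.
rewrite lt_neqAle I0 andbT eq_sym; apply/eqP => I0'.
have mE : measurable_fun (pos : set R) (fun t => (F t)%:E).
  by apply/measurable_EFinP; exact: measurable_funTS.
have : (\int[mu]_(t in pos) `|(F t)%:E| = 0)%E.
  rewrite -[RHS]I0'; apply: eq_integral => t /[!in_pos] t0.
  by rewrite gee0_abs// lee_fin ltW// F0.
move=> /(ae_eq_integral_abs mu (@measurable_pos R) mE) [N [mN N0 h]].
have sub : `]0 : R, 1]%classic `<=` N.
  move=> t /=; rewrite in_itv/= => /andP[t0 _]; apply: h => /= /(_ t0) /eqP.
  by rewrite eqe gt_eqF// F0.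
have : (mu `]0%R, 1%R]%classic <= mu N)%E.
  by apply: le_measure => //; rewrite inE.
by rewrite N0 lebesgue_measure_itv/= lte_fin ltr01 oppr0 adde0 lee_fin ler10.
Qed.

End PositiveIntegral.

Section HeatOffDiagonal.
Variables (R : realType) (d : nat).
Implicit Types (t r : R) (x z : Zd d).

(** The diagonal is removed because [heat t 0] tends to 1 as [t] tends to 0, where [t^(-s-1)] is not
    integrable; this matches the convention that [kappa s] vanishes at 0. *)
Definition offd t z : R := if z == 0 then 0 else heat t z.

Lemma offd_ge0 t z : 0 <= t -> 0 <= offd t z.
Proof. by move=> t0; rewrite /offd; case: ifP => // _; exact: heat_ge0. Qed.

Lemma measurable_offd z : measurable_fun setT (offd ^~ z).
Proof.
by rewrite /offd; case: eqP => _; [exact: measurable_cst|exact: measurable_heat].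
Qed.

Lemma esum_offd t (F : Zd d -> R) : 0 <= t -> (forall z, 0 <= F z) ->
  (\esum_(z in setT) (heat t z * F z)%:E =
   (heat t (0 : Zd d) * F 0)%:E + \esum_(z in setT) (offd t z * F z)%:E)%E.
Proof.
move=> t0 F0.
pose D z := if z == 0 then heat t z * F z else 0.
have D0 z : 0 <= D z by rewrite /D; case: ifP => // _; rewrite mulr_ge0// heat_ge0.
have <- : (\esum_(z in setT) (D z)%:E = (heat t (0 : Zd d) * F 0)%:E)%E.
  transitivity (D 0)%:E; last by rewrite /D eqxx.
  apply: (@esum_single R (Zd d) (fun z => (D z)%:E) 0) => z; first by rewrite lee_fin.
  by rewrite /D => /negbTE ->.
rewrite -esumD.
- apply: eq_esum => z _; rewrite -EFinD /D /offd; case: eqP => [->|_].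
    by rewrite mul0r addr0.
  by rewrite add0r.
- by move=> z _; rewrite lee_fin.
- by move=> z _; rewrite lee_fin mulr_ge0// offd_ge0.
Qed.

Lemma offd_mass t : 0 <= t ->
  (\esum_(z in [set: Zd d]) (offd t z)%:E = (1 - heat t (0 : Zd d))%:E)%E.
Proof.
move=> t0; have := @esum_offd t (fun=> 1) t0 (fun=> ler01).
rewrite [X in X = _ -> _](_ : _ = 1%:E); last first.
  by rewrite -(@heat_mass R d t t0); apply: eq_esum => z _; rewrite mulr1.
rewrite [X in (_ + X)%E](_ : _ = \esum_(z in [set: Zd d]) (offd t z)%:E)%E; last first.
  by apply: eq_esum => z _; rewrite mulr1.
rewrite mulr1; have : (0 <= \esum_(z in [set: Zd d]) (offd t z)%:E)%E.
  by apply: esum_ge0 => z _; rewrite lee_fin offd_ge0.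
case: (esum _ _) => [x||]// _; rewrite -EFinD => -[->]; congr EFin; ring.
Qed.

Lemma riesz_ge0 (a : R) x : 0 < a -> 0 <= riesz a x.
Proof.
by move=> a0; apply: divr_ge0; [rewrite fine_ge0// kint_ge0|exact: (ltW (Gamma_pos_gt0 a0))].
Qed.

(** The finite left-hand side rules out [S = +oo]; the rest divides by the Gamma factors that
    normalise the kernels. *)
Lemma fractional_rescale (m P ga gas g p : R) (S : \bar R) :
  0 < ga -> 0 < gas -> 0 < g -> (0 <= S)%E ->
  ((m * P)%:E = (ga / gas * g * p)%:E + (g * ga)%:E * S)%E ->
  ((m / g * (P / ga))%:E = (p / gas)%:E + S)%E.
Proof.
move=> G1 G2 G3; case: S => [S||]// _; last by rewrite gt0_muley ?lte_fin ?mulr_gt0.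
rewrite -!EFinM -!EFinD => -[e]; congr EFin.
apply: (mulIf (lt0r_neq0 (mulr_gt0 G3 G1))).
rewrite [LHS](_ : _ = m * P); last by field; rewrite (gt_eqF G1) (gt_eqF G3).
by rewrite e; field; rewrite (gt_eqF G2).
Qed.

Lemma kint_shift a t x : 0 <= t ->
  (\int[mu]_(r in pos) (heat (t + r) x * r `^ (a - 1))%:E =
   \esum_(z in setT) ((heat t z)%:E * kint a (x - z)%R))%E.
Proof.
move=> t0.
have mk z : measurable_fun (pos : set R) (fun r => ((heat t z * (heat r (x - z) * r `^ (a - 1)))%:E)).
  apply/measurable_EFinP; apply: measurable_funTS; apply: measurable_funM => //.
  exact: measurable_kint.
transitivity (\int[mu]_(r in pos) (\esum_(z in [set: Zd d])
    (heat t z * (heat r (x - z) * r `^ (a - 1)))%:E))%E.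
  apply: eq_integral => r /[!in_pos] r0; rewrite addrC EFinM heat_semigroup// ?(ltW r0)//.
  rewrite muleC -esumZl ?powR_ge0//.
    by apply: eq_esum => z _; rewrite -EFinM; congr EFin; ring.
  by move=> z; rewrite lee_fin mulr_ge0// heat_ge0// ltW.
rewrite integral_esum//; [|exact: measurable_pos|].
- apply: eq_esum => z _; rewrite ge0_integralZlR//.
  + exact: measurable_pos.
  + by apply: measurable_funTS; exact: measurable_kint.
  + by move=> r r0; exact: kint_integrand_ge0.
  + exact: heat_ge0.
- by move=> z r r0; rewrite lee_fin mulr_ge0 ?kint_integrand_ge0// heat_ge0.
Qed.

End HeatOffDiagonal.

(** * The kernel and the equation for sigma < 1 *)

Section FractionalKernel.
Variables (R : realType) (d : nat) (s : R).
Hypotheses (s0 : 0 < s) (s1 : s < 1).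
Implicit Types (t r : R) (x z : Zd d).

Let Gs : R := Gamma_pos (1 - s) / s.

Lemma Gs_gt0 : 0 < Gs.
Proof. by rewrite divr_gt0// Gamma_pos_gt0// subr_gt0. Qed.

Lemma Gamma_Ns : `|Gamma (- s)| = Gs.
Proof.
rewrite /Gamma oppr_gt0 ltNge (ltW s0)/= opprK (@floor_def _ s 0); last by rewrite (ltW s0).
rewrite /= big_ord_recl big_ord0 addr0 mulr1 addrC normrM (gtr0_norm (Gamma_pos_gt0 _)) ?subr_gt0//.
by rewrite normfV normrN gtr0_norm.
Qed.

(** The jump intensity of the walk subordinated by a stable process of index [s], up to the factor
    [|Gamma (- s)|]. *)
Definition jump z : \bar R := (\int[mu]_(t in pos) (t `^ (- s - 1) * offd t z)%:E)%E.

Lemma measurable_jump z : measurable_fun setT (fun t => t `^ (- s - 1) * offd t z).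
Proof. by apply: measurable_funM; [exact: measurable_powR|exact: measurable_offd]. Qed.

Lemma jump_ge0 z : (0 <= jump z)%E.
Proof.
by apply: integral_ge0 => t t0; rewrite lee_fin mulr_ge0 ?powR_ge0// offd_ge0// ltW.
Qed.

(** At 0 the loss is at most [2 d t], which leaves the integrable power [t^(-s)]; this is where
    [s < 1] enters. *)
Lemma diag_loss_fin :
  (\int[mu]_(t in pos) (t `^ (- s - 1) * (1 - heat t (0 : Zd d)))%:E)%E \is a fin_num.
Proof.
have h0 t : 0 < t -> 0 <= 1 - heat t (0 : Zd d).
  by move=> t0; rewrite subr_ge0 heat_le1// ltW.
rewrite ge0_fin_numE; last first.
  by apply: integral_ge0 => t t0; rewrite lee_fin mulr_ge0 ?powR_ge0 ?h0.
have s10 : 0 < 1 - s by rewrite subr_gt0.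
apply: le_lt_trans (ltry _).
apply: (@integral_pos_bound R (1 - s) s 1 (2 * d%:R) 1) => //.
- apply: measurable_funM; first exact: measurable_powR.
  by apply: measurable_funB => //; exact: measurable_heat.
- by move=> t t0; rewrite mulr_ge0 ?powR_ge0 ?h0.
- move=> t t0 t1; rewrite (_ : 1 - s - 1 = (- s - 1) + 1); last by ring.
  rewrite -(@powR_mulD R t _ 1 t0) powRr1 ?(ltW t0)// mulrCA ler_wpM2l ?powR_ge0//.
  have := @heat00_ge_linear R d t (ltW t0); lra.
- move=> t t1; have t0 : 0 < t by apply: lt_le_trans t1.
  by rewrite mul1r -[leRHS]mulr1 ler_wpM2l ?powR_ge0// gerBl heat_ge0// ltW.
Qed.

Lemma jump_total :
  (\esum_(z in setT) jump z =
   \int[mu]_(t in pos) (t `^ (- s - 1) * (1 - heat t (0 : Zd d)))%:E)%E.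
Proof.
rewrite -integral_esum.
- apply: eq_integral => t /[!in_pos] t0; rewrite EFinM -offd_mass ?(ltW t0)// -esumZl ?powR_ge0//.
  by move=> z; rewrite lee_fin offd_ge0// ltW.
- exact: measurable_pos.
- by move=> z; apply/measurable_EFinP; apply: measurable_funTS; exact: measurable_jump.
- by move=> z t t0; rewrite lee_fin mulr_ge0 ?powR_ge0// offd_ge0// ltW.
Qed.

Lemma jump_fin z : jump z \is a fin_num.
Proof.
rewrite ge0_fin_numE ?jump_ge0//; apply: (@le_lt_trans _ _ (\esum_(z in setT) jump z)%E).
  by apply: (esum_ge_term (f := jump)); exact: jump_ge0.
rewrite jump_total; have := diag_loss_fin; rewrite fin_numE => /andP[_].
by rewrite ltey.
Qed.

Lemma kappa_jump z : kappa s z = fine (jump z) / Gs.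
Proof.
rewrite /kappa (gt_eqF s0) (lt_eqF s1) s0 s1 /= /jump /offd.
have [_|_] := eqVneq z 0.
  rewrite (_ : (\int[mu]_(t in pos) _)%E = 0%E) ?mul0r//.
  by apply: integral0_eq => t _; rewrite mulr0.
rewrite Gamma_Ns; apply: (congr1 (fun I => fine I / Gs)); apply: eq_integral => t _.
by rewrite mulrC (_ : -1 - s = - s - 1)//; ring.
Qed.

Lemma kappa_frac_ge0 z : 0 <= kappa s z.
Proof. by rewrite kappa_jump divr_ge0 ?(ltW Gs_gt0)// fine_ge0// jump_ge0. Qed.

Lemma kappa_frac_gt0 z : z != 0 -> 0 < kappa s z.
Proof.
move=> z0; rewrite kappa_jump divr_gt0 ?Gs_gt0// fine_gt0//.
have := jump_fin z; rewrite ge0_fin_numE ?jump_ge0// => ->; rewrite andbT.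
apply: integral_pos_gt0; first exact: measurable_jump.
by move=> t t0; rewrite mulr_gt0 ?powR_gt0// /offd (negbTE z0) heat_gt0.
Qed.

Lemma kappa_frac_sym z : kappa s (- z) = kappa s z.
Proof.
rewrite !kappa_jump; apply: (congr1 (fun I => fine I / Gs)); apply: eq_integral => t _.
by rewrite /offd oppr_eq0 heat_sym.
Qed.

Let M : R := fine (\int[mu]_(t in pos) (t `^ (- s - 1) * (1 - heat t (0 : Zd d)))%:E)%E.

Lemma kappa_frac_mass : (\esum_(z in [set: Zd d]) (kappa s z)%:E = (M / Gs)%:E)%E.
Proof.
rewrite mulrC EFinM /M fineK ?diag_loss_fin// -jump_total -esumZl ?invr_ge0 ?(ltW Gs_gt0)//.
  by apply: eq_esum => z _; rewrite kappa_jump mulrC EFinM fineK// jump_fin.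
exact: jump_ge0.
Qed.

(** By [kint_shift], the time integral of the shifted kernel is the convolution of [heat t] with
    [kint a]. Its term at the origin, subtracted from the unshifted integral, is the loss; the other
    terms are the gain, and integrating them against [t^(-s-1)] rebuilds [kappa s]. *)
Lemma kappa_frac_identity a x : s < a -> a < d%:R / 2 ->
  ((M / Gs * riesz a x)%:E = (riesz (a - s) x)%:E +
    \esum_(y in setT) (kappa s (x - y) * riesz a y)%:E)%E.
Proof.
move=> sa ad; have a0 : 0 < a by exact: lt_trans sa.
have as0 : 0 < a - s by rewrite subr_gt0.
have asd : a - s < d%:R / 2 by apply: lt_trans ad; rewrite ltrBlDr ltrDl.
pose P (y : Zd d) : R := fine (kint a y).
have PE y : kint a y = (P y)%:E by rewrite /P fineK// kint_fin_num.
have P0 y : 0 <= P y by rewrite fine_ge0// kint_ge0.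
have P'E : kint (a - s) x = (fine (kint (a - s) x))%:E by rewrite fineK// kint_fin_num.
have [K hK] := kint_bounded a0 ad.
pose T t := (\esum_(z in setT) (offd t z * P (x - z))%:E)%E.
have shift t : 0 < t -> (\int[mu]_(r in pos) (heat (t + r) x * r `^ (a - 1))%:E =
    (heat t (0 : Zd d) * P x)%:E + T t)%E.
  move=> t0; rewrite kint_shift ?(ltW t0)//.
  have := @esum_offd R d t (fun z => P (x - z)) (ltW t0) (fun z => P0 _); rewrite subr0 => <-.
  by apply: eq_esum => z _; rewrite PE.
have T0 t : 0 < t -> (0 <= T t)%E.
  by move=> t0; apply: esum_ge0 => z _; rewrite lee_fin mulr_ge0// offd_ge0// ltW.
have mT : measurable_fun (pos : set R) T.
  apply: measurable_esum; first exact: measurable_pos.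
  - move=> z; apply/measurable_EFinP; apply: measurable_funTS.
    by apply: measurable_funM => //; exact: measurable_offd.
  - by move=> z t t0; rewrite lee_fin mulr_ge0// offd_ge0// ltW.
have Tfin t : 0 < t -> T t \is a fin_num.
  move=> t0; rewrite ge0_fin_numE ?T0//.
  have K0 : 0 <= K by rewrite -lee_fin; apply: le_trans (hK 0); exact: kint_ge0.
  apply: (@le_lt_trans _ _ (\esum_(z in [set: Zd d]) (K%:E * (offd t z)%:E))%E).
    apply: le_esum => z _; rewrite -EFinM lee_fin mulrC ler_wpM2r ?offd_ge0 ?(ltW t0)//.
    by rewrite -lee_fin -PE.
  rewrite esumZl//; last by move=> z; rewrite lee_fin offd_ge0// ltW.
  by rewrite offd_mass ?(ltW t0)// -EFinM ltry.
have h1 t : 0 < t -> 0 <= 1 - heat t (0 : Zd d).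
  by move=> t0; rewrite subr_ge0 heat_le1// ltW.
have := @fractional_identity R a s s0 s1 sa (fun r => heat r x)
   (fun t => ((1 - heat t (0 : Zd d)) * P x)%:E) T (P x) (fine (kint (a - s) x)) (measurable_heat x).
have q0 r : 0 < r -> 0 <= heat r x by move=> r0; rewrite heat_ge0// ltW.
have D0 t : 0 < t -> (0 <= ((1 - heat t (0 : Zd d)) * P x)%:E)%E.
  by move=> t0; rewrite lee_fin mulr_ge0// h1.
move=> /(_ q0).
have mh : measurable_fun setT (fun t : R => (1 - heat t (0 : Zd d)) * P x).
  by apply: measurable_funM => //; apply: measurable_funB => //; exact: measurable_heat.
have mD : measurable_fun (pos : set R) (fun t : R => ((1 - heat t (0 : Zd d)) * P x)%:E).
  by apply/measurable_EFinP; exact: measurable_funTS.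
move=> /(_ mD D0 mT T0 (PE x) P'E).
have Sf t : 0 < t -> (\int[mu]_(r in pos) (heat (t + r) x * r `^ (a - 1))%:E)%E \is a fin_num.
  by move=> t0; rewrite shift// fin_numD Tfin.
move=> /(_ Sf).
have bal t : 0 < t -> (((1 - heat t (0 : Zd d)) * P x)%:E +
    \int[mu]_(r in pos) (heat (t + r) x * r `^ (a - 1))%:E = (P x)%:E + T t)%E.
  by move=> t0; rewrite shift// addeA -EFinD; congr (_%:E + _)%E; ring.
move=> /(_ bal).
have -> : (\int[mu]_(t in pos) ((t `^ (- s - 1))%:E * ((1 - heat t (0 : Zd d)) * P x)%:E) =
    (M * P x)%:E)%E.
  rewrite mulrC EFinM /M (fineK diag_loss_fin) -ge0_integralZlR//.
  - by apply: eq_integral => t _; rewrite -EFinM; congr EFin; ring.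
  - exact: measurable_pos.
  - apply: measurable_funTS; apply: measurable_funM; first exact: measurable_powR.
    by apply: measurable_funB => //; exact: measurable_heat.
  - by move=> t t0; rewrite mulr_ge0 ?powR_ge0 ?h1.
have G1 := Gamma_pos_gt0 a0; have G2 := Gamma_pos_gt0 as0; have G3 := Gs_gt0.
have -> : (\int[mu]_(t in pos) ((t `^ (- s - 1))%:E * T t) = (Gs * Gamma_pos a)%:E *
    \esum_(y in setT) (kappa s (x - y) * riesz a y)%:E)%E.
  have GG := ltW (mulr_gt0 G3 G1).
  rewrite -(esum_reflect _ x) -(esumZl GG); last first.
    by move=> z; rewrite lee_fin mulr_ge0 ?kappa_frac_ge0 ?riesz_ge0.
  transitivity (\int[mu]_(t in pos) (\esum_(z in [set: Zd d]) (t `^ (- s - 1) * offd t z * P (x - z))%:E))%E.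
    apply: eq_integral => t /[!in_pos] t0; rewrite -esumZl ?powR_ge0//.
      by apply: eq_esum => z _; rewrite -EFinM mulrA.
    by move=> z; rewrite lee_fin mulr_ge0// offd_ge0// ltW.
  rewrite integral_esum.
  - apply: eq_esum => z _; rewrite subKr kappa_jump /riesz -/(P _) -EFinM.
    rewrite [RHS](_ : _ = (P (x - z))%:E * (fine (jump z))%:E)%E; last first.
      by rewrite -EFinM; congr EFin; field; rewrite (gt_eqF G1) (gt_eqF G3).
    rewrite (fineK (jump_fin z)) -ge0_integralZlR//.
    + by apply: eq_integral => t _; rewrite mulrC.
    + exact: measurable_pos.
    + by apply: measurable_funTS; exact: measurable_jump.
    + by move=> t t0; rewrite mulr_ge0 ?powR_ge0// offd_ge0// ltW.
  - exact: measurable_pos.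
  - move=> z; apply/measurable_EFinP; apply: measurable_funTS.
    by apply: measurable_funM => //; exact: measurable_jump.
  - by move=> z t t0; rewrite lee_fin mulr_ge0// mulr_ge0 ?powR_ge0// offd_ge0// ltW.
have S0 : (0 <= \esum_(y in setT) (kappa s (x - y) * riesz a y)%:E)%E.
  by apply: esum_ge0 => y _; rewrite lee_fin mulr_ge0 ?kappa_frac_ge0 ?riesz_ge0.
exact: (fractional_rescale G1 G2 G3 S0).
Qed.

End FractionalKernel.

(** * The kernel and the equation for sigma = 1 *)

Section NearestNeighbour.
Variables (R : realType) (d : nat).
Implicit Types (t r : R) (x z : Zd d).

Definition nbr z : R := \sum_(i < d) ((z == unitv i)%:R + (z == - unitv i)%:R).

Lemma unitv_entry (i j : 'I_d) : unitv i 0 j = (j == i)%:R.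
Proof. by rewrite /unitv mxE eqxx. Qed.

Lemma oppv_entry z (j : 'I_d) : (- z) 0 j = - z 0 j.
Proof. by rewrite mxE. Qed.

Lemma unitv_inj : injective (@unitv d).
Proof.
move=> i j /(congr1 (fun z : Zd d => z 0 i)); rewrite !unitv_entry eqxx.
by case: eqP.
Qed.

Lemma unitv_neqN (i j : 'I_d) : unitv i != - unitv j.
Proof.
apply/eqP => /(congr1 (fun z : Zd d => z 0 i)); rewrite oppv_entry !unitv_entry eqxx.
by case: eqP.
Qed.

Lemma nbrN z : nbr (- z) = nbr z.
Proof.
by apply: eq_bigr => i _; rewrite addrC eqr_opp eqr_oppLR.
Qed.

Lemma nbr_unitv i : nbr (unitv i) = 1.
Proof.
rewrite /nbr (bigD1 i)//= eqxx (negbTE (unitv_neqN i i)) addr0 big1 ?addr0// => j ji.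
rewrite (negbTE (unitv_neqN i j)) addr0 (inj_eq unitv_inj) eq_sym.
by rewrite (negbTE ji).
Qed.

Lemma sqr_unitv (i : 'I_d) : \sum_(j < d) (unitv i 0 j) ^+ 2 = 1.
Proof.
rewrite (bigD1 i)//= unitv_entry eqxx expr1n big1 ?addr0// => j ji.
by rewrite unitv_entry (negbTE ji).
Qed.

(** A nonzero integer coordinate has square at least 1 and so exhausts the sum. *)
Lemma sqr_sum1 z : \sum_(i < d) (z 0 i) ^+ 2 = 1 -> exists i, z = unitv i \/ z = - unitv i.
Proof.
move=> z1.
have [i zi] : exists i, z 0 i != 0.
  apply/existsP; apply: contraTT isT => /existsPn h.
  move: z1; rewrite big1 => [/eqP|i _]; first by rewrite eq_sym oner_eq0.
  by have /negPn/eqP -> := h i; rewrite expr0n.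
have s0 : 0 <= \sum_(j < d | j != i) (z 0 j) ^+ 2 by apply: sumr_ge0 => j _; exact: sqr_ge0.
rewrite (bigD1 i)//= in z1.
have zi1 : 1 <= z 0 i ^+ 2 by rewrite -gtz0_ge1 exprn_even_gt0.
have zi2 : z 0 i ^+ 2 = 1 by apply/eqP; rewrite eq_le zi1 andbT -z1 lerDl.
have r0 : \sum_(j < d | j != i) (z 0 j) ^+ 2 = 0.
  by apply: (addrI (z 0 i ^+ 2)); rewrite z1 zi2 addr0.
have zj j : j != i -> z 0 j = 0.
  move=> ji; apply/eqP; rewrite -sqrf_eq0; apply/eqP.
  by apply: (psumr_eq0P _ r0) => // k _; exact: sqr_ge0.
exists i; move/eqP: zi2; rewrite sqrf_eq1 => /orP[]/eqP e; [left|right];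
  apply/rowP => j; rewrite ?oppv_entry unitv_entry;
  by have [->|ji] := eqVneq j i; rewrite ?e ?zj ?oppr0.
Qed.

Lemma kappa1E z : kappa 1 z = nbr z.
Proof.
rewrite /kappa oner_eq0 eqxx; case: eqP => [/sqr_sum1[i [->|->]]|h].
- by rewrite nbr_unitv.
- by rewrite nbrN nbr_unitv.
- rewrite /nbr big1// => i _.
  rewrite (_ : (z == unitv i) = false) 1?(_ : (z == - unitv i) = false) ?addr0//.
    apply/eqP => e; apply: h; rewrite e -[RHS](sqr_unitv i); apply: eq_bigr => j _.
    by rewrite oppv_entry sqrrN.
  by apply/eqP => e; apply: h; rewrite e sqr_unitv.
Qed.

Lemma esum_nbr (g : Zd d -> R) : (forall z, 0 <= g z) ->
  (\esum_(z in setT) (nbr z * g z)%:E = (\sum_(i < d) (g (unitv i) + g (- unitv i)))%:E)%E.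
Proof.
move=> g0.
have pt a : (\esum_(z in [set: Zd d]) ((z == a)%:R * g z)%:E = (g a)%:E)%E.
  transitivity ((a == a)%:R * g a)%:E; last by rewrite eqxx mul1r.
  apply: (@esum_single R (Zd d) (fun z => ((z == a)%:R * g z)%:E) a) => z.
    by rewrite lee_fin mulr_ge0.
  by move=> /negbTE ->; rewrite mul0r.
transitivity (\esum_(z in [set: Zd d]) \sum_(i < d)
    (((z == unitv i)%:R * g z)%:E + ((z == - unitv i)%:R * g z)%:E))%E.
  apply: eq_esum => z _; rewrite /nbr mulr_suml -sumEFin; apply: eq_bigr => i _.
  by rewrite mulrDl EFinD.
rewrite esum_sum; last by move=> z i _ _; rewrite adde_ge0// lee_fin mulr_ge0.
rewrite -sumEFin; apply: eq_bigr => i _; rewrite esumD ?pt//.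
- by move=> z _; rewrite lee_fin mulr_ge0.
- by move=> z _; rewrite lee_fin mulr_ge0.
Qed.

Definition nbsum (g : Zd d -> R) x : R := \sum_(i < d) (g (x + unitv i) + g (x - unitv i)).

Lemma esum_kappa1 (g : Zd d -> R) x : (forall z, 0 <= g z) ->
  (\esum_(y in setT) (kappa 1 (x - y) * g y)%:E = (nbsum g x)%:E)%E.
Proof.
move=> g0; rewrite -(esum_reflect _ x).
transitivity (\esum_(z in setT) (nbr z * g (x - z))%:E)%E.
  by apply: eq_esum => z _; rewrite subKr kappa1E.
rewrite (esum_nbr (g := fun z => g (x - z)))//; congr EFin; apply: eq_bigr => i _.
by rewrite opprK addrC.
Qed.

Lemma kappa1_mass : (\esum_(z in [set: Zd d]) (kappa 1 z)%:E = (2 * d%:R : R)%:E)%E.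
Proof.
transitivity (\esum_(z in [set: Zd d]) (nbr z * 1)%:E)%E.
  by apply: eq_esum => z _; rewrite kappa1E mulr1.
rewrite (esum_nbr (g := fun=> 1))//; congr EFin.
by rewrite sumr_const card_ord mulr_natr.
Qed.

Lemma nnop_nbsum (g : Zd d -> R) x : nnop (-2) 1 g x = nbsum g x - 2 * d%:R * g x.
Proof.
rewrite nnopE /nbsum big_split /= sumr_const card_ord -mulr_natr addrC; congr (_ + _).
  by apply: eq_bigr => i _; rewrite mul1r.
ring.
Qed.

Hypothesis d2 : 1 < d%:R / 2 :> R.

Let b : R := d%:R / 2 - 1.
Let b0 : 0 < b. Proof. by rewrite subr_gt0. Qed.

Lemma heat_decay_all : exists2 K : R, 0 < K & forall t x, 0 < t -> heat t x <= K * t `^ (- b - 1).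
Proof.
have [C C0 h] := @heat_decay R d; exists (C + 1); first by rewrite addr_gt0.
move=> t x t0; rewrite (_ : - b - 1 = - (d%:R / 2)); last by rewrite /b; ring.
have p0 := powR_ge0 t (- (d%:R / 2)).
have [t1|t1] := leP 1 t.
  by apply: le_trans (h t x t1) _; rewrite mulrDl lerDl mul1r.
apply: le_trans (heat_le1 x (ltW t0)) _; rewrite mulrDl mul1r.
have : 1 <= t `^ (- (d%:R / 2)).
  rewrite -[leLHS](powRr0 t); apply: ger_powR; first by rewrite t0 ltW.
  by rewrite oppr_le0 divr_ge0.
by have := mulr_ge0 (ltW C0) p0; lra.
Qed.

(* [F] is minus the time derivative of [heat t x] plus a power dominating it, so that
   the fundamental theorem for nonnegative integrands on a half-line applies. *)
Lemma heat_tail_identity r x : 0 < r ->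
  ((heat r x)%:E + \int[mu]_(t in `[r, +oo[) (nbsum (heat t) x)%:E =
   (2 * d%:R)%:E * \int[mu]_(t in `[r, +oo[) (heat t x)%:E)%E.
Proof.
move=> r0; have [K K0 hK] := heat_decay_all.
(* Each of the [2 d] neighbours contributes at most [K t^(-b-1)] to the only negative term of
   [F]. *)
pose c := 2 * d%:R * K.
have c0 : 0 <= c by rewrite mulr_ge0// ltW.
pose F t := 2 * d%:R * heat t x - nbsum (heat t) x + c * t `^ (- b - 1).
pose G t := - heat t x + c * (t `^ (- b) / (- b)).
have dG t : 0 < t -> is_derive t 1 G (F t).
  move=> t0.
  have h1 := derN (is_derive_heat t x).
  have h2 := derM (derC c t) (is_derive_powR_div (a := - b) (x := t) _ t0).
  have b1 : - b != 0 by rewrite oppr_eq0 gt_eqF.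
  have h := derD h1 (h2 b1); apply: (is_derive_eq h).
  by rewrite nnop_nbsum /F mul0r add0r; ring.
have nb_ge0 t : 0 < t -> 0 <= nbsum (heat t) x.
  by move=> t0; apply: sumr_ge0 => i _; rewrite addr_ge0// heat_ge0// ltW.
have F0 t : r <= t -> 0 <= F t.
  move=> rt; have t0 : 0 < t by apply: lt_le_trans rt.
  have : nbsum (heat t) x <= c * t `^ (- b - 1).
    apply: (@le_trans _ _ (\sum_(i < d) (2 * (K * t `^ (- b - 1))))).
      by apply: ler_sum => i _; rewrite mulr_natl mulr2n lerD// hK.
    rewrite sumr_const card_ord -mulr_natr /c le_eqVlt; apply/orP; left; apply/eqP; ring.
  have := heat_ge0 x (ltW t0); have := ler0n R (2 * d); rewrite natrM /F => p q h.
  have := mulr_ge0 p q; lra.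
have cnb : continuous (fun t => nbsum (heat t) x).
  move=> t; apply: cvg_sumr => i.
  by apply: cvgD; exact: continuous_heat.
have IF : (\int[mu]_(t in `[r, +oo[) (F t)%:E = (heat r x + c * (r `^ (- b) / b))%:E)%E.
  rewrite (@ge0_continuous_FTC2y _ _ G _ 0)//.
  - rewrite sub0e -EFinN; congr EFin; rewrite /G invrN; ring.
  - apply: continuous_in_subspaceT => t /[!inE]/= /[!in_itv]/= /andP[rt _].
    have t0 := lt_le_trans r0 rt.
    apply: cvgD; last first.
      apply: cvgM; first exact: cvg_cst.
      exact: (is_derive_cts (is_derive1_powR (- b - 1) t0)).
    apply: cvgB; last exact: cnb.
    by apply: cvgM; [exact: cvg_cst|exact: continuous_heat].
  - rewrite -[X in _ --> X](addr0 0); apply: cvgD.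
      rewrite -[X in _ --> X]oppr0; apply: cvgN.
      have b1 : 0 < b + 1 by rewrite addr_gt0.
      apply: (@squeeze_cvgr _ _ _ _ (cst 0) (fun t => K * t `^ (- (b + 1)))).
      + near=> t; have t0 : 0 < t by [].
        by rewrite heat_ge0 ?(ltW t0)//= opprD hK.
      + exact: cvg_cst.
      + by rewrite -[X in _ --> X](mulr0 K); apply: cvgM; [exact: cvg_cst|exact: cvg_powRN_oo].
    rewrite -[X in _ --> X](mulr0 c); apply: cvgM; first exact: cvg_cst.
    rewrite -[X in _ --> X](mul0r (- b)^-1); apply: cvgM; last exact: cvg_cst.
    exact: cvg_powRN_oo.
  - by move=> t rt; have [] := dG t (lt_trans r0 rt).
  - by apply: cvg_at_right_filter; exact: (is_derive_cts (dG r r0)).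
  - move=> t /[!in_itv]/= /andP[rt _].
    by rewrite derive1E; have [_ ->] := dG t (lt_trans r0 rt).
have mitv : measurable (`[r, +oo[%classic : set R) by [].
have mnb : measurable_fun setT (fun t => nbsum (heat t) x) by exact: continuous_measurable_fun.
have mF : measurable_fun setT F.
  apply: measurable_funD; last exact: measurable_powRZ.
  by apply: measurable_funB => //; apply: measurable_funM => //; exact: measurable_heat.
have tpos t : `[r, +oo[%classic t -> 0 < t.
  by rewrite /= in_itv/= andbT; exact: lt_le_trans.
have Ip : (\int[mu]_(t in `[r, +oo[) (c * t `^ (- b - 1))%:E = (c * (r `^ (- b) / b))%:E)%E.
  rewrite ge0_integralZlR//; first by rewrite integral_powR_oo.
  - by apply: measurable_funTS; exact: measurable_powR.
  - by move=> t _; exact: powR_ge0.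
have mE (f : R -> R) : measurable_fun setT f -> measurable_fun (`[r, +oo[%classic : set R) (fun t => (f t)%:E).
  by move=> mf; apply/measurable_EFinP; exact: measurable_funTS.
have e1 : (\int[mu]_(t in `[r, +oo[) (F t)%:E + \int[mu]_(t in `[r, +oo[) (nbsum (heat t) x)%:E =
    (2 * d%:R)%:E * \int[mu]_(t in `[r, +oo[) (heat t x)%:E +
    \int[mu]_(t in `[r, +oo[) (c * t `^ (- b - 1))%:E)%E.
  rewrite -ge0_integralZlR//; last 2 first.
  - by apply: measurable_funTS; exact: measurable_heat.
  - by move=> t /tpos t0; rewrite heat_ge0// ltW.
  rewrite -!ge0_integralD//.
  - by apply: eq_integral => t _; rewrite -!EFinD; congr EFin; rewrite /F; ring.
  - by move=> t /tpos t0; rewrite lee_fin mulr_ge0// heat_ge0// ltW.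
  - by apply: mE; apply: measurable_funM => //; exact: measurable_heat.
  - by move=> t _; rewrite lee_fin mulr_ge0// powR_ge0.
  - by apply: mE; exact: measurable_powRZ.
  - by move=> t; rewrite /= in_itv/= andbT => rt; rewrite lee_fin F0.
  - exact: mE.
  - by move=> t /tpos t0; rewrite lee_fin nb_ge0.
  - exact: mE.
rewrite IF Ip EFinD addeAC in e1.
have := congr1 (fun X => X - (c * (r `^ (- b) / b))%:E)%E e1; by rewrite /= !addeK.
Unshelve. all: by end_near. Qed.

(** [heat_tail_identity] is integrated against [(a - 1) t^(a-2)]. The layer formula turns the tails
    into the integrals with exponent [a], and the pointwise term acquires the factor [a - 1] that
    relates [Gamma_pos a] to [Gamma_pos (a - 1)]. *)
Lemma kappa_one_identity (a : R) x : 1 < a -> a < d%:R / 2 ->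
  ((2 * d%:R * riesz a x)%:E = (riesz (a - 1) x)%:E +
    \esum_(y in setT) (kappa 1 (x - y) * riesz a y)%:E)%E.
Proof.
move=> a1 ad; have a0 : 0 < a by exact: lt_trans a1.
have as0 : 0 < a - 1 by rewrite subr_gt0.
have asd : a - 1 < d%:R / 2 by apply: lt_trans ad; rewrite ltrBlDr ltrDl.
have Ga := Gamma_pos_gt0 as0; have Ga' := Gamma_pos_gt0 a0.
rewrite esum_kappa1; last by move=> z; exact: riesz_ge0.
rewrite -EFinD; congr EFin.
pose P (y : Zd d) : R := fine (kint a y).
have PE y : kint a y = (P y)%:E by rewrite /P fineK// kint_fin_num.
have P'E : kint (a - 1) x = (fine (kint (a - 1) x))%:E by rewrite fineK// kint_fin_num.
have mnb : measurable_fun setT (fun t => nbsum (heat t) x).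
  apply: continuous_measurable_fun => t; apply: cvg_sumr => i.
  by apply: cvgD; exact: continuous_heat.
have nb_ge0 t : 0 < t -> 0 <= nbsum (heat t) x.
  by move=> t0; apply: sumr_ge0 => i _; rewrite addr_ge0// heat_ge0// ltW.
have q0 t : 0 < t -> 0 <= heat t x by move=> t0; rewrite heat_ge0// ltW.
have L1 := @integral_powR_layer R (a - 1) (fun t => heat t x) as0 (measurable_heat x)
  q0.
have L2 := @integral_powR_layer R (a - 1) (fun t => nbsum (heat t) x) as0 mnb nb_ge0.
have E2 : (\int[mu]_(s in pos) (nbsum (heat s) x * s `^ (a - 1))%:E = (nbsum P x)%:E)%E.
  transitivity (\sum_(i < d) (kint a (x + unitv i)%R + kint a (x - unitv i)%R))%E; last first.
    by rewrite -sumEFin; apply: eq_bigr => i _; rewrite !PE.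
  transitivity (\sum_(i < d) \int[mu]_(s in pos)
     ((heat s (x + unitv i) * s `^ (a - 1))%:E + (heat s (x - unitv i) * s `^ (a - 1))%:E))%E; last first.
    apply: eq_bigr => i _; rewrite ge0_integralD//.
    - exact: measurable_pos.
    - by move=> s s0; rewrite lee_fin kint_integrand_ge0.
    - by apply/measurable_EFinP; apply: measurable_funTS; exact: measurable_kint.
    - by move=> s s0; rewrite lee_fin kint_integrand_ge0.
    - by apply/measurable_EFinP; apply: measurable_funTS; exact: measurable_kint.
  rewrite -ge0_integral_sum//.
  - apply: eq_integral => s _; rewrite /nbsum mulr_suml -sumEFin; apply: eq_bigr => i _.
    by rewrite mulrDl EFinD.
  - exact: measurable_pos.
  - by move=> i; apply: emeasurable_funD; apply/measurable_EFinP; apply: measurable_funTS; exact: measurable_kint.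
  - by move=> i s s0; rewrite adde_ge0// lee_fin kint_integrand_ge0.
pose C t := (a - 1) * t `^ (a - 1 - 1).
have C0 t : 0 <= C t by rewrite mulr_ge0 ?powR_ge0// ltW.
have mC : measurable_fun (pos : set R) (fun t => (C t)%:E).
  by apply/measurable_EFinP; apply: measurable_funTS; exact: measurable_powRZ.
have tail_ge0 (g : R -> R) t : (forall s, 0 < s -> 0 <= g s) -> 0 < t ->
    (0 <= \int[mu]_(s in `[t, +oo[) (g s)%:E)%E.
  move=> g0 t0; apply: integral_ge0 => s; rewrite /= in_itv/= andbT => ts.
  by rewrite lee_fin g0// (lt_le_trans t0).
have key : ((a - 1)%:E * kint (a - 1) x + (nbsum P x)%:E = (2 * d%:R)%:E * kint a x)%E.
  rewrite -E2 -L2 /kint -L1 -ge0_integralZlR//; last 4 first.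
  - exact: measurable_pos.
  - by apply: measurable_funTS; exact: measurable_kint.
  - by move=> s s0; exact: kint_integrand_ge0.
  - exact: ltW.
  rewrite -ge0_integralD//; last 5 first.
  - exact: measurable_pos.
  - by move=> t t0; rewrite lee_fin mulr_ge0 ?(ltW as0)// kint_integrand_ge0.
  - apply/measurable_EFinP; apply: measurable_funTS; apply: measurable_funM => //.
    exact: measurable_kint.
  - by move=> t t0; rewrite mule_ge0 ?lee_fin ?C0// tail_ge0.
  - by apply: emeasurable_funM => //; exact: measurable_tail.
  rewrite -ge0_integralZl; last 4 first.
  - exact: measurable_pos.
  - by apply: emeasurable_funM => //; apply: measurable_tail => //; exact: measurable_heat.
  - by move=> t t0; rewrite mule_ge0 ?lee_fin ?C0// tail_ge0.
  - by rewrite lee_fin mulr_ge0.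
  apply: eq_integral => t /[!in_pos] t0; rewrite muleCA -heat_tail_identity// [RHS]ge0_muleDr.
  - by rewrite -EFinM; congr (_%:E + _)%E; rewrite /C; ring.
  - by rewrite lee_fin q0.
  - exact: tail_ge0.
rewrite P'E PE -!EFinM -EFinD in key; case: key => key.
have EG := Gamma_posS as0; rewrite subrK in EG.
have -> : nbsum (riesz a) x = nbsum P x / Gamma_pos a.
  by rewrite /nbsum mulr_suml; apply: eq_bigr => i _; rewrite /riesz mulrDl.
rewrite /riesz -/(P x) mulrA -key EG mulrDl; congr (_ + _).
move: (Gamma_pos (a - 1)) (fine _) Ga as0 => g p g0 h; field.
by rewrite (gt_eqF g0) (gt_eqF h).
Qed.

End NearestNeighbour.

(** * Levels, divergence and the quotient expansion *)

Section LatticeBox.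
Variables (R : realType) (d : nat).
Implicit Types (x z : Zd d) (N : nat).

Definition box_seq N : seq (Zd d) :=
  [seq (\row_i ((m 0 i : nat)%:Z - N%:Z) : Zd d) | m : 'rV['I_(2 * N).+1]_d <- enum {: 'rV['I_(2 * N).+1]_d}].

Lemma size_box N : size (box_seq N) = ((2 * N).+1 ^ d)%N.
Proof. by rewrite size_map -cardE card_mx card_ord mul1n. Qed.

Lemma mem_box N x : (forall i, (absz (x 0%R i) <= N)%N) -> x \in box_seq N.
Proof.
move=> h; apply/mapP.
exists (\row_i inord (absz (x 0 i + N%:Z))); first by rewrite mem_enum.
have key (k : int) : (absz k <= N)%N -> k = (absz (k + N%:Z)%R)%:Z - N%:Z by lia.
apply/rowP => i; rewrite !mxE inordK; last by have := h i; lia.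
exact: key.
Qed.

Lemma coord_le_enorm x i : (absz (x 0 i))%:R <= enorm R x.
Proof.
rewrite -(@ler_pXn2r _ 2)// ?nnegrE ?enorm_ge0// enorm_sqr (bigD1 i)//=.
rewrite (_ : (absz (x 0 i))%:R ^+ 2 = ((x 0 i)%:~R : R) ^+ 2).
  by rewrite lerDl sumr_ge0// => j _; exact: sqr_ge0.
by rewrite -[RHS]real_normK ?num_real// -intr_norm -abszE pmulrn.
Qed.

Lemma ball_box (r : R) x : enorm R x <= r -> x \in box_seq (Num.truncn r).
Proof.
move=> xr; apply: mem_box => i; rewrite -ltnS -(ltr_nat R).
by apply: le_lt_trans (truncnS_gt _); apply: le_trans xr; exact: coord_le_enorm.
Qed.

Lemma enorm0 : enorm R (0 : Zd d) = 0.
Proof.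
rewrite /enorm big1 ?sqrtr0// => i _; by rewrite mxE mulr0z expr0n.
Qed.

Lemma enorm_ge1 x : x != 0 -> 1 <= enorm R x.
Proof.
move=> x0; have [i xi] : exists i, x 0 i != 0.
  apply/existsP; apply: contraNT x0; rewrite negb_exists => /forallP h.
  by apply/eqP/rowP => i; rewrite mxE; apply/eqP; have := h i; rewrite negbK.
apply: le_trans (coord_le_enorm x i); rewrite (ler_nat R 1).
by rewrite lt0n absz_eq0.
Qed.

End LatticeBox.

(** * Level sets of the Riesz kernel and divergence of the product sum *)

Section RieszLevels.
Variables (R : realType) (d : nat).
Implicit Types (x z : Zd d) (a e r t : R).

Lemma kint_upper a : 0 < a -> a < d%:R / 2 -> exists2 K : R, 1 <= K &
  forall x, 1 <= enorm R x -> fine (kint a x) <= K * enorm R x `^ (- (2 * (d%:R / 2 - a))).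
Proof.
move=> a0 ad; have [A A0 h] := @kint_asymp R d; have [C hC] := h a a0 ad.
set c := A * _ in hC.
exists (1 + `|c| + `|C|); first by rewrite -addrA lerDl addr_ge0.
move=> x x1; have := hC x x1; set r := enorm R x in x1 *; set b := 2 * (_ - a).
have r0 : 0 < r by apply: lt_le_trans x1.
rewrite ler_norml => /andP[_ h2].
have p0 := powR_ge0 r (- b).
have h3 : r `^ (- (b + 2)) <= r `^ (- b) by rewrite ler_powR// lerN2 lerDl.
have h4 : C * r `^ (- (b + 2)) <= `|C| * r `^ (- b).
  apply: (@le_trans _ _ (`|C| * r `^ (- (b + 2)))).
    by rewrite ler_wpM2r ?powR_ge0// ler_norm.
  by rewrite ler_wpM2l.
have h5 : c * r `^ (- b) <= `|c| * r `^ (- b) by rewrite ler_wpM2r ?ler_norm.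
rewrite !mulrDl mul1r; lra.
Qed.

Lemma riesz_gt0 a x : 0 < a -> a < d%:R / 2 -> 0 < riesz a x.
Proof.
move=> a0 ad; apply: divr_gt0; last exact: Gamma_pos_gt0.
apply: fine_gt0; have := kint_fin_num x a0 ad; rewrite ge0_fin_numE ?kint_ge0// => ->.
rewrite andbT; apply: integral_pos_gt0; first exact: measurable_kint.
by move=> t t0; rewrite mulr_gt0 ?powR_gt0 ?heat_gt0.
Qed.

(** Inverts the power decay. [K >= 1] makes the radius at least 1 for [e <= 1], as the ball estimate
    [sum_kint_ball] requires. *)
Lemma riesz_level a : 0 < a -> a < d%:R / 2 -> exists2 K : R, 1 <= K &
  forall e x, 0 < e -> e < riesz a x ->
    enorm R x <= (K / e) `^ (2 * (d%:R / 2 - a))^-1.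
Proof.
move=> a0 ad; have [K K1 hK] := kint_upper a0 ad.
have G0 := Gamma_pos_gt0 a0.
exists (1 + K / Gamma_pos a); first by rewrite lerDl divr_ge0 ?(ltW G0)//; lra.
move=> e x e0 ex; have [->|x0] := eqVneq x 0; first by rewrite enorm0 powR_ge0.
have r1 := enorm_ge1 R x0; set r := enorm R x in r1 *; set b := 2 * (_ - a).
have b0 : 0 < b by rewrite mulr_gt0// subr_gt0.
have r0 : 0 < r by apply: lt_le_trans r1.
have rE : r = (r `^ b) `^ b^-1 by rewrite -powRrM divff ?gt_eqF// powRr1// ltW.
rewrite [leLHS]rE.
have h : e * r `^ b <= 1 + K / Gamma_pos a.
  apply: (@le_trans _ _ (riesz a x * r `^ b)).
    by rewrite ler_wpM2r ?powR_ge0// ltW.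
  rewrite /riesz mulrAC; apply: (@le_trans _ _ (K / Gamma_pos a)); last by lra.
  rewrite ler_pM2r ?invr_gt0//.
  apply: (@le_trans _ _ (K * r `^ (- b) * r `^ b)).
    by rewrite ler_wpM2r ?powR_ge0// hK.
  by rewrite -mulrA powR_mulD// addNr powRr0 mulr1.
apply: ge0_ler_powR; rewrite ?nnegrE ?powR_ge0 ?invr_ge0 ?(ltW b0)//.
  by rewrite divr_ge0 ?(ltW e0)// addr_ge0// divr_ge0 ?(ltW G0)//; lra.
by rewrite ler_pdivlMr// mulrC.
Qed.

Lemma riesz_level_finite a e : 0 < a -> a < d%:R / 2 -> 0 < e ->
  finite_set [set x : Zd d | e < riesz a x].
Proof.
move=> a0 ad e0; have [K _ hK] := riesz_level a0 ad.
apply: (@sub_finite_set _ _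
  [set` box_seq d (Num.truncn ((K / e) `^ (2 * (d%:R / 2 - a))^-1))]); last exact: finite_seq.
by move=> x /= /(hK _ _ e0); exact: ball_box.
Qed.

(* The total heat of a set of [n] points is at most [1] and at most
   [n * C * t^(-d/2)]; the two bounds cross at [t = rho^2] when [n] is of
   order [rho^d]. *)
Lemma sum_kint_ball a : 0 < a -> a < d%:R / 2 -> exists2 C : R, 0 < C &
  forall (rho : R) (s : seq (Zd d)), 1 <= rho -> uniq s ->
  (forall x, x \in s -> enorm R x <= rho) ->
  \sum_(x <- s) fine (kint a x) <= C * rho `^ (2 * a).
Proof.
move=> a0 ad; have [C C0 hC] := @heat_decay R d.
pose b := d%:R / 2 - a; have b0 : 0 < b by rewrite subr_gt0.
exists (1 / a + C * 3 ^+ d / b).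
  by rewrite addr_gt0 ?divr_gt0// mulr_gt0// exprn_gt0.
move=> rho s rho1 us hs.
have rho0 : 0 < rho by apply: lt_le_trans rho1.
pose F t := \sum_(x <- s) heat t x.
have F0 t : 0 < t -> 0 <= F t by move=> t0; apply: sumr_ge0 => x _; rewrite heat_ge0// ltW.
have F1 t : 0 < t -> F t <= 1.
  move=> t0; rewrite -lee_fin -(@heat_mass R d t (ltW t0)).
  by apply: esum_ge_seq => // x; rewrite heat_ge0// ltW.
have ns : (size s)%:R <= 3 ^+ d * rho ^+ d :> R.
  apply: (@le_trans _ _ ((size (box_seq d (Num.truncn rho)))%:R)).
    by rewrite ler_nat; apply: uniq_leq_size => // x /hs; exact: ball_box.
  rewrite size_box natrX -exprMn; apply: lerXn2r; rewrite ?nnegrE ?mulr_ge0 ?ler0n ?(ltW rho0)//.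
  rewrite -natr1 natrM; have : (Num.truncn rho)%:R <= rho by rewrite truncn_le ltW.
  lra.
have F2 t : 1 <= t -> F t <= (size s)%:R * (C * t `^ (- (d%:R / 2))).
  move=> t1; rewrite /F mulr_natl.
  apply: (@le_trans _ _ (\sum_(x <- s) (C * t `^ (- (d%:R / 2))))).
    by apply: ler_sum => x _; exact: hC.
  by rewrite big_const_seq count_predT iter_addr_0.
have mF : measurable_fun setT (fun t => F t * t `^ (a - 1)).
  apply: measurable_funM; last exact: measurable_powR.
  by apply: measurable_sum => x; exact: measurable_heat.
rewrite -lee_fin.
have -> : (\sum_(x <- s) fine (kint a x))%:E = (\int[mu]_(t in pos) (F t * t `^ (a - 1))%:E)%E.
  rewrite -sumEFin; transitivity (\sum_(x <- s) kint a x)%E.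
    by apply: eq_bigr => x _; rewrite fineK// kint_fin_num.
  rewrite /kint -ge0_integral_sum//.
  - by apply: eq_integral => t _; rewrite sumEFin mulr_suml.
  - exact: measurable_pos.
  - by move=> x; apply/measurable_EFinP; apply: measurable_funTS; exact: measurable_kint.
  - by move=> x t t0; rewrite lee_fin kint_integrand_ge0.
have c0 : 0 < rho ^+ 2 by rewrite exprn_gt0.
have C2 : 0 <= C * 3 ^+ d * rho ^+ d.
  by rewrite !mulr_ge0 ?exprn_ge0 ?(ltW C0) ?(ltW rho0).
apply: (le_trans (integral_pos_bound a0 b0 c0 ler01 C2 mF _ _ _)).
- by move=> t t0; rewrite mulr_ge0 ?powR_ge0 ?F0.
- by move=> t t0 _; rewrite ler_wpM2r ?powR_ge0 ?F1.
- move=> t ct; have t1 : 1 <= t by apply: le_trans ct; rewrite exprn_ege1.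
  have t0 : 0 < t by apply: lt_le_trans t1.
  apply: (@le_trans _ _ ((size s)%:R * (C * t `^ (- (d%:R / 2))) * t `^ (a - 1))).
    by rewrite ler_wpM2r ?powR_ge0 ?F2.
  rewrite -!mulrA powR_mulD// (_ : - (d%:R / 2) + (a - 1) = - b - 1); last by rewrite /b; ring.
  rewrite [leRHS](_ : _ = 3 ^+ d * rho ^+ d * (C * t `^ (- b - 1))); last by ring.
  by rewrite ler_wpM2r// mulr_ge0 ?powR_ge0 ?(ltW C0).
have sqp c : (rho ^+ 2) `^ c = rho `^ (2 * c).
  by rewrite -powR_mulrn ?(ltW rho0)// -powRrM.
rewrite lee_fin !sqp [leRHS]mulrDl; apply: lerD; first by rewrite !mul1r mulrC.
rewrite le_eqVlt; apply/orP; left; apply/eqP.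
rewrite [LHS](_ : _ = C * 3 ^+ d / b * (rho ^+ d * rho `^ (2 * - b))); last by ring.
rewrite -(powR_mulrn d (ltW rho0)) powR_mulD//; congr (_ * _ `^ _).
by rewrite /b; field.
Qed.

(** The level set lies in a ball of radius [(K / e)^(1 / (2 a'))], because [d / 2 - a = a']. The sum
    over that ball is at most a constant times the radius to the power [2 a'], that is a multiple of
    [1 / e], and [e] cancels exactly. *)
Lemma riesz_level_bound a a' : 0 < a -> a < d%:R / 2 -> 0 < a' -> a' < d%:R / 2 ->
  a + a' = d%:R / 2 ->
  exists C : R, forall e (s : seq (Zd d)), 0 < e -> e <= 1 -> uniq s ->
    (forall x, x \in s -> e < riesz a x) -> e * \sum_(x <- s) riesz a' x <= C.
Proof.
move=> a0 ad a'0 a'd aa'; have [K K1 hK] := riesz_level a0 ad.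
have [C C0 hC] := sum_kint_ball a'0 a'd.
have G0 := Gamma_pos_gt0 a'0.
exists (C * K / Gamma_pos a') => e s e0 e1 us hs.
have b : d%:R / 2 - a = a' by rewrite -aa' addrC addKr.
have Ke : 1 <= K / e by rewrite ler_pdivlMr// mul1r (le_trans e1).
have K0 : 0 < K by apply: lt_le_trans K1.
have Ke0 : 0 <= K / e by rewrite divr_ge0// ltW.
pose rho := (K / e) `^ (2 * a')^-1.
have rho1 : 1 <= rho.
  by rewrite -(powRr0 (K / e)); apply: ler_powR => //; rewrite invr_ge0 mulr_ge0// ltW.
have h := hC rho s rho1 us; rewrite /rho -powRrM mulVf ?powRr1// in h; last first.
  by rewrite mulf_neq0// gt_eqF.
rewrite (_ : \sum_(x <- s) riesz a' x = (\sum_(x <- s) fine (kint a' x)) / Gamma_pos a'); last first.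
  by rewrite mulr_suml.
rewrite mulrA ler_pM2r ?invr_gt0//.
have /h h' : forall x, x \in s -> enorm R x <= (K / e) `^ (2 * a')^-1.
  by move=> x xs; rewrite -b; apply: hK => //; exact: hs.
apply: (@le_trans _ _ (e * (C * (K / e)))); first by rewrite ler_wpM2l ?(ltW e0).
by rewrite le_eqVlt; apply/orP; left; apply/eqP; field; rewrite gt_eqF.
Qed.

Lemma heat_diag_lower : exists2 c : R, 0 < c &
  forall t, 1 <= t -> c * t `^ (- (d%:R / 2)) <= heat t (0 : Zd d).
Proof.
have [A A0 h] := @heat1_0_asymp R.
exists ((A * expR (-1)) ^+ d); first by rewrite exprn_gt0// mulr_gt0 ?expR_gt0.
move=> t t1; have t0 : 0 < t by apply: lt_le_trans t1.
rewrite heat_prod ?(ltW t0)// (eq_bigr (fun=> heat1 t 0)); last by move=> i _; rewrite mxE.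
rewrite prodr_const card_ord -sqrt_powR// -exprVn -exprMn.
have s0 : 0 < Num.sqrt t by rewrite sqrtr_gt0.
apply: lerXn2r; rewrite ?nnegrE ?mulr_ge0 ?expR_ge0 ?invr_ge0 ?(ltW A0) ?(ltW s0)//.
  by rewrite ltW// heat1_gt0.
rewrite ler_pdivrMr// [leRHS]mulrC; have [h1 _] := h t t1; apply: le_trans h1.
by rewrite ler_wpM2l ?(ltW A0)// ler_expR lerN2 invf_le1.
Qed.

(* By the semigroup property the sum is a double integral of
   [heat (t + r) 0 * t^(a-1) * r^(a'-1)]; integrating over [r <= t] leaves at least
   a multiple of [1/t]. *)
Lemma riesz_product_diverges a a' : 0 < a -> a < d%:R / 2 -> 0 < a' -> a' < d%:R / 2 ->
  a + a' = d%:R / 2 ->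
  (\esum_(x in [set: Zd d]) (riesz a' x * riesz a x)%:E = +oo)%E.
Proof.
move=> a0 ad a'0 a'd aa'.
have [g [gE g0]] : exists g, Gamma_pos a = g /\ 0 < g.
  by exists (Gamma_pos a); split=> //; exact: Gamma_pos_gt0.
have [g' [g'E g'0]] : exists g, Gamma_pos a' = g /\ 0 < g.
  by exists (Gamma_pos a'); split=> //; exact: Gamma_pos_gt0.
have [c c0 hc] := heat_diag_lower.
(* Written as a convolution at the origin, so that [kint_shift] applies; the reflection is undone by
   the symmetry of the heat kernel. *)
pose Z : \bar R := (\esum_(x in [set: Zd d]) (kint a x * kint a' (0 - x)%R))%E.
have kE (b : R) (x : Zd d) : 0 < b -> b < d%:R / 2 -> kint b x = (Gamma_pos b * riesz b x)%:E.
  move=> b0 bd; rewrite /riesz mulrC divfK ?gt_eqF ?Gamma_pos_gt0// fineK//.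
  exact: kint_fin_num.
have ksym x : kint a' (0 - x) = kint a' x.
  by rewrite sub0r; apply: eq_integral => t _; rewrite heat_sym.
have ZE : Z = ((g * g')%:E *
    \esum_(x in [set: Zd d]) (riesz a' x * riesz a x)%:E)%E.
  rewrite -esumZl.
  - by apply: eq_esum => x _; rewrite ksym (kE a x a0 ad) (kE a' x a'0 a'd) gE g'E -!EFinM mulrACA [riesz a x * _]mulrC.
  - by rewrite mulr_ge0 ?(ltW g0) ?(ltW g'0).
  - by move=> x; rewrite lee_fin mulr_ge0 ?riesz_ge0.
clear gE g'E kE.
suff Zoo : Z = +oo%E.
  move: ZE; rewrite Zoo; case: (\esum_(x in _) _)%E => [y||]//.
  by rewrite gt0_muleNy// lte_fin mulr_gt0.
pose T t := (\int[mu]_(r in pos) (heat (t + r) (0 : Zd d) * r `^ (a' - 1))%:E)%E.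
have Zint : Z = (\int[mu]_(t in pos) ((t `^ (a - 1))%:E * T t))%E.
  transitivity (\int[mu]_(t in pos) (\esum_(x in [set: Zd d])
      ((heat t x * t `^ (a - 1))%:E * kint a' (0 - x)%R)))%E.
    rewrite integral_esum.
    - apply: eq_esum => x _; rewrite muleC -ge0_integralZl.
      + by apply: eq_integral => t _; rewrite muleC.
      + exact: measurable_pos.
      + by apply/measurable_EFinP; apply: measurable_funTS; exact: measurable_kint.
      + by move=> t t0; rewrite lee_fin kint_integrand_ge0.
      + exact: kint_ge0.
    - exact: measurable_pos.
    - move=> x; apply: emeasurable_funM; last exact: measurable_cst.
      by apply/measurable_EFinP; apply: measurable_funTS; exact: measurable_kint.
    - by move=> x t t0; rewrite mule_ge0 ?kint_ge0// lee_fin kint_integrand_ge0.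
  apply: eq_integral => t /[!in_pos] t0; rewrite /T kint_shift ?(ltW t0)// -esumZl ?powR_ge0//.
    by apply: eq_esum => x _; rewrite muleA -EFinM mulrC.
  by move=> x; rewrite mule_ge0 ?kint_ge0// lee_fin heat_ge0// ltW.
pose k := c * 2 `^ (- (d%:R / 2)) / a'.
have k0 : 0 < k by rewrite divr_gt0// mulr_gt0// powR_gt0.
have T0 t : 0 < t -> (0 <= T t)%E.
  move=> t0; apply: integral_ge0 => r r0; rewrite lee_fin mulr_ge0 ?powR_ge0// heat_ge0//.
  by rewrite addr_ge0// ltW.
have Tge t : 1 <= t -> ((k * t `^ (a' - d%:R / 2))%:E <= T t)%E.
  move=> t1; have t0 : 0 < t by apply: lt_le_trans t1.
  have mT : measurable_fun setT (fun r => heat (t + r) (0 : Zd d) * r `^ (a' - 1)).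
    apply: measurable_funM; last exact: measurable_powR.
    by apply: (measurableT_comp (measurable_heat (0 : Zd d))); exact: measurable_funD.
  apply: (@le_trans _ _ (\int[mu]_(r in `]0%R, t])
      (c * (2 * t) `^ (- (d%:R / 2)) * r `^ (a' - 1))%:E)%E).
    rewrite ge0_integralZlR//.
    - rewrite integral_powR_0// -EFinM lee_fin powRM ?(ltW t0)// le_eqVlt; apply/orP; left; apply/eqP.
      rewrite -(powR_mulD a' (- (d%:R / 2)) t0) /k; field; rewrite gt_eqF//.
    - by apply: measurable_funTS; exact: measurable_powR.
    - by move=> r _; exact: powR_ge0.
    - by rewrite mulr_ge0 ?powR_ge0 ?(ltW c0).
  apply: (@le_trans _ _ (\int[mu]_(r in `]0%R, t])
      (heat (t + r) (0 : Zd d) * r `^ (a' - 1))%:E)%E).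
    apply: le_integralR => //.
    - by apply: measurable_funTS; exact: measurable_powRZ.
    - exact: measurable_funTS.
    - by move=> r _; rewrite !mulr_ge0 ?powR_ge0 ?(ltW c0).
    - move=> r; rewrite /= in_itv/= => /andP[r0 rt]; rewrite ler_wpM2r ?powR_ge0//.
      have tr1 : 1 <= t + r by lra.
      apply: le_trans (hc _ tr1); rewrite ler_wpM2l ?(ltW c0)// !powRN.
      have tr0 : 0 < t + r by lra.
      have t20 : 0 < 2 * t by lra.
      rewrite lef_pV2 ?posrE ?powR_gt0//; apply: ge0_ler_powR; rewrite ?nnegrE ?divr_ge0 ?(ltW tr0) ?(ltW t20)//.
      by rewrite mulr_natl mulr2n lerD2l.
  apply: ge0_subset_integral => //.
  - exact: measurable_pos.
  - by apply/measurable_EFinP; exact: measurable_funTS.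
  - move=> r r0; rewrite lee_fin mulr_ge0 ?powR_ge0// heat_ge0// addr_ge0// ltW//.
  - by move=> r /=; rewrite in_itv/= => /andP[].
(* For [t >= 1] the integrand is at least [k / t], hence at least [k t^(-b-1)], whose integral is
   the finite number [k / b]; [b] is arbitrarily small. *)
have Zge b : 0 < b -> ((k / b)%:E <= Z)%E.
  move=> b0; rewrite Zint.
  apply: (@le_trans _ _ (\int[mu]_(t in `[1%R, +oo[) (k * t `^ (- b - 1))%:E)%E).
    rewrite ge0_integralZlR ?(ltW k0)//.
    - by rewrite integral_powR_oo// powR1 -EFinM mul1r.
    - by apply: measurable_funTS; exact: measurable_powR.
    - by move=> t _; exact: powR_ge0.
  have mTT : measurable_fun (pos : set R) T.
    apply: (eq_measurable_fun (fun t => \int[mu]_(r in pos)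
        (`|heat (t + r) (0 : Zd d)| * r `^ (a' - 1))%:E)%E).
      move=> t /[!in_pos] t0; apply: eq_integral => r /[!in_pos] r0.
      by rewrite ger0_norm// heat_ge0// addr_ge0// ltW.
    apply: (@measurable_integral_snd R pos pos
        (fun t r => (`|heat (t + r) (0 : Zd d)| * r `^ (a' - 1))%:E)).
    - exact: measurable_pos.
    - apply/measurable_EFinP; apply: measurable_funM; last first.
        by apply: measurable_powR_comp; exact: measurable_snd.
      apply: (measurableT_comp (f := fun y : R => `|heat y (0 : Zd d)|)).
        by apply: measurableT_comp => //; exact: measurable_heat.
      by apply: measurable_funD; [exact: measurable_fst|exact: measurable_snd].
    - by move=> t r _; rewrite lee_fin mulr_ge0 ?powR_ge0.
  have mtT : measurable_fun (pos : set R) (fun t => (t `^ (a - 1))%:E * T t)%E.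
    apply: emeasurable_funM => //; apply/measurable_EFinP; apply: measurable_funTS.
    exact: measurable_powR.
  apply: (@le_trans _ _ (\int[mu]_(t in `[1%R, +oo[) ((t `^ (a - 1))%:E * T t))%E).
    apply: ge0_le_integral => //.
    - by move=> t _; rewrite lee_fin mulr_ge0 ?powR_ge0 ?(ltW k0).
    - by apply/measurable_EFinP; apply: measurable_funTS; exact: measurable_powRZ.
    - apply: measurable_funS mtT; first exact: measurable_pos.
      by move=> t /=; rewrite in_itv/= andbT; exact: lt_le_trans.
    - move=> t; rewrite /= in_itv/= andbT => t1; have t0 : 0 < t by apply: lt_le_trans t1.
      apply: (@le_trans _ _ ((t `^ (a - 1))%:E * (k * t `^ (a' - d%:R / 2))%:E)%E).
        rewrite -EFinM lee_fin mulrCA ler_wpM2l ?(ltW k0)// powR_mulD//.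
        by apply: ler_powR => //; lra.
      by apply: lee_wpmul2l; [rewrite lee_fin powR_ge0|exact: Tge].
  apply: ge0_subset_integral => //.
  - exact: measurable_pos.
  - by move=> t t0; rewrite mule_ge0 ?lee_fin ?powR_ge0// T0.
  - by move=> t /=; rewrite in_itv/= andbT; exact: lt_le_trans.
apply/eqP; rewrite eq_le leey/= leye_eq; apply/eqP.
case: Z Zge {ZE Zint} => [z||]// Zge; exfalso; last by have := Zge 1 ltr01; rewrite leeNy_eq.
have z0 : 0 <= z.
  by have := Zge 1 ltr01; rewrite lee_fin; apply: le_trans; rewrite divr_ge0// ltW.
(* For this [b] the lower bound [k / b] is [z + 1]. *)
have b0 : 0 < k / (z + 1) by rewrite divr_gt0// ltr_wpDl.
have := Zge _ b0; rewrite lee_fin invf_div mulrCA divff ?gt_eqF// mulr1; lra.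
Qed.

End RieszLevels.

Section Asymptotics.
Variable R : realType.

(** [rho] is the relative error. Its smallness keeps [U] above half of its main term, and the
    numerator over the common denominator is linear in the two errors. *)
Lemma ratio_expansion (U F p q rho cu cf C0 C1 : R) : 0 < p -> 0 < q -> 0 <= rho ->
  0 < cu -> 0 < cf -> 0 <= C0 -> 0 <= C1 -> C0 * rho <= cu / 2 ->
  `|U - cu * p| <= C0 * (p * rho) -> `|F - cf * q| <= C1 * (q * rho) ->
  `|F / U - cf / cu * (q / p)| <= 2 * (cu * C1 + cf * C0) / cu ^+ 2 * (q / p * rho).
Proof.
move=> p0 q0 rho0 cu0 cf0 C00 C10 small hU hF.
have Up : cu * p / 2 <= U.
  have : C0 * (p * rho) <= cu / 2 * p by rewrite mulrCA [leRHS]mulrC ler_wpM2l ?(ltW p0).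
  by move: hU; rewrite ler_norml => /andP[h _]; lra.
have cp : 0 < cu * p by rewrite mulr_gt0.
have U0 : 0 < U by lra.
rewrite (_ : F / U - cf / cu * (q / p) =
  (cu * p * (F - cf * q) - cf * q * (U - cu * p)) / (U * (cu * p))); last first.
  by field; rewrite !gt_eqF.
rewrite normrM normfV (gtr0_norm (mulr_gt0 U0 cp)) ler_pdivrMr ?mulr_gt0//.
apply: (@le_trans _ _ ((cu * C1 + cf * C0) * (p * q * rho))).
  apply: (le_trans (ler_normB _ _)); rewrite !normrM (gtr0_norm cu0) (gtr0_norm p0).
  rewrite (gtr0_norm cf0) (gtr0_norm q0) mulrDl; apply: lerD.
    rewrite [leRHS](_ : _ = cu * p * (C1 * (q * rho))); last by ring.
    by rewrite ler_wpM2l// ltW.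
  rewrite [leRHS](_ : _ = cf * q * (C0 * (p * rho))); last by ring.
  by rewrite ler_wpM2l// ltW// mulr_gt0.
rewrite [leRHS](_ : _ = (cu * C1 + cf * C0) * (q * rho) * (2 / cu * U)); last first.
  by field; rewrite !gt_eqF.
rewrite [leLHS](_ : _ = (cu * C1 + cf * C0) * (q * rho) * p); last by ring.
apply: ler_wpM2l.
  by rewrite !mulr_ge0 ?addr_ge0 ?mulr_ge0 ?(ltW cu0) ?(ltW cf0) ?(ltW q0).
rewrite mulrAC ler_pdivlMr// mulrC; lra.
Qed.

End Asymptotics.

(** * The optimal weight *)

Section HardyExponents.
Variables (R : realType) (d : nat) (sigma a0 a1 : R).
Hypotheses (sigma0 : 0 < sigma) (sigma1 : sigma <= 1) (a1_gt0 : 0 < a1).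
Hypotheses (a1E : a1 = a0 - sigma) (a0Da1 : a0 + a1 = d%:R / 2).

Lemma a0_gt0 : 0 < a0.
Proof. by rewrite -(subrK sigma a0) -a1E addr_gt0. Qed.

Lemma a0_ltd : a0 < d%:R / 2.
Proof. by rewrite -a0Da1 ltrDl. Qed.

Lemma a1_ltd : a1 < d%:R / 2.
Proof. by rewrite -a0Da1 ltrDr a0_gt0. Qed.

Lemma wsa_riesz : wsa sigma a0 = (fun x : Zd d => riesz a1 x / riesz a0 x).
Proof.
apply/funext => x; rewrite /wsa (kappaN _ a0_gt0).
by rewrite (_ : sigma - a0 = - a1) ?(kappaN _ a1_gt0)// a1E opprB.
Qed.

(** Collects the hypotheses of the abstract form, merging the cases [sigma = 1] and [sigma < 1]. *)
Lemma kernel_facts : exists m : R, [/\ (forall z : Zd d, 0 <= kappa sigma z),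
  (forall z : Zd d, kappa sigma (- z) = kappa sigma z),
  (\esum_(z in [set: Zd d]) (kappa sigma z)%:E = m%:E)%E,
  (forall i : 'I_d, 0 < kappa sigma (unitv i)) &
  (forall x : Zd d, ((m * riesz a0 x)%:E = (riesz a1 x)%:E +
    \esum_(y in setT) (kappa sigma (x - y) * riesz a0 y)%:E)%E)].
Proof.
move: sigma1; rewrite le_eqVlt => /predU1P[s1|s1].
  exists (2 * d%:R); rewrite a1E s1; split.
  - by move=> z; rewrite kappa1E sumr_ge0// => i _; rewrite addr_ge0.
  - by move=> z; rewrite !kappa1E nbrN.
  - exact: kappa1_mass.
  - by move=> i; rewrite kappa1E nbr_unitv.
  - have a01 : 1 < a0 by rewrite -s1 -subr_gt0 -a1E.
    move=> x; apply: kappa_one_identity => //; last exact: a0_ltd.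
    exact: lt_trans a0_ltd.
rewrite a1E; eexists; split.
- exact: kappa_frac_ge0.
- exact: kappa_frac_sym.
- exact: kappa_frac_mass.
- move=> i; apply: kappa_frac_gt0 => //; apply/eqP => /(congr1 (fun z : Zd d => z 0 i)).
  by rewrite unitv_entry eqxx mxE.
- by move=> x; apply: kappa_frac_identity => //; [rewrite -subr_gt0 -a1E|exact: a0_ltd].
Qed.

Lemma wsa_optimal : @optimal_hardy_weight R d sigma (wsa sigma a0).
Proof.
have [m [k0 ksym km kunit eqn]] := kernel_facts.
have u0 (x : Zd d) : 0 < riesz a0 x by apply: riesz_gt0; [exact: a0_gt0|exact: a0_ltd].
have f0 (x : Zd d) : 0 <= riesz a1 x by apply: riesz_ge0; exact: a1_gt0.
rewrite wsa_riesz; split; [split|split].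
- by move=> x; rewrite divr_ge0// ltW.
- exact: (hardy_ineq k0 ksym km u0 f0 eqn).
- move=> w' [w'0 hw'] ww'.
  have [C hC] := @riesz_level_bound R d a0 a1 a0_gt0 a0_ltd a1_gt0 a1_ltd a0Da1.
  apply: (@critical _ _ _ _ _ _ k0 ksym km u0 f0 eqn C) => //.
  + by move=> e e0; apply: riesz_level_finite => //; [exact: a0_gt0|exact: a0_ltd].
- move=> [v [[un [unf unc]] [v0 vE]]]; apply: v0.
  apply: (null_critical k0 ksym km u0 f0 eqn kunit unf unc _ vE).
  by apply: riesz_product_diverges; [exact: a0_gt0|exact: a0_ltd|exact: a1_gt0|exact: a1_ltd|exact: a0Da1].
Qed.

(** The quotient [Gamma_pos a0 / Gamma_pos a1] arises twice, from the Gaussian integrals and from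
    the normalisation of [riesz]; hence the squares. The power of 4 is [4^(a0 - a1)], and [A]
    cancels. *)
Lemma wsa_expansion : exists C r : R, forall x : Zd d, r <= @enorm R d x ->
  `| wsa sigma a0 x - (4 `^ sigma * (Gamma_pos a0 ^+ 2 / Gamma_pos a1 ^+ 2))
     / enorm R x `^ (2 * sigma) | <= C / enorm R x `^ (2 * sigma + 2).
Proof.
have [A A0 hA] := @kint_asymp R d.
have [C0 h0] := hA a0 a0_gt0 a0_ltd; have [C1 h1] := hA a1 a1_gt0 a1_ltd.
have e0 : d%:R / 2 - a0 = a1 by rewrite -a0Da1 addrC addKr.
have e1 : d%:R / 2 - a1 = a0 by rewrite -a0Da1 addrK.
rewrite e0 in h0; rewrite e1 in h1.
have G0 := Gamma_pos_gt0 a0_gt0; have G1 := Gamma_pos_gt0 a1_gt0.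
have [g0 g0E] : exists g, Gamma_pos a0 = g by exists (Gamma_pos a0).
have [g1 g1E] : exists g, Gamma_pos a1 = g by exists (Gamma_pos a1).
have wE (x : Zd d) : wsa sigma a0 x = (fine (kint a1 x) / g1) / (fine (kint a0 x) / g0).
  by rewrite wsa_riesz /riesz g0E g1E.
rewrite g0E in G0 h1 *; rewrite g1E in G1 h0 *; clear g0E g1E.
pose cu := A * (4 `^ a1 * g1); pose cf := A * (4 `^ a0 * g0).
have cu0 : 0 < cu by rewrite mulr_gt0// mulr_gt0// powR_gt0.
have cf0 : 0 < cf by rewrite mulr_gt0// mulr_gt0// powR_gt0.
pose K := 2 * (cu * `|C1| + cf * `|C0|) / cu ^+ 2.
(* From this radius on, [|C0| / r <= cu / 2] and [r >= 1], so the relative error [|C0| r^(-2)] meets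
   the smallness condition of [ratio_expansion]. *)
exists (g0 / g1 * K), (1 + 2 * `|C0| / cu) => x; rewrite wE.
move: (h0 x) (h1 x); move: (fine (kint a0 x)) (fine (kint a1 x)) (enorm R x) => U F r h0x h1x hr.
have q0 : 0 <= 2 * `|C0| / cu by rewrite divr_ge0 ?(ltW cu0)// mulr_ge0.
have r1 : 1 <= r by apply: le_trans hr; rewrite lerDl.
have r0 : 0 < r by apply: lt_le_trans r1.
pose rho := r `^ (- 2).
have rhoE : rho = r^-1 * r^-1 by rewrite /rho powRN (powR_mulrn 2 (ltW r0)) expr2 invfM.
have small : `|C0| * rho <= cu / 2.
  have h : `|C0| * r^-1 <= cu / 2.
    rewrite ler_pdivrMr// mulrC -ler_pdivrMr ?divr_gt0//.
    rewrite invf_div mulrCA mulrA; lra.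
  rewrite rhoE mulrA; apply: le_trans h; rewrite ler_piMr ?mulr_ge0 ?invr_ge0 ?(ltW r0)//.
  by rewrite invf_le1.
have p0 : 0 < r `^ (- (2 * a1)) by rewrite powR_gt0.
have p1 : 0 < r `^ (- (2 * a0)) by rewrite powR_gt0.
have rho0 : 0 <= rho by exact: powR_ge0.
have hu : `|U - cu * r `^ (- (2 * a1))| <= `|C0| * (r `^ (- (2 * a1)) * rho).
  rewrite powR_mulD// -opprD; apply: (le_trans (h0x r1)).
  by rewrite ler_wpM2r ?powR_ge0 ?ler_norm.
have hf : `|F - cf * r `^ (- (2 * a0))| <= `|C1| * (r `^ (- (2 * a0)) * rho).
  rewrite powR_mulD// -opprD; apply: (le_trans (h1x r1)).
  by rewrite ler_wpM2r ?powR_ge0 ?ler_norm.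
have := ratio_expansion p0 p1 rho0 cu0 cf0 (normr_ge0 C0) (normr_ge0 C1) small hu hf.
have qp : r `^ (- (2 * a0)) / r `^ (- (2 * a1)) = r `^ (- (2 * sigma)).
  by rewrite -powRN powR_mulD//; congr (_ `^ _); rewrite a1E; ring.
have s4 : 4 `^ a0 / 4 `^ a1 = 4 `^ sigma :> R.
  by rewrite -powRN powR_mulD//; congr (_ `^ _); rewrite a1E; ring.
rewrite qp powR_mulD// -opprD -/K => h.
rewrite -!powRN.
rewrite [X in `|X|](_ : _ = g0 / g1 * (F / U -
    cf / cu * r `^ (- (2 * sigma)))); last first.
  rewrite -s4 /cf /cu.
  have F0 : 4 `^ a1 != 0 :> R by rewrite gt_eqF// powR_gt0.
  have U0 : g0 != 0 by rewrite gt_eqF.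
  have U1 : g1 != 0 by rewrite gt_eqF.
  have A1 : A != 0 by rewrite gt_eqF.
  rewrite invfM invrK mulrBr; congr (_ - _); first by ring.
  by field; rewrite F0 U1 A1.
have g01 : 0 <= g0 / g1 by rewrite divr_ge0// ltW.
by rewrite normrM (ger0_norm g01) -[leRHS]mulrA ler_wpM2l.
Qed.

End HardyExponents.

Theorem theorem1p1 (R : realType) (d : nat) (sigma : R) :
  (0 < d)%N -> 0 < sigma -> sigma <= 1 ->
  ((d <= 2)%N -> sigma < d%:R / 2) ->
  let alpha0 := (d%:R / 2 + sigma) / 2 in
  @optimal_hardy_weight R d sigma (@wsa R d sigma alpha0) /\
  exists C : R, exists r : R, forall x : Zd d, r <= @enorm R d x ->
    `| @wsa R d sigma alpha0 x
       - (4 `^ sigma * (Gamma (d%:R / 4 + sigma / 2) ^+ 2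
                         / Gamma (d%:R / 4 - sigma / 2) ^+ 2))
         / @enorm R d x `^ (2 * sigma) |
    <= C / @enorm R d x `^ (2 * sigma + 2).
Proof.
move=> d0 s0 s1 hd /=.
(* For [d >= 3] this is automatic, as [sigma <= 1 < 3 / 2]. *)
have sd : sigma < d%:R / 2.
  have [/hd//|d3] := leqP d 2.
  have : 3%:R <= d%:R :> R by rewrite ler_nat.
  by lra.
set a0 := (d%:R / 2 + sigma) / 2; set a1 := a0 - sigma.
have a1_gt0 : 0 < a1.
  rewrite (_ : a1 = (d%:R / 2 - sigma) / 2); last by rewrite /a1 /a0; field.
  by rewrite divr_gt0// subr_gt0.
have a0Da1 : a0 + a1 = d%:R / 2 by rewrite /a1 /a0; field.
have a0_gt0 : 0 < a0 by rewrite /a0 divr_gt0// addr_gt0// (lt_trans s0).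
split; first exact: (wsa_optimal s0 s1 a1_gt0 erefl a0Da1).
have [C [r h]] := wsa_expansion s0 a1_gt0 erefl a0Da1.
have GE (b : R) : 0 < b -> Gamma b = Gamma_pos b by move=> b0; rewrite /Gamma b0.
exists C, r => x /h.
have e0 : d%:R / 4 + sigma / 2 = a0 by rewrite /a0; field.
have e1 : d%:R / 4 - sigma / 2 = a1 by rewrite /a1 /a0; field.
by rewrite e0 e1 !GE.
Qed.
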